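(* There exists a canonical basis $\mathbf B(\mathbf S_v)=\{\{\phi^g_{\gamma\nu}\}:(\gamma,g,\nu)\in\Xi\}$ for $\mathbf S_v$ (an $\mathcal A$-basis), which is characterized by the following two properties: for every $(\gamma,g,\nu)\in\Xi$, $$\overline{\{\phi^g_{\gamma\nu}\}}=\{\phi^g_{\gamma\nu}\},\qquad \{\phi^g_{\gamma\nu}\}\in[\phi^g_{\gamma\nu}]+\sum_{y<g}v\mathbb Z[v]\,[\phi^y_{\gamma\nu}]\quad(y\in\mathcal D_{\gamma\nu}).$$
   Context: Let $\Phi$ be a root system with simple roots $\alpha_1,\dots,\alpha_d$, positive roots $\Phi^+$, unique highest root $\theta$, $\theta^\vee=2\theta/(\theta,\theta)$, coweight lattice $\check X$, dominant coweights $\check X^{\mathrm{dom}}=\{\mathbf i\in\check X:\langle\alpha_k,\mathbf i\rangle\in\mathbb N,\ 1\le k\le d\}$, and Weyl group $W=\langle s_1,\dots,s_d\rangle$. The extended affine Weyl group is $\widetilde W=\check X\rtimes W=\{t_{\mathbf i}w\}$ with $t_{\mathbf i}t_{\mathbf j}=t_{\mathbf i+\mathbf j}$, $wt_{\mathbf i}=t_{w(\mathbf i)}w$. Put $s_0=t_{\theta^\vee}s_\theta$ ($s_\theta$ the reflection in $\theta$), $W_{\mathrm{aff}}=\langle s_0,\dots,s_d\rangle$. Then $\widetilde W=\Omega\ltimes W_{\mathrm{aff}}$ with $\Omega$ finite abelian, $\ell$ is the length function on $\widetilde W$ with $\ell(s_i)=1$ ($0\le i\le d$) and $\Omega=\{w:\ell(w)=0\}$,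 and $<$ is the Bruhat order on $\widetilde W$. Fix an integer $n\ge2$; $\widetilde W$ acts on $\check X$ from the right by $\mathbf j w=w^{-1}(\mathbf j)$ ($w\in W$), $\mathbf j t_{\mathbf i}=\mathbf j-n\mathbf i$. Let $\mathcal A=\mathbb Z[v,v^{-1}]$. $\widetilde{\mathbf H}$ is the $\mathcal A$-algebra with free basis $\{H_w\}_{w\in\widetilde W}$, $H_wH_{w'}=H_{ww'}$ if $\ell(ww')=\ell(w)+\ell(w')$, $(H_{s_i}-v^{-1})(H_{s_i}+v)=0$ ($0\le i\le d$). Its bar involution is the $\mathbb Z$-algebra automorphism with $\overline v=v^{-1}$, $\overline{H_{s_k}}=H_{s_k}^{-1}$ ($0\le k\le d$), $\overline{H_\sigma}=H_\sigma$ ($\sigma\in\Omega$). For $\mathbf i=\mathbf j-\mathbf k$ with $\mathbf j,\mathbf k\in\check X^{\mathrm{dom}}$ put $\theta_{\mathbf i}=H_{t_{\mathbf j}}H_{t_{\mathbf k}}^{-1}$. Fix an arbitrary $\widetilde W$-invariant subset $\check X_{\mathtt f}\subset\check X$; $\Lambda_{\mathtt f}$ is the (finite) set of its $\widetilde W$-orbits. Let $F=\{\mathbf i\in\check X:-n<\frac{2(\mathbf i,\alpha)}{(\alpha,\alpha)}\le0\ \forall\alpha\in\Phi^+\}$, where $F\cap\check X_{\mathtt f}$ is taken as a fundamental domain for $\widetilde W$ on $\check X_{\mathtt f}$, and $F_{\mathtt f}=W(F\cap\check X_{\mathtt f})$. Each $W$-orbit in $F_{\mathtt f}$ contains a unique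 anti-dominant element and determines a unique $\widetilde W$-orbit $\gamma\in\Lambda_{\mathtt f}$; the anti-dominant element is denoted $\mathbf i_\gamma$, and $\gamma\mapsto\mathbf i_\gamma$ is the resulting bijection from $\Lambda_{\mathtt f}$ to the anti-dominant elements of $F_{\mathtt f}$. $\mathbf T_{\mathtt f}=\bigoplus_{\mathbf i\in\check X_{\mathtt f}}\mathcal Au_{\mathbf i}$, with right $\widetilde{\mathbf H}$-action determined by: for $\mathbf i\in F_{\mathtt f}$, $1\le k\le d$, $u_{\mathbf i}H_{s_k}$ equals $v^{-1}u_{\mathbf i}$ if $\mathbf is_k=\mathbf i$, $u_{\mathbf is_k}$ if $\mathbf is_k\succ\mathbf i$, and $u_{\mathbf is_k}+(v^{-1}-v)u_{\mathbf i}$ if $\mathbf is_k\prec\mathbf i$ ($\succ$ the dominance order: $\mathbf is_k\succ\mathbf i$ means $\langle\alpha_k,\mathbf i\rangle<0$); and $u_{\mathbf i}\theta_{\mathbf j}=u_{\mathbf i-n\mathbf j}$ for $\mathbf i\in\check X_{\mathtt f}$, $\mathbf j\in\check X$. The affine $q$-Schur algebra is $\mathbf S_v=\mathrm{End}_{\widetilde{\mathbf H}}(\mathbf T_{\mathtt f})$. For $\gamma\in\Lambda_{\mathtt f}$ let $J_\gamma=\{0\le k\le d:\mathbf i_\gamma s_k=\mathbf i_\gamma\}$ (a proper subset of $\{0,\dots,d\}$), $W_\gamma=\langle s_k:k\in J_\gamma\rangle$ (finite, longest element $w_\circ^\gamma$), $x_\gamma=\sum_{w\in W_\gamma}v^{\ell(w_\circ^\gamma)-\ell(w)}H_w$.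 Via the isomorphism of right $\widetilde{\mathbf H}$-modules $\mathbf T_{\mathtt f}\cong\bigoplus_\gamma x_\gamma\widetilde{\mathbf H}$, $u_{\mathbf i_\gamma}\mapsto x_\gamma$, one identifies $\mathbf S_v=\bigoplus_{\gamma,\nu\in\Lambda_{\mathtt f}}\mathrm{Hom}_{\widetilde{\mathbf H}}(x_\nu\widetilde{\mathbf H},x_\gamma\widetilde{\mathbf H})$. $\mathcal D_{\gamma\nu}$ is the set of minimal length double coset representatives of $W_\gamma\backslash\widetilde W/W_\nu$, $\Xi=\{(\gamma,g,\nu):\gamma,\nu\in\Lambda_{\mathtt f},g\in\mathcal D_{\gamma\nu}\}$, and $g^+_{\gamma\nu}$ is the longest element of $W_\gamma gW_\nu$. For $(\gamma,g,\nu)\in\Xi$, $\phi^g_{\gamma\nu}\in\mathbf S_v$ is determined by $\phi^g_{\gamma\nu}(x_{\nu'})=\delta_{\nu,\nu'}v^{\ell(w_\circ^\nu)}\sum_{w\in W_\gamma gW_\nu}v^{-\ell(w)}H_w$; put $[\phi^g_{\gamma\nu}]=v^{\ell(g^+_{\gamma\nu})-\ell(w_\circ^\nu)}\phi^g_{\gamma\nu}$ (standard basis). The bar involution on $\mathbf S_v$ sends $f\in\mathrm{Hom}_{\widetilde{\mathbf H}}(x_\nu\widetilde{\mathbf H},x_\gamma\widetilde{\mathbf H})$ to the $\widetilde{\mathbf H}$-linear map $\overline f$ in the same Hom-space with $\overline f(x_\nu)=\overline{f(x_\nu)}$. *)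

(* Defs.v *)
From HB Require Import structures.
From mathcomp Require Import all_boot all_order all_algebra.
From mathcomp Require Import finmap ring.
From mathcomp Require Import boolp classical_sets functions fsbigop reals.
From Stdlib Require Import Relation_Operators.

Set Implicit Arguments.
Unset Strict Implicit.
Unset Printing Implicit Defensive.

Import Order.TTheory GRing.Theory Num.Theory.

Local Notation "p %:F" := (@FracField.tofrac _ p) : ring_scope.
Local Open Scope classical_set_scope.
Local Open Scope ring_scope.

Definition nncomb (M : nmodType) (d : nat) (a : 'I_d -> M) (x : M) : Prop :=
  exists c : 'I_d -> nat, x = \sum_k a k *+ c k.

(* Reduced crystallographic root systems in a Euclidean space V, with a base
   and a highest root.  The existence of a highest root forces the root system
   to be irreducible, and d >= 1.  V is identified with its dual by the scalar
   product [dot], which is not normalised. *)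
Record rootSystem (R : realType) (V : vectType R) (d : nat) := RootSystem {
  dot : V -> V -> R;
  dotC : forall x y, dot x y = dot y x;
  dotDZ : forall a x y z, dot (a *: x + y) z = a * dot x z + dot y z;
  dot_gt0 : forall x, x != 0 -> 0 < dot x x;
  root : {fset V};
  root_neq0 : 0 \notin root;
  root_refl : forall a b, a \in root -> b \in root ->
    b - (2 * dot b a / dot a a) *: a \in root;
  root_int : forall a b, a \in root -> b \in root ->
    2 * dot b a / dot a a \is a Num.int;
  root_reduced : forall a c, a \in root -> c *: a \in root ->
    c = 1 \/ c = -1;
  simple : 'I_d -> V;
  simple_basis : basis_of fullv [tuple simple k | k < d];
  simple_root : forall k, simple k \in root;
  root_sign : forall b, b \in root -> nncomb simple b \/ nncomb simple (- b);
  highest : V;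
  highest_root : highest \in root;
  highest_max : forall b, b \in root -> nncomb simple (highest - b)
}.

Definition laurent_pred : {pred {fraction {poly int}}} := fun x =>
  `[< exists (p : {poly int}) (m : nat), x = p%:F / 'X%:F ^+ m >].

Record laurent := Laurent {
  laurent_val :> {fraction {poly int}};
  laurent_valP : laurent_val \in laurent_pred
}.

Lemma fracX_neq0 : 'X%:F != 0 :> {fraction {poly int}}.
Proof. by rewrite fraction.tofrac_eq0 polyX_eq0. Qed.

Fact laurent_subring : subring_closed laurent_pred.
Proof.
split.
- by apply/asboolP; exists 1, 0%N; rewrite expr0 divr1 rmorph1.
- move=> x y /asboolP[p [m ->]] /asboolP[q [l ->]]; apply/asboolP.
  exists (p * 'X ^+ l - q * 'X ^+ m), (m + l)%N.
  rewrite rmorphB !rmorphM !rmorphXn /= mulrBl exprD invfM.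
  have Xn k : 'X%:F ^+ k != 0 :> {fraction {poly int}}.
    by rewrite expf_neq0 ?fracX_neq0.
  congr (_ - _).
    by rewrite mulrACA divff ?mulr1 ?Xn.
  by rewrite [X in _ = _ * X]mulrC mulrACA divff ?mulr1 ?Xn.
- move=> x y /asboolP[p [m ->]] /asboolP[q [l ->]]; apply/asboolP.
  exists (p * q), (m + l)%N.
  by rewrite rmorphM exprD invfM mulrACA.
Qed.
HB.instance Definition _ :=
  GRing.isSubringClosed.Build _ laurent_pred laurent_subring.

HB.instance Definition _ := [isSub for laurent_val].
HB.instance Definition _ := [Choice of laurent by <:].
HB.instance Definition _ := [SubChoice_isSubComNzRing of laurent by <:].

Definition laurent_unit : {pred laurent} := fun x =>
  `[< exists y, y * x = 1 >].
Definition laurent_inv (x : laurent) : laurent :=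
  xget x [set y | y * x = 1].

Fact laurent_mulVx : {in laurent_unit, left_inverse 1 laurent_inv *%R}.
Proof. by move=> x /asboolP xU; apply: (xgetPex x xU). Qed.
Fact laurent_unitPl (x y : laurent) : y * x = 1 -> laurent_unit x.
Proof. by move=> yx; apply/asboolP; exists y. Qed.
Fact laurent_inv_out : {in [predC laurent_unit], laurent_inv =1 id}.
Proof.
move=> x /asboolPn xNU; rewrite /laurent_inv; case: xgetP => // y _ yx.
by case: xNU; exists y.
Qed.
HB.instance Definition _ := GRing.ComNzRing_hasMulInverse.Build laurent
  laurent_mulVx laurent_unitPl laurent_inv_out.

Fact laurent_vP : 'X%:F \in laurent_pred.
Proof. by apply/asboolP; exists 'X, 0%N; rewrite expr0 divr1. Qed.

Definition v : laurent := Laurent laurent_vP.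

Lemma v_unit : v \is a GRing.unit.
Proof.
have vVP : 'X%:F^-1 \in laurent_pred.
  by apply/asboolP; exists 1, 1%N; rewrite rmorph1 mul1r expr1.
apply/asboolP; exists (Laurent vVP); apply/val_inj => /=.
exact: mulVf fracX_neq0.
Qed.

Definition vZv : set laurent :=
  [set a | exists p : {poly int}, a = v * (map_poly intr p).[v]].

(* The restriction to P of the family b is a basis of M. *)
Definition is_basis (A : nzRingType) (M : lmodType A) (I : choiceType)
    (P : set I) (b : I -> M) : Prop :=
  forall m : M, exists! c : {fsfun I -> A with 0},
    (forall i, i \in finsupp c -> P i) /\
    m = \sum_(i <- finsupp c) c i *: b i.

Section RootSystem.
Variables (R : realType) (V : vectType R) (d : nat) (Phi : rootSystem V d).

Local Notation "<< x , y >>" := (dot Phi x y) (format "<< x ,  y >>").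
Local Notation root := (root Phi).
Local Notation simple := (simple Phi).
Local Notation highest := (highest Phi).

Definition posroot (b : V) : Prop := b \in root /\ nncomb simple b.

Lemma dotDZr a x y z : <<z, a *: x + y>> = a * <<z, x>> + <<z, y>>.
Proof. by rewrite dotC dotDZ ![<<z, _>>]dotC. Qed.

Lemma dotD x y z : <<x + y, z>> = <<x, z>> + <<y, z>>.
Proof. by rewrite -[x]scale1r dotDZ mul1r scale1r. Qed.

Lemma dot0 z : <<0, z>> = 0.
Proof. by apply: (addrI <<0, z>>); rewrite -dotD !addr0. Qed.

Lemma dotZ a x z : <<a *: x, z>> = a * <<x, z>>.
Proof. by rewrite -[a *: x]addr0 dotDZ dot0 addr0. Qed.

Lemma dotN x z : <<- x, z>> = - <<x, z>>.
Proof. by rewrite -scaleN1r dotZ mulN1r. Qed.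

Lemma dotDr x y z : <<z, x + y>> = <<z, x>> + <<z, y>>.
Proof. by rewrite dotC dotD ![<<z, _>>]dotC. Qed.

Lemma dotZr a x z : <<z, a *: x>> = a * <<z, x>>.
Proof. by rewrite dotC dotZ [<<z, _>>]dotC. Qed.

Lemma dotNr x z : <<z, - x>> = - <<z, x>>.
Proof. by rewrite dotC dotN [<<z, _>>]dotC. Qed.

Lemma dot0r z : <<z, 0>> = 0. Proof. by rewrite dotC dot0. Qed.

Lemma root_norm_neq0 a : a \in root -> <<a, a>> != 0.
Proof.
move=> aP; rewrite gt_eqF // dot_gt0 //.
by apply: contraNneq (root_neq0 Phi) => <-.
Qed.

Definition refl_fun (a x : V) : V := x - (2 * <<x, a>> / <<a, a>>) *: a.

Fact refl_fun_linear a : linear (refl_fun a).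
Proof.
move=> c x y; rewrite /refl_fun dotDZ mulrDr mulrDl scalerDl scalerBr opprD.
rewrite addrACA; congr (_ - _ + _).
by rewrite scalerA !mulrA [2 * c]mulrC.
Qed.
HB.instance Definition _ a :=
  GRing.isLinear.Build R V V *:%R (refl_fun a) (refl_fun_linear a).

Definition refl (a : V) : 'End(V) := linfun (refl_fun a).

Lemma reflE a x : refl a x = x - (2 * <<x, a>> / <<a, a>>) *: a.
Proof. by rewrite lfunE. Qed.

Lemma dot_refl a x y : <<refl a x, y>> = <<x, refl a y>>.
Proof.
rewrite !reflE dotD dotDr dotN dotNr dotZ dotZr [<<y, a>>]dotC; ring.
Qed.

Lemma reflK a : a \in root -> involutive (refl a).
Proof.
move=> aP x; rewrite !reflE dotD dotN dotZ divfK ?root_norm_neq0 //.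
have -> : 2 * (<<x, a>> - 2 * <<x, a>>) / <<a, a>>
  = - (2 * <<x, a>> / <<a, a>>) by ring.
by rewrite scaleNr opprK subrK.
Qed.

Lemma refl_root a b : a \in root -> b \in root -> refl a b \in root.
Proof. by move=> aP bP; rewrite reflE root_refl. Qed.

Definition simple_word (s : seq 'I_d) : 'End(V) :=
  foldr (fun k f => (refl (simple k) \o f)%VF) \1%VF s.

Definition weyl_pred : {pred 'End(V)} := fun f =>
  `[< exists s : seq 'I_d, f = simple_word s >].

Record weyl := Weyl {
  weyl_val :> 'End(V);
  weyl_valP : weyl_val \in weyl_pred
}.
HB.instance Definition _ := [isSub for weyl_val].
HB.instance Definition _ := [Choice of weyl by <:].

Lemma simple_word_cat s t :
  simple_word (s ++ t) = (simple_word s \o simple_word t)%VF.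
Proof. by elim: s => /= [|k s ->]; rewrite ?comp_lfun1l ?comp_lfunA. Qed.

Lemma simple_wordVK s : (simple_word (rev s) \o simple_word s = \1)%VF.
Proof.
elim: s => /= [|k s IH]; first by rewrite comp_lfun1l.
rewrite rev_cons -cats1 simple_word_cat /= comp_lfun1r.
rewrite -comp_lfunA [X in (_ \o X)%VF]comp_lfunA.
suff -> : (refl (simple k) \o refl (simple k) = \1)%VF by rewrite comp_lfun1l.
by apply/lfunP => x; rewrite comp_lfunE id_lfunE reflK ?simple_root.
Qed.

Fact weyl_one_subproof : \1%VF \in weyl_pred.
Proof. by apply/asboolP; exists [::]. Qed.
Fact weyl_mul_subproof (f g : weyl) :
  (weyl_val f \o weyl_val g)%VF \in weyl_pred.
Proof.
case: f g => [_ /= /asboolP[s ->]] [_ /= /asboolP[t ->]].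
by apply/asboolP; exists (s ++ t); rewrite simple_word_cat.
Qed.
Lemma simple_word_inv s : ((simple_word s)^-1 = simple_word (rev s))%VF.
Proof.
have sK : cancel (simple_word s) (simple_word (rev s)).
  by move=> x; rewrite -comp_lfunE simple_wordVK id_lfunE.
have ker0 : lker (simple_word s) == 0%VS by apply/lker0P; apply: can_inj sK.
rewrite -[LHS]comp_lfun1l -(simple_wordVK s) -comp_lfunA.
by rewrite lker0_compfV ?comp_lfun1r.
Qed.
Fact weyl_inv_subproof (f : weyl) : (weyl_val f)^-1%VF \in weyl_pred.
Proof.
case: f => [_ /= /asboolP[s ->]].
by apply/asboolP; exists (rev s); rewrite simple_word_inv.
Qed.

Definition weyl_one := Weyl weyl_one_subproof.
Definition weyl_mul f g := Weyl (weyl_mul_subproof f g).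
Definition weyl_inv f := Weyl (weyl_inv_subproof f).

Fact weyl_mulA : associative weyl_mul.
Proof. by move=> f g h; apply/val_inj/comp_lfunA. Qed.
Fact weyl_mul1 : left_id weyl_one weyl_mul.
Proof. by move=> f; apply/val_inj/comp_lfun1l. Qed.
Fact weyl_mulr1 : right_id weyl_one weyl_mul.
Proof. by move=> f; apply/val_inj/comp_lfun1r. Qed.
Fact weyl_mulV : left_inverse weyl_one weyl_inv weyl_mul.
Proof.
move=> [f fP]; apply/val_inj => /=; have /asboolP[s ->] := fP.
by rewrite simple_word_inv simple_wordVK.
Qed.
Fact weyl_mulVr : right_inverse weyl_one weyl_inv weyl_mul.
Proof.
move=> [f fP]; apply/val_inj => /=; have /asboolP[s ->] := fP.
by rewrite simple_word_inv -[s in X in (X \o _)%VF]revK simple_wordVK.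
Qed.
HB.instance Definition _ := isGroup.Build weyl
  weyl_mulA weyl_mul1 weyl_mulr1 weyl_mulV weyl_mulVr.

Lemma simple_free (a b : 'I_d -> R) :
  \sum_k a k *: simple k = \sum_k b k *: simple k -> a =1 b.
Proof.
move=> ab k; have /basis_free/freeP fr := simple_basis Phi.
apply/eqP; rewrite -subr_eq0; apply/eqP.
apply: (fr (fun k => a k - b k)); under eq_bigr => i _.
  rewrite -tnth_nth tnth_mktuple scalerBl; over.
by rewrite sumrB ab subrr.
Qed.

Lemma refl_posroot b : posroot b -> refl b \in weyl_pred.
Proof.
case=> bP [c bE]; have [h] := ubnP (\sum_k c k).
elim: h => // h IH in b c bP bE *; rewrite ltnS => ch.
have simpleP k : b = simple k -> refl b \in weyl_pred.
  by move=> ->; apply/asboolP; exists [:: k]; rewrite /= comp_lfun1r.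
have [k bk] : exists k, 0 < <<b, simple k>>.
  apply/existsP; apply: contraT; rewrite negb_exists => /forallP bn.
  have bN0 : b != 0 by apply: contraTneq bP => ->; apply: root_neq0.
  have := dot_gt0 Phi bN0; rewrite {2}bE.
  have -> : <<b, \sum_k simple k *+ c k>> = \sum_k <<b, simple k>> *+ c k.
    elim/big_rec2: _ => [|i y1 y2 _ <-]; first by rewrite dot0r.
    by rewrite dotDr -scaler_nat dotZr mulr_natl.
  rewrite ltNge => /negP[]; apply: sumr_le0 => i _.
  by apply: mulrn_wle0; rewrite leNgt.
have kP := simple_root Phi k.
have kk : 0 < <<simple k, simple k>>.
  by rewrite dot_gt0 //; apply: contraTneq kP => ->; apply: root_neq0.
have /intrP[z zE] := root_int kP bP.
have z0 : 0 < z.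
  by rewrite -(ltr0z R) -zE divr_gt0 // mulr_gt0.
have b'P := refl_root kP bP.
have b'E : refl (simple k) b = \sum_j ((c j)%:R - (z *+ (j == k))%:~R) *: simple j.
  rewrite reflE zE {1}bE.
  under [RHS]eq_bigr do rewrite scalerBl scaler_nat.
  rewrite sumrB; congr (_ - _).
  rewrite (bigD1 k) //= eqxx big1 ?addr0 // => i ik.
  by rewrite (negPf ik) mulr0n scale0r.
case: (root_sign b'P) => -[c' c'E].
- have ck j : (c' j)%:Z = (c j)%:Z - z *+ (j == k).
    have : (c' j)%:R = (c j)%:R - (z *+ (j == k))%:~R :> R.
      move: j; apply: simple_free; rewrite -b'E c'E.
      by apply: eq_bigr => j _; rewrite scaler_nat.
    by rewrite !pmulrn -intrB => /eqP; rewrite eqr_int => /eqP.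
  have c'c : (\sum_j c' j < \sum_j c j)%N.
    rewrite [X in (X < _)%N](bigD1 k) //= [X in (_ < X)%N](bigD1 k) //=.
    have -> : (\sum_(i | i != k) c' i = \sum_(i | i != k) c i)%N.
      apply: eq_bigr => i ik; apply/eqP; rewrite -eqz_nat ck (negPf ik).
      by rewrite mulr0n subr0.
    by rewrite ltn_add2r -ltz_nat ck eqxx mulr1n gtrBl.
  have /asboolP[s sE] := IH _ _ b'P c'E (leq_trans c'c ch).
  apply/asboolP; exists (k :: rcons s k).
  rewrite /= -cats1 simple_word_cat /= comp_lfun1r -sE.
  apply/lfunP => x; rewrite !comp_lfunE.
  rewrite [refl (refl _ _) _]reflE linearB linearZ /= !reflK //.
  by rewrite reflE !dot_refl !reflK.
- have cN j : j != k -> c j = 0%N.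
    move=> jk; apply/eqP.
    have : (c' j)%:R = - ((c j)%:R - (z *+ (j == k))%:~R) :> R.
      move: {jk} j; apply: simple_free.
      under eq_bigr do rewrite scaler_nat.
      rewrite -c'E b'E -sumrN; apply: eq_bigr => j _.
      by rewrite scaleNr.
    rewrite (negPf jk) mulr0n subr0 => /eqP.
    by rewrite -subr_eq0 opprK -natrD pnatr_eq0 addn_eq0 => /andP[].
  have bE' : b = (c k)%:R *: simple k.
    rewrite bE (bigD1 k) //= big1 ?addr0 ?scaler_nat // => i ik.
    by rewrite cN // mulr0n.
  have [c1|c1] : (c k)%:R = 1 :> R \/ (c k)%:R = -1 :> R.
  + by apply: (root_reduced kP); rewrite -bE'.
  + by apply: (simpleP k); rewrite bE' c1 scale1r.
  + have : 0 <= (c k)%:R :> R by rewrite ler0n.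
    by rewrite c1 lerNr oppr0 ler10.
Qed.

Lemma highest_pos : posroot highest.
Proof.
split; first exact: highest_root.
case: (root_sign (highest_root Phi)) => // -[c cE].
have [k] : exists k : 'I_d, true.
  apply/existsP; apply: contraT => /existsPn dP.
  have := root_neq0 Phi; rewrite -[0]opprK -[X in - X](_ : - highest = _).
    by rewrite opprK highest_root.
  by rewrite cE big1 ?oppr0 // => i; have := dP i.
move=> _; have [c' c'E] := highest_max (simple_root Phi k).
have : (fun j => (c' j + c j + (j == k))%:R : R) =1 (fun=> 0).
  apply: simple_free; rewrite [RHS]big1 => [|j _]; last by rewrite scale0r.
  under eq_bigr do rewrite scaler_nat !mulrnDr.
  rewrite !big_split /= -c'E -cE (bigD1 k) //= eqxx big1 => [|j jk].
    by rewrite addr0 addrAC subrK subrr.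
  by rewrite (negPf jk).
by move/(_ k)/eqP; rewrite eqxx addn1 pnatr_eq0.
Qed.

Fact simple_refl_subproof k : refl (simple k) \in weyl_pred.
Proof. by apply/asboolP; exists [:: k]; rewrite /= comp_lfun1r. Qed.

Definition srefl (k : 'I_d) : weyl := Weyl (simple_refl_subproof k).
Definition hrefl : weyl := Weyl (refl_posroot highest_pos).

Definition coweight_pred : {pred V} := fun x =>
  all (fun a => <<a, x>> \is a Num.int) root.

Lemma coweight_predP x :
  reflect (forall a, a \in root -> <<a, x>> \is a Num.int)
          (x \in coweight_pred).
Proof. exact: allP. Qed.

Fact coweight_zmod_closed : zmod_closed coweight_pred.
Proof.
split=> [|x y /coweight_predP xP /coweight_predP yP]; apply/coweight_predP.
  by move=> a _; rewrite dot0r rpred0.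
by move=> a aP; rewrite dotDr dotNr rpredB ?xP ?yP.
Qed.
HB.instance Definition _ :=
  GRing.isZmodClosed.Build V coweight_pred coweight_zmod_closed.

Record coweight := Coweight {
  coweight_val :> V;
  coweight_valP : coweight_val \in coweight_pred
}.
HB.instance Definition _ := [isSub for coweight_val].
HB.instance Definition _ := [Choice of coweight by <:].
HB.instance Definition _ := [SubChoice_isSubZmodule of coweight by <:].

Definition dominant (i : coweight) : Prop := forall k, 0 <= <<simple k, i>>.
Definition antidominant (i : coweight) : Prop := forall k, <<simple k, i>> <= 0.

Fact theta_check_subproof :
  (2 / <<highest, highest>>) *: highest \in coweight_pred.
Proof.
apply/coweight_predP => a aP; rewrite dotZr mulrAC.
exact: root_int (highest_root Phi) aP.
Qed.
Definition theta_check : coweight := Coweight theta_check_subproof.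

Fact weyl_act_subproof (w : weyl) (i : coweight) :
  weyl_val w (coweight_val i) \in coweight_pred.
Proof.
case: w i => [f /= /asboolP[s ->]] [x /= xP].
elim: s => /= [|k s IH]; first by rewrite id_lfunE.
apply/coweight_predP => a aP; rewrite comp_lfunE -dot_refl.
by move/coweight_predP: IH; apply; rewrite refl_root ?simple_root.
Qed.
Definition weyl_act (w : weyl) (i : coweight) : coweight :=
  Coweight (weyl_act_subproof w i).

Lemma weyl_act1 i : weyl_act 1%g i = i.
Proof. by apply/val_inj; rewrite /= id_lfunE. Qed.
Lemma weyl_actM w w' i : weyl_act (w * w')%g i = weyl_act w (weyl_act w' i).
Proof. by apply/val_inj; rewrite /= comp_lfunE. Qed.
Lemma weyl_actD w : {morph weyl_act w : i j / i + j}.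
Proof. by move=> i j; apply/val_inj; rewrite /= linearD. Qed.
Lemma weyl_actN w : {morph weyl_act w : i / - i}.
Proof. by move=> i; apply/val_inj; rewrite /= linearN. Qed.

(* [ExtW i w] is the element t_i w. *)
Record extW := ExtW { etr : coweight; elin : weyl }.

Definition extW_pair (x : extW) := (etr x, elin x).
Fact extW_pairK : cancel extW_pair (fun p => ExtW p.1 p.2).
Proof. by case. Qed.
HB.instance Definition _ := Choice.copy extW (can_type extW_pairK).

Definition extW_one := ExtW 0 1%g.
Definition extW_mul (x y : extW) :=
  ExtW (etr x + weyl_act (elin x) (etr y)) (elin x * elin y)%g.
Definition extW_inv (x : extW) :=
  ExtW (- weyl_act (elin x)^-1%g (etr x)) (elin x)^-1%g.

Fact extW_mulA : associative extW_mul.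
Proof.
move=> x y z; congr ExtW; last exact: mulgA.
by rewrite /= weyl_actM weyl_actD addrA.
Qed.
Fact extW_mul1 : left_id extW_one extW_mul.
Proof. by case=> i w; congr ExtW; rewrite /= ?mul1g // weyl_act1 add0r. Qed.
Fact extW_mulr1 : right_id extW_one extW_mul.
Proof.
case=> i w; congr ExtW; rewrite /= ?mulg1 //; apply/val_inj => /=.
by rewrite linear0 addr0.
Qed.
Fact extW_mulV : left_inverse extW_one extW_inv extW_mul.
Proof. by case=> i w; congr ExtW; rewrite /= ?mulVg // addNr. Qed.
Fact extW_mulVr : right_inverse extW_one extW_inv extW_mul.
Proof.
case=> i w; congr ExtW; rewrite /= ?mulgV //.
by rewrite weyl_actN -weyl_actM mulgV weyl_act1 subrr.
Qed.
HB.instance Definition _ := isGroup.Build extW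
  extW_mulA extW_mul1 extW_mulr1 extW_mulV extW_mulVr.

Definition etrans (i : coweight) : extW := ExtW i 1%g.

(* The generators s_0, ..., s_d: index 0 is the affine reflection and index
   [lift ord0 k] is the simple reflection attached to [simple k]. *)
Definition sgen (k : 'I_d.+1) : extW :=
  if unlift ord0 k is Some j then ExtW 0 (srefl j) else ExtW theta_check hrefl.

(* Omega is the stabiliser of the fundamental alcove for the action
   t_i w : x |-> w x + i of the extended affine Weyl group on V. *)
Definition alcove : set V :=
  [set x | (forall k, 0 < <<simple k, x>>) /\ <<highest, x>> < 1].

Definition Omega : set extW :=
  [set x | [set weyl_val (elin x) p + coweight_val (etr x) | p in alcove] = alcove].

Definition has_word (x : extW) (l : nat) : Prop :=
  exists (o : extW) (s : seq 'I_d.+1),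
    [/\ Omega o, size s = l & x = (o * \prod_(k <- s) sgen k)%g].

(* The length on Omega |x W_aff extending the Coxeter length on W_aff.  Here and
   below, [xget x0 P] is an element of P; the default x0 is taken only if P is
   empty. *)
Definition len (x : extW) : nat :=
  xget 0%N [set l | has_word x l /\ forall l', has_word x l' -> (l <= l')%N].

Definition bruhat_step (x y : extW) : Prop :=
  (len x < len y)%N /\
  exists (z : extW) (k : 'I_d.+1), x = (y * (z * sgen k * z^-1))%g.

Definition bruhat_lt : extW -> extW -> Prop := clos_trans extW bruhat_step.

Definition longest (C : set extW) : extW :=
  xget 1%g [set x | C x /\ forall y, C y -> (len y <= len x)%N].

Definition parabolic (J : set 'I_d.+1) : set extW :=
  [set x | exists2 s : seq 'I_d.+1,
     (forall k, k \in s -> J k) & x = (\prod_(k <- s) sgen k)%g].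

(* The unit ring structure only serves to write inverses; every algebra has one
   classically. *)
Record heckeAlgebra (H : unitAlgType laurent) := HeckeAlgebra {
  Hb : extW -> H;
  Hb_basis : is_basis setT Hb;
  HbM : forall x y, len (x * y)%g = (len x + len y)%N ->
    Hb x * Hb y = Hb (x * y)%g;
  Hb_quad : forall k,
    (Hb (sgen k) - v^-1%:A) * (Hb (sgen k) + v%:A) = 0
}.

Record is_bar (H : unitAlgType laurent) (HH : heckeAlgebra H)
    (bar : {rmorphism H -> H}) : Prop := IsBar {
  bar_bij : bijective bar;
  bar_v : bar v%:A = v^-1%:A;
  bar_gen : forall k, bar (Hb HH (sgen k)) = (Hb HH (sgen k))^-1;
  bar_Omega : forall o, Omega o -> bar (Hb HH o) = Hb HH o
}.

Section TensorSpace.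
Variable n : nat.

(* j . t_i w = w^-1 (j - n i) *)
Definition ract (j : coweight) (x : extW) : coweight :=
  weyl_act (elin x)^-1%g (j - etr x *+ n).

Definition orbit (i : coweight) : set coweight :=
  [set j | exists x, j = ract i x].

(* Not invariant under rescaling of [dot], since the coweights are defined by
   the pairing <<a, i>> and the condition involves 2 <<i, a>> / <<a, a>>. *)
Definition fund : set coweight :=
  [set i | forall a, posroot a ->
     - n%:R < 2 * <<coweight_val i, a>> / <<a, a>> <= 0].

Variable Xf : set coweight.

Definition ract_invariant : Prop := forall i x, Xf i -> Xf (ract i x).

Definition Lambda : set (set coweight) :=
  [set g | exists2 i, Xf i & g = orbit i].

(* [fund `&` Xf] meets every orbit exactly once.  This is a condition on Xf, as
   [fund] alone need not be a fundamental domain on the whole coweight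
   lattice. *)
Definition fund_domain : Prop :=
  forall g, Lambda g -> exists! i, (fund `&` Xf) i /\ g i.

Definition Ff : set coweight :=
  [set j | exists (w : weyl) (i : coweight),
     (fund `&` Xf) i /\ j = weyl_act w i].

(* i_gamma: unique for gamma in Lambda when [fund_domain] holds. *)
Definition irep (g : set coweight) : coweight :=
  xget 0 [set i | [/\ Ff i, antidominant i & g i]].

Definition Jset (g : set coweight) : set 'I_d.+1 :=
  [set k | ract (irep g) (sgen k) = irep g].

Definition Wpar (g : set coweight) : set extW := parabolic (Jset g).

Definition dcoset (g : set coweight) (x : extW) (h : set coweight) :
    set extW :=
  [set y | exists a b, [/\ Wpar g a, Wpar h b & y = (a * x * b)%g]].

Definition Dmin (g h : set coweight) : set extW :=
  [set x | forall y, dcoset g x h y -> (len x <= len y)%N].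

(* (gamma, g, nu) is encoded as ((gamma, g), nu). *)
Definition triple := (set coweight * extW * set coweight)%type.

Definition Xi : set triple :=
  [set t | [/\ Lambda t.1.1, Dmin t.1.1 t.2 t.1.2 & Lambda t.2]].

Variables (H : unitAlgType laurent) (HH : heckeAlgebra H).

Local Notation Hb := (Hb HH).

(* theta_(j - k) for dominant j and k; every coweight is such a difference. *)
Definition theta (j k : coweight) : H := Hb (etrans j) / Hb (etrans k).

Definition xel (g : set coweight) : H :=
  \sum_(w \in Wpar g) v ^ ((len (longest (Wpar g)))%:Z - (len w)%:Z) *: Hb w.

Variable T : lmodType laurent.

(* The module T_f with basis (u_i), i in Xf; the values of u outside Xf are
   irrelevant. *)
Record tensorSpace := TensorSpace {
  u : coweight -> T;
  u_basis : is_basis Xf u;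
  act : T -> H -> T;
  act_linear : forall h a x y, act (a *: x + y) h = a *: act x h + act y h;
  act_linearr : forall x a g h, act x (a *: g + h) = a *: act x g + act x h;
  act1 : forall x, act x 1 = x;
  actM : forall x g h, act x (g * h) = act (act x g) h;
  u_fixed : forall i k, let s := sgen (lift ord0 k) in
    Ff i -> ract i s = i -> act (u i) (Hb s) = v^-1 *: u i;
  u_up : forall i k, let s := sgen (lift ord0 k) in
    Ff i -> <<simple k, i>> < 0 -> act (u i) (Hb s) = u (ract i s);
  u_down : forall i k, let s := sgen (lift ord0 k) in
    Ff i -> 0 < <<simple k, i>> ->
    act (u i) (Hb s) = u (ract i s) + (v^-1 - v) *: u i;
  u_theta : forall i j k, Xf i -> dominant j -> dominant k ->
    act (u i) (theta j k) = u (i - (j - k) *+ n)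
}.

Variable TT : tensorSpace.

Definition schur_pred : {pred (T -> T)} := fun f =>
  `[< linear f /\ forall x h, f (act TT x h) = act TT (f x) h >].

Record schur := Schur {
  schur_val :> T -> T;
  schur_valP : schur_val \in schur_pred
}.

Lemma act0l h : act TT 0 h = 0.
Proof.
by have := act_linear TT h (-1) 0 0; rewrite scaler0 addr0 scaleN1r addNr.
Qed.

Lemma actDl x y h : act TT (x + y) h = act TT x h + act TT y h.
Proof. by have := act_linear TT h 1 x y; rewrite !scale1r. Qed.

Lemma actZl a x h : act TT (a *: x) h = a *: act TT x h.
Proof. by have := act_linear TT h a x 0; rewrite act0l !addr0. Qed.

Fact schur_submod_closed : subsemimod_closed schur_pred.
Proof.
split; first split.
- apply/asboolP; split=> [a x y|x h]; first by rewrite scaler0 addr0.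
  by rewrite act0l.
- move=> f g /asboolP[fl fh] /asboolP[gl gh]; apply/asboolP.
  split=> [a x y|x h]; rewrite !addrfctE.
    by rewrite fl gl scalerDr addrACA.
  by rewrite fh gh actDl.
- move=> a f /asboolP[fl fh]; apply/asboolP.
  split=> [b x y|x h]; rewrite !scalrfctE.
    by rewrite fl scalerDr !scalerA mulrC.
  by rewrite fh actZl.
Qed.
HB.instance Definition _ :=
  GRing.isSubmodClosed.Build laurent (T -> T) schur_pred schur_submod_closed.
HB.instance Definition _ := [isSub for schur_val].
HB.instance Definition _ := [Choice of schur by <:].
HB.instance Definition _ := [SubChoice_isSubLmodule of schur by <:].

(* [iota] is the isomorphism of right H-modules from T_f to the direct sum of
   the x_gamma H mapping u_(i_gamma) to x_gamma.  An element of the sum is a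
   family of elements of H indexed by sets of coweights, zero outside the
   (finite) set Lambda of orbits. *)
Record is_orbit_iso (iota : T -> set coweight -> H) : Prop := IsOrbitIso {
  iota_linear : forall a x y g,
    iota (a *: x + y) g = a *: iota x g + iota y g;
  iota_act : forall x h g, iota (act TT x h) g = iota x g * h;
  iota_u : forall g g', Lambda g ->
    iota (u TT (irep g)) g' = if g' == g then xel g else 0;
  iota_inj : injective iota;
  iota_image : forall f : set coweight -> H,
    (exists x, f = iota x) <->
    (forall g, Lambda g -> exists h, f g = xel g * h) /\
    (forall g, ~ Lambda g -> f g = 0)
}.

Variable iota : T -> set coweight -> H.

(* The component of f in Hom(x_nu H, x_gamma H), evaluated at x_nu. *)
Definition component (f : schur) (g h : set coweight) : H :=
  iota (f (u TT (irep h))) g.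

Definition phi (t : triple) : schur :=
  let: (g, x, h) := t in
  xget 0 [set f | forall g' h', Lambda g' -> Lambda h' ->
    component f g' h' =
      if (g' == g) && (h' == h) then
        v ^ (len (longest (Wpar h)))%:Z *:
          \sum_(w \in dcoset g x h) v ^ (- (len w)%:Z) *: Hb w
      else 0].

(* For minimal x the element g^+ is the longest one of the double coset. *)
Definition std (t : triple) : schur :=
  let: (g, x, h) := t in
  v ^ ((len (longest (dcoset g x h)))%:Z - (len (longest (Wpar h)))%:Z) *:
    phi t.

(* The bar involution of each Hom(x_nu H, x_gamma H), extended additively to
   their direct sum. *)
Definition schur_bar (bar : H -> H) (f : schur) : schur :=
  xget 0 [set f' | forall g h, Lambda g -> Lambda h ->
    component f' g h = bar (component f g h)].

Definition std_coset (t : triple) : set schur :=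
  let: (g, x, h) := t in
  [set f | exists c : {fsfun extW -> laurent with 0},
    (forall y, y \in finsupp c -> [/\ Dmin g h y, bruhat_lt y x & vZv (c y)]) /\
    f = std t + \sum_(y <- finsupp c) c y *: std (g, y, h)].

End TensorSpace.
End RootSystem.

(* Main.v *)
Require Import Defs.
From HB Require Import structures.
From mathcomp Require Import all_boot all_order all_algebra.
From mathcomp Require Import finmap ring lra zify.
From mathcomp Require Import boolp classical_sets cardinality fsbigop reals.
From Stdlib Require Import Relation_Operators.

Set Implicit Arguments.
Unset Strict Implicit.
Unset Printing Implicit Defensive.

Import Order.TTheory GRing.Theory Num.Theory.
Local Open Scope classical_set_scope.
Local Open Scope ring_scope.

(* A homomorphism x_nu H -> x_gamma H is determined by the image m of x_nu, and
   the possible images are the m in H with H_s m = v^-1 m for s in J_gamma and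
   m H_s = v^-1 m for s in J_nu.  In terms of the coefficients c_w of m, this
   says that v^(len w) c_w is constant on the double cosets of W_gamma and W_nu;
   so the standard basis is indexed by double cosets, and the coordinate of m at
   a coset is c_w for w the longest element of that coset.  Since bar H_w is H_w
   plus lower terms in the Bruhat order, and w <= w' implies the same for the
   minimal elements of the double cosets of w and w', the bar involution is
   unitriangular on the standard basis.  For such an involution psi, the
   difference psi b_x - b_x is anti-invariant, hence of the form q - psi q for a
   unique combination q of lower b_y with coefficients in v Z[v], and b_x + q is
   the canonical basis element.

   The exchange condition and the length are obtained from the action on affine
   roots: len (w s_k) > len w exactly when w maps the simple affine root a_k to
   a root that is positive on the alcove. *)

(** * Laurent polynomials *)

(** That the two-sided eigenvectors are exactly the possible images has two halves. A left
    eigenvector for J_gamma lies in x_gamma H because subtracting multiples of x_gamma H_x, with x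
    minimal in W_gamma x, clears its support one coset at a time. Conversely x_nu h |-> m h is well
    defined although x_nu has annihilators: m times the sum over W_nu is m times the Poincare
    polynomial of W_nu in v^-2, a nonzero element of a domain, so whatever kills x_nu on the right
    kills m. The bar involution of H is given only as a ring morphism, so its effect on scalars has
    to be derived. The map [lbar] is built from the splitting of a Laurent polynomial into negative,
    constant and positive powers, the same splitting that solves q - lbar q = r with q in v Z[v].
    The correction q is found by recursion on the length of g: supports are finite, and the
    coordinates in the layer of greatest length can be treated independently of each other. *)

Definition ev (x : laurent) (p : {poly int}) : laurent := (map_poly intr p).[x].

Section Laurent.

Lemma evD x p q : ev x (p + q) = ev x p + ev x q.
Proof. by rewrite /ev rmorphD hornerD. Qed.
Lemma evN x p : ev x (- p) = - ev x p.
Proof. by rewrite /ev rmorphN hornerN. Qed.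
Lemma evM x p q : ev x (p * q) = ev x p * ev x q.
Proof. by rewrite /ev rmorphM hornerM. Qed.
Lemma evC x c : ev x c%:P = c%:~R.
Proof. by rewrite /ev map_polyC hornerC. Qed.
Lemma evX x : ev x 'X = x.
Proof. by rewrite /ev map_polyX hornerX. Qed.
Lemma evXn x k : ev x ('X ^+ k) = x ^+ k.
Proof. by rewrite /ev map_polyXn hornerXn. Qed.
Lemma ev0 x : ev x 0 = 0. Proof. by rewrite (evC x 0). Qed.
Lemma ev1 x : ev x 1 = 1. Proof. by rewrite (evC x 1). Qed.

Definition evE := (evD, evN, evM, evC, evX, evXn, ev0, ev1).

Lemma laurent_val_ev p : laurent_val (ev v p) = @FracField.tofrac _ p.
Proof.
elim/poly_ind: p => [|p c IH]; first by rewrite ev0 !raddf0.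
rewrite !evE !raddfD /= !rmorphM /= IH -[c in c%:P]intz !rmorph_int.
congr (_ + _); exact: (rmorph_int (\val : laurent -> _)).
Qed.

Lemma ev_inj : injective (ev v).
Proof.
move=> p q /(congr1 laurent_val); rewrite !laurent_val_ev => /eqP.
by rewrite fraction.tofrac_eq => /eqP.
Qed.

Lemma vVK : v^-1 * v = 1. Proof. by rewrite mulVr ?v_unit. Qed.
Lemma vKV : v * v^-1 = 1. Proof. by rewrite mulrV ?v_unit. Qed.

Lemma laurent_ind (P : laurent -> Prop) :
  (forall p, P (ev v p)) -> (forall a, P a -> P (v^-1 * a)) -> forall a, P a.
Proof.
move=> Pev PV a; case: (a) => x xP; have /asboolP[p [m xE]] := xP.
have -> : Laurent xP = v^-1 ^+ m * ev v p.
  apply: (mulrI (unitrX m v_unit)); rewrite mulrA -exprMn vKV expr1n mul1r.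
  apply/val_inj; rewrite rmorphM rmorphXn /= laurent_val_ev xE mulrC mulfVK //.
  by rewrite expf_neq0 ?fracX_neq0.
elim: m {x xP xE} => [|m IH]; first by rewrite mul1r.
by rewrite exprS -mulrA; apply: PV.
Qed.

(** Storing the negative and positive powers as polynomials makes the exchange of [v] and [v^-1] a
    swap of [p] and [q]. Division by [v] shifts the parts: [c] joins the negative powers and the
    constant term of [q] becomes the new [c]. *)
Lemma laurent_decomp a : exists p c q, a = v^-1 * ev v^-1 p + c%:~R + v * ev v q.
Proof.
elim/laurent_ind: a => [|a [p [c [q ->]]]].
  elim/poly_ind => [|p c _]; first by exists 0, 0, 0; rewrite !ev0 !mulr0 !addr0.
  by exists 0, c, p; rewrite !evE mulr0 add0r addrC mulrC.
elim/poly_ind: q => [|q e _].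
  by exists (p * 'X + c%:P), 0, 0; rewrite !evE; ring.
exists (p * 'X + c%:P), e, q; rewrite !evE !mulrDr [v^-1 * (v * _)]mulrA.
by rewrite [v^-1 * (v * _)]mulrA vVK; ring.
Qed.

Lemma evV_rev k (p : {poly int}) : (size p <= k.+1)%N ->
  v ^+ k * ev v^-1 p = ev v (\poly_(i < k.+1) p`_(k - i)).
Proof.
move=> sp; have evw x n (q : {poly int}) : (size q <= n)%N ->
    ev x q = \sum_(i < n) (q`_i)%:~R * x ^+ i.
  move=> sq; rewrite /ev (@horner_coef_wide _ n) ?(leq_trans (size_poly _ _)) //.
  by apply: eq_bigr => i _; rewrite coef_map.
rewrite (evw _ _ _ sp) (evw _ _ _ (size_poly _ _)) mulr_sumr (reindex_inj rev_ord_inj) /=.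
apply: eq_bigr => i _; rewrite coef_poly ltn_ord subSS mulrCA; congr (_ * _).
have ik : (i <= k)%N by rewrite -ltnS.
by rewrite -{1}(subnK ik) exprD mulrAC -exprMn vKV expr1n mul1r.
Qed.

Lemma laurent_decomp0 p c q :
  v^-1 * ev v^-1 p + c%:~R + v * ev v q = 0 -> [/\ p = 0, c = 0 & q = 0].
Proof.
(* After this multiplication the three parts are polynomials in [v] in disjoint degrees: at most
   [size p], exactly [(size p).+1], and at least [(size p).+2]. *)
move=> /(congr1 (fun x => v ^+ (size p).+1 * x)); rewrite mulr0 !mulrDr.
rewrite [X in X + _ + _](_ : _ = v ^+ size p * ev v^-1 p); last first.
  by rewrite exprSr -mulrA [v * (_ * _)]mulrA vKV mul1r.
rewrite (evV_rev (leqnSn _)) -(evC v c) -(evXn v) -[X in _ * (X * _)](evX v).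
rewrite -!evM -!evD -(ev0 v) => /ev_inj/polyP E.
have {}E i : (if (i < (size p).+1)%N then p`_(size p - i) else 0) +
    (if (i < (size p).+1)%N then 0 else if (i - (size p).+1 == 0)%N then c else 0) +
    (if (i < (size p).+2)%N then 0 else q`_(i - (size p).+2)) = 0.
  by have := E i; rewrite !coefD mulrA -exprSr !coefXnM coefC coef_poly coef0.
have qE i : q`_i = 0.
  have := E (i + (size p).+2)%N; rewrite addnK.
  have -> : (i + (size p).+2 < (size p).+1)%N = false by lia.
  have -> : (i + (size p).+2 < (size p).+2)%N = false by lia.
  have -> : (i + (size p).+2 - (size p).+1 == 0)%N = false by lia.
  by rewrite !add0r.
have cE : c = 0.
  by have := E (size p).+1; rewrite ltnS leqnn ltnn subnn eqxx add0r addr0.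
split=> //; last by apply/polyP => i; rewrite coef0.
apply/polyP => i; rewrite coef0; case: (leqP (size p) i) => ip.
  exact: nth_default.
have := E (size p - i)%N.
have -> : (size p - i < (size p).+1)%N by lia.
have -> : (size p - i < (size p).+2)%N by lia.
by rewrite subKn ?(ltnW ip) // !addr0.
Qed.

(** The substitution of [v^-1] for [v], given as a relation on decompositions; existence and
    uniqueness of the decomposition make it a function, and the default 0 is never taken. *)
Definition lbar (a : laurent) : laurent :=
  xget 0 [set b | exists p c q, a = v^-1 * ev v^-1 p + c%:~R + v * ev v q /\
    b = v * ev v p + c%:~R + v^-1 * ev v^-1 q].

Lemma lbar_decomp p c q : lbar (v^-1 * ev v^-1 p + c%:~R + v * ev v q) =
  v * ev v p + c%:~R + v^-1 * ev v^-1 q.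
Proof.
rewrite /lbar; set S := (X in xget _ X); set b := (RHS).
have Sb : S b by exists p, c, q.
have [p' [c' [q' [E ->]]]] := xgetPex 0 (ex_intro _ _ Sb).
have : v^-1 * ev v^-1 (p - p') + (c - c')%:~R + v * ev v (q - q') = 0.
  rewrite !evE !mulrBr rmorphB /= -(subrr (v^-1 * ev v^-1 p + c%:~R + v * ev v q)) {2}E.
  by ring.
move=> /laurent_decomp0[/eqP pp /eqP cc /eqP qq]; rewrite /b.
by move: pp cc qq; rewrite !subr_eq0 => /eqP-> /eqP-> /eqP->.
Qed.

Lemma lbarD : {morph lbar : a b / a + b}.
Proof.
move=> a b; have [p [c [q ->]]] := laurent_decomp a.
have [p' [c' [q' ->]]] := laurent_decomp b; rewrite !lbar_decomp.
have -> : v^-1 * ev v^-1 p + c%:~R + v * ev v q +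
   (v^-1 * ev v^-1 p' + c'%:~R + v * ev v q') =
   v^-1 * ev v^-1 (p + p') + (c + c')%:~R + v * ev v (q + q').
   by rewrite !evE rmorphD; ring.
by rewrite lbar_decomp !evE rmorphD; ring.
Qed.

Lemma lbarK : involutive lbar.
Proof.
move=> a; have [p [c [q ->]]] := laurent_decomp a.
have E (x y z : laurent) : x + y + z = z + y + x by ring.
by rewrite lbar_decomp E lbar_decomp E.
Qed.

Lemma lbar_v_ev p : lbar (v * ev v p) = v^-1 * ev v^-1 p.
Proof.
have := lbar_decomp 0 0 p.
by rewrite !ev0 !mulr0 !add0r.
Qed.

Lemma lbar_ev p : lbar (ev v p) = ev v^-1 p.
Proof.
elim/poly_ind: p => [|p c _].
  by have := lbar_v_ev 0; rewrite !ev0 !mulr0.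
have := lbar_decomp 0 c p.
by rewrite !evE !mulr0 !add0r addrC mulrC => ->; rewrite addrC mulrC.
Qed.

Lemma lbar_vVM a : lbar (v^-1 * a) = v * lbar a.
Proof.
have [p [c [q ->]]] := laurent_decomp a; rewrite lbar_decomp.
elim/poly_ind: q => [|q e _].
  have -> : v^-1 * (v^-1 * ev v^-1 p + c%:~R + v * ev v 0) =
    v^-1 * ev v^-1 (p * 'X + c%:P) + 0%:~R + v * ev v 0 by rewrite !evE; ring.
  by rewrite lbar_decomp !evE; ring.
have -> : v^-1 * (v^-1 * ev v^-1 p + c%:~R + v * ev v (q * 'X + e%:P)) =
    v^-1 * ev v^-1 (p * 'X + c%:P) + e%:~R + v * ev v q.
  rewrite !evE !mulrDr [v^-1 * (v * _)]mulrA [v^-1 * (v * _)]mulrA vVK; ring.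
rewrite lbar_decomp !evE !mulrDr [v * (v^-1 * _)]mulrA [v * (v^-1 * e%:~R)]mulrA vKV.
ring.
Qed.

Lemma lbar_ind (P : laurent -> laurent -> Prop) :
  (forall p, P (ev v p) (ev v^-1 p)) ->
  (forall a b, P a b -> P (v^-1 * a) (v * b)) -> forall a, P a (lbar a).
Proof.
move=> Pev PV; elim/laurent_ind => [p|a Pa]; first by rewrite lbar_ev.
by rewrite lbar_vVM; apply: PV.
Qed.

(** Anti-invariance forces [c + c = 0] and makes the negative part minus the mirror image of the
    positive part. So the positive part of [r] serves as [q]. *)
Lemma antiinvariant_split r : lbar r = - r ->
  exists2 q, vZv q & q - lbar q = r.
Proof.
have [p [c [q ->]]] := laurent_decomp r; rewrite lbar_decomp => E.
have : v^-1 * ev v^-1 (q + p) + (c + c)%:~R + v * ev v (p + q) = 0.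
  rewrite !evE rmorphD /= -(subrr (- (v^-1 * ev v^-1 p + c%:~R + v * ev v q))).
  by rewrite -{1}E; ring.
move=> /laurent_decomp0[_ cc /eqP]; rewrite addr_eq0 => /eqP ->.
have -> : c = 0 by lia.
exists (v * ev v q); first by exists q.
by rewrite lbar_v_ev !evE; ring.
Qed.

(** Elements of [vZ[v]] have only positive powers and their bar images only negative ones. This is
    the source of uniqueness of the canonical basis. *)
Lemma vZv_invariant q : vZv q -> lbar q = q -> q = 0.
Proof.
move=> [p ->]; rewrite -/(ev v p) lbar_v_ev => E.
have := @laurent_decomp0 p 0 (- p); rewrite evN addr0 mulrN E subrr.
by move=> /(_ erefl)[-> _ _]; rewrite ev0 mulr0.
Qed.

Lemma vZv0 : vZv 0.
Proof. by exists 0; rewrite -/(ev _ _) ev0 mulr0. Qed.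

Lemma vZvB a b : vZv a -> vZv b -> vZv (a - b).
Proof.
by move=> [p ->] [q ->]; exists (p - q); rewrite -!/(ev _ _) !evE mulrBr.
Qed.

Lemma vZvD a b : vZv a -> vZv b -> vZv (a + b).
Proof.
by move=> [p ->] [q ->]; exists (p + q); rewrite -!/(ev _ _) !evE mulrDr.
Qed.

Lemma laurent_integral (a b : laurent) : a * b = 0 -> a = 0 \/ b = 0.
Proof.
move=> ab; have /eqP : \val a * \val b = 0 by rewrite -rmorphM ab rmorph0.
rewrite mulf_eq0.
by case/orP => /eqP E; [left|right]; apply/val_inj.
Qed.

Lemma sum_vV_neq0 (I : Type) (s : seq I) (f : I -> nat) : s <> [::] ->
  \sum_(i <- s) v ^- (f i) != 0.
Proof.
move=> sN0; pose N := (\sum_(i <- s) f i)%N.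
(* [N] bounds all exponents, so [v^N] times the sum is a polynomial, whose value at 1 counts the
   terms. The list [s2] is padding: it keeps the total exponent fixed while terms leave [s1] in the
   induction. *)
have E (s1 s2 : seq I) : v ^+ (\sum_(i <- s1) f i + \sum_(i <- s2) f i)%N *
    \sum_(i <- s1) v ^- (f i) = ev v (\sum_(i <- s1) 'X ^+
      ((\sum_(j <- s1) f j + \sum_(j <- s2) f j) - f i)).
  elim: s1 s2 => [|i s1 IH] s2; first by rewrite !big_nil mulr0 ev0.
  have := IH (i :: s2); rewrite !big_cons !addnA [(_ + f i)%N]addnC => {}IH.
  rewrite mulrDr {}IH evE evXn; congr (_ + _).
  by rewrite -addnA addKn exprD [v ^+ f i * _]mulrC mulrK // unitrX ?v_unit.
apply/eqP => S0; have := E s [::]; rewrite S0 mulr0 -(ev0 v) => /ev_inj E'.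
have := congr1 (horner^~ 1) E'; rewrite horner0 horner_sum.
rewrite (eq_bigr (fun=> 1)) => [|i _]; last by rewrite hornerXn expr1n.
rewrite big_const_seq count_predT iter_addr_0 => /esym/eqP.
by rewrite pnatr_eq0; case: s sN0 {N E E' S0}.
Qed.

End Laurent.

(** * Canonical bases *)

Section Coordinates.
Variables (A : nzRingType) (M : lmodType A) (I : choiceType) (P : set I).

(** Coordinate functionals of a basis. Spanning is not a field: it follows from the others in
    [coords_expand]. Off [P], only linearity is required of [cf i]. *)
Record coords (b : I -> M) (cf : I -> M -> A) : Prop := Coords {
  coords_linear : forall i a x y, cf i (a *: x + y) = a * cf i x + cf i y;
  coords_fin : forall m, finite_set [set i | P i /\ cf i m != 0];
  coords_inj : forall m, (forall i, P i -> cf i m = 0) -> m = 0;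
  coords_b : forall i j, P i -> P j -> cf i (b j) = (i == j)%:R
}.

Section Theory.
Variables (b : I -> M) (cf : I -> M -> A) (bP : coords b cf).

Lemma coords0 i : cf i 0 = 0.
Proof.
have := coords_linear bP i 1 0 0; rewrite scale1r addr0 mul1r => /eqP.
by rewrite addrC -subr_eq subrr => /eqP.
Qed.

Lemma coordsD i : {morph cf i : x y / x + y}.
Proof. by move=> x y; rewrite -[x]scale1r (coords_linear bP) mul1r scale1r. Qed.

Lemma coordsZ i a x : cf i (a *: x) = a * cf i x.
Proof. by rewrite -[a *: x]addr0 (coords_linear bP) coords0 addr0. Qed.

Lemma coordsN i x : cf i (- x) = - cf i x.
Proof. by rewrite -scaleN1r coordsZ mulN1r. Qed.

Lemma coordsB i x y : cf i (x - y) = cf i x - cf i y.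
Proof. by rewrite coordsD coordsN. Qed.

Lemma coords_sum i (J : Type) (r : seq J) (p : pred J) (F : J -> M) :
  cf i (\sum_(j <- r | p j) F j) = \sum_(j <- r | p j) cf i (F j).
Proof. by apply: big_morph; [exact: coordsD | exact: coords0]. Qed.

Definition csupp m : {fset I} := fset_set [set i | P i /\ cf i m != 0].

Lemma csuppP m i : i \in csupp m <-> P i /\ cf i m <> 0.
Proof.
rewrite in_fset_set; last exact: (coords_fin bP m).
split; first by move=> /set_mem[Pi /eqP].
by move=> [Pi /eqP mi]; apply/mem_set.
Qed.

Lemma coords_eq x y : (forall i, P i -> cf i x = cf i y) -> x = y.
Proof.
move=> xy; apply/eqP; rewrite -subr_eq0; apply/eqP/(coords_inj bP) => i Pi.
by rewrite coordsB xy // subrr.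
Qed.

Lemma coords_sum_b i (F : {fset I}) (c : I -> A) : P i ->
  (forall j, j \in F -> P j) ->
  cf i (\sum_(j <- F) c j *: b j) = if i \in F then c i else 0.
Proof.
move=> Pi FP; rewrite coords_sum; case: ifP => iF.
  rewrite (big_fsetD1 i) //= coordsZ (coords_b bP Pi Pi) eqxx mulr1.
  rewrite big1_fset ?addr0 // => j; rewrite !inE => /andP[ji jF] _.
  by rewrite coordsZ (coords_b bP Pi (FP j jF)) eq_sym (negPf ji) mulr0.
rewrite big1_fset // => j jF _; rewrite coordsZ (coords_b bP Pi (FP j jF)).
by rewrite (negPf (_ : i != j)) ?mulr0 //; apply: contraFneq iF => ->.
Qed.

Lemma coords_expand m : m = \sum_(i <- csupp m) cf i m *: b i.
Proof.
apply: coords_eq => i Pi; rewrite coords_sum_b //; last by move=> j /csuppP[].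
case: ifPn => // iN; apply/eqP; apply: contraNT iN => mi.
by apply/csuppP; split=> //; apply/eqP.
Qed.

End Theory.

Lemma basis_coords (b : I -> M) : is_basis P b -> exists cf, coords b cf.
Proof.
move=> bP; have [c cP] := choice bP.
have cU m e : (forall i, i \in finsupp e -> P i) ->
    m = \sum_(i <- finsupp e) e i *: b i -> c m = e.
  by move=> e1 e2; have [_] := cP m; apply.
have cS m i : i \in finsupp (c m) -> P i by have [[+ _] _] := cP m; apply.
have cE m (F : {fset I}) : (finsupp (c m) `<=` F)%fset ->
    m = \sum_(i <- F) c m i *: b i.
  move=> mF; have [[_ mE] _] := cP m; rewrite [LHS]mE.
  rewrite [LHS](big_fset_incl _ mF) //= => i iF iN.
  by rewrite fsfun_dflt ?scale0r.
have cN m i : ~ P i -> c m i = 0.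
  by move=> iN; rewrite fsfun_dflt //; apply/negP => /cS.
exists (fun i m => c m i); split.
- move=> i a x y.
  pose F := (finsupp (c x) `|` finsupp (c y))%fset.
  pose e : {fsfun I -> A with 0} := [fsfun i in F => a * c x i + c y i].
  have eE j : e j = a * c x j + c y j.
    rewrite fsfunE; case: ifPn => //; rewrite in_fsetU negb_or => /andP[jx jy].
    by rewrite !fsfun_dflt // mulr0 addr0.
  rewrite (cU (a *: x + y) e) ?eE // => [j|].
    move=> jE; apply: contrapT => jN; move: jE.
    by rewrite mem_finsupp eE !cN // mulr0 addr0 eqxx.
  have eF : (finsupp e `<=` F)%fset.
    apply/fsubsetP => j; rewrite mem_finsupp; apply: contraR => jF.
    by rewrite fsfunE (negPf jF).
  rewrite {1}(cE x F) ?fsubsetUl // {1}(cE y F) ?fsubsetUr // scaler_sumr -big_split /=.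
  rewrite [RHS](big_fset_incl _ eF) /=; last first.
    by move=> j _ jN; rewrite fsfun_dflt // scale0r.
  by apply: eq_bigr => j _; rewrite eE scalerDl scalerA.
- move=> m; apply: (@sub_finite_set _ _ [set` finsupp (c m)]) => [i [_]|].
    by rewrite /= mem_finsupp.
  exact: finite_fset.
- move=> m m0; have [[_ ->] _] := cP m; apply: big1_fset => i /cS/m0 -> _.
  by rewrite scale0r.
- move=> i j Pi Pj; pose e : {fsfun I -> A with 0} := [fsfun i in [fset j]%fset => 1].
  have eE k : e k = (k == j)%:R by rewrite fsfunE inE; case: eqP.
  have eS : finsupp e = [fset j]%fset.
    by apply/fsetP => k; rewrite mem_finsupp eE in_fset1; case: (k == j) => /=;
      rewrite ?oner_eq0 ?eqxx.
  rewrite (cU (b j) e) ?eE // => [k|]; rewrite eS ?inE; first by move/eqP ->.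
  by rewrite big_seq_fset1 eE eqxx scale1r.
Qed.

Lemma fsfun_of_seq (C : I -> M) (s : seq (A * I)) :
  (forall p, p \in s -> P p.2) ->
  exists c : {fsfun I -> A with 0}, (forall i, i \in finsupp c -> P i) /\
    \sum_(p <- s) p.1 *: C p.2 = \sum_(i <- finsupp c) c i *: C i.
Proof.
move=> sP; pose F : {fset I} := [fset p.2 | p in s]%fset.
have FP i : i \in F -> P i by move=> /imfsetP[p /= /sP ? ->].
pose c : {fsfun I -> A with 0} := [fsfun i in F => \sum_(p <- s | p.2 == i) p.1].
have cF : (finsupp c `<=` F)%fset.
  apply/fsubsetP => j; rewrite mem_finsupp; apply: contraR => jF.
  by rewrite fsfunE (negPf jF).
exists c; split=> [i /(fsubsetP cF)/FP//|].
rewrite [RHS](big_fset_incl _ cF) /=; last first.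
  by move=> j _ jN; rewrite fsfun_dflt // scale0r.
rewrite [RHS](eq_big_seq (fun i => \sum_(p <- s | p.2 == i) p.1 *: C p.2)); last first.
  move=> i iF /=; rewrite fsfunE iF scaler_suml.
  by apply: eq_bigr => p /eqP ->.
rewrite (exchange_big_dep predT) //=; apply: eq_big_seq => p ps.
have pF : p.2 \in F by apply/imfsetP; exists p.
rewrite big_mkcond (big_fsetD1 p.2) //= eqxx big1_fset ?addr0 // => i.
by rewrite !inE eq_sym => /andP[/negPf ->].
Qed.

End Coordinates.

(** * The canonical basis of a unitriangular semilinear involution *)

Section CanonicalBasis.
Variables (M : lmodType laurent) (I : choiceType) (P : set I).
Variables (b : I -> M) (cf : I -> M -> laurent) (bP : coords P b cf).
Variables (len : I -> nat) (lt : I -> I -> Prop).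
Hypothesis lt_trans : forall i j k, lt i j -> lt j k -> lt i k.
Hypothesis lt_len : forall i j, lt i j -> (len i < len j)%N.

(** Replacing each [b i] by [C i] in the expansion of [m] leaves an error supported in smaller
    lengths, which gives spanning. In a vanishing combination the coefficients of greatest length
    vanish first, which gives independence. *)
Lemma unitriangular_basis (C : I -> M) :
  (forall i j, P i -> P j -> cf j (C i - b i) <> 0 -> lt j i) -> is_basis P C.
Proof.
move=> CP.
have cfC i j : P i -> P j -> cf j (C i) = (j == i)%:R + cf j (C i - b i).
  by move=> Pi Pj; rewrite -(coords_b bP Pj Pi) (coordsB bP) addrC subrK.
have span N : forall m, (forall i, P i -> cf i m <> 0 -> (len i < N)%N) ->
    exists s : seq (laurent * I), (forall p, p \in s -> P p.2) /\
      m = \sum_(p <- s) p.1 *: C p.2.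
  elim: N => [|N IH] m mN.
    exists [::]; split=> //; rewrite big_nil; apply: (coords_inj bP) => i Pi.
    by apply: contrapT => /(mN _ Pi).
  pose s0 := [seq (cf i m, i) | i <- csupp P cf m].
  have s0P p : p \in s0 -> P p.2.
    by move=> /mapP[i /(csuppP bP)[Pi _] ->].
  have [|s [sP sE]] := IH (m - \sum_(p <- s0) p.1 *: C p.2).
    move=> j Pj; rewrite big_map /= => jN.
    have [i [iS jC]] : exists i, i \in csupp P cf m /\ cf j (C i - b i) <> 0.
      apply: contrapT => /forallNP jC; apply: jN.
      rewrite {1}(coords_expand bP m) -sumrB (coords_sum bP).
      apply: big1_fset => i iS _; rewrite -scalerBr (coordsZ bP) -opprB (coordsN bP).
      have /not_andP[//|/contrapT ->] := jC i.
      by rewrite oppr0 mulr0.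
    have [Pi iN] := (csuppP bP m i).1 iS.
    by rewrite -ltnS (leq_trans _ (mN i Pi iN)) // ltnS lt_len //; exact: CP.
  exists (s0 ++ s); split=> [p|]; first by rewrite mem_cat => /orP[/s0P|/sP].
  by rewrite big_cat /= -sE addrC subrK.
have indep (F : {fset I}) (d : I -> laurent) : (forall i, i \in F -> P i) ->
    \sum_(i <- F) d i *: C i = 0 -> forall i, i \in F -> d i = 0.
  move=> FP dE; pose B := (\sum_(i <- F) len i).+1.
  have FB i : i \in F -> (len i < B)%N.
    by move=> iF; rewrite ltnS (big_fsetD1 i) //= leq_addr.
  suff main k : forall i, i \in F -> (B <= len i + k)%N -> d i = 0.
    by move=> i iF; apply: (main B i iF); rewrite leq_addl.
  elim: k => [|k IH] i iF ik.
    by have := FB i iF; rewrite addn0 in ik; rewrite ltnNge ik.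
  have := congr1 (cf i) dE; rewrite (coords0 bP) (coords_sum bP).
  rewrite (big_fsetD1 i) //= (coordsZ bP) (cfC _ _ (FP i iF) (FP i iF)) eqxx mulrDr mulr1.
  rewrite big1_fset => [|j]; last first.
    rewrite !inE => /andP[/negPf ji jF] _;
    rewrite (coordsZ bP) (cfC _ _ (FP j jF) (FP i iF)).
    rewrite eq_sym ji add0r.
    have [->|/eqP/CP ij] := eqVneq (cf i (C j - b j)) 0; first by rewrite mulr0.
    rewrite IH ?mul0r // (leq_trans ik) // addnS -addSn leq_add2r.
    by apply/lt_len/ij; apply: FP.
  rewrite addr0; have [->|/eqP/CP ii] := eqVneq (cf i (C i - b i)) 0.
    by rewrite mulr0 addr0.
  by have := lt_len (ii (FP _ iF) (FP _ iF)); rewrite ltnn.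
move=> m; pose N := (\sum_(i <- csupp P cf m) len i).+1.
have [|s [sP sE]] := span N m.
  move=> i Pi mi; have iS : i \in csupp P cf m by apply/(csuppP bP).
  by rewrite ltnS (big_fsetD1 i) //= leq_addr.
have [c [cP cE]] := fsfun_of_seq C sP.
exists c; split=> [|c' [c'P c'E]]; first by rewrite sE.
pose F := (finsupp c `|` finsupp c')%fset.
have FP i : i \in F -> P i by rewrite inE => /orP[/cP|/c'P].
have := indep F (fun i => c i - c' i) FP.
have -> : \sum_(i <- F) (c i - c' i) *: C i = 0.
  under eq_bigr do rewrite scalerBl.
  have E (e : {fsfun I -> laurent with 0}) : (finsupp e `<=` F)%fset ->
      \sum_(i <- F) e i *: C i = \sum_(i <- finsupp e) e i *: C i.
    move=> eF; rewrite [RHS](big_fset_incl _ eF) //= => j _ jN.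
    by rewrite fsfun_dflt // scale0r.
  by rewrite sumrB !E ?fsubsetUl ?fsubsetUr // -c'E -cE -sE subrr.
move=> /(_ erefl) H; apply/fsfunP => i; have [iF|iF] := boolP (i \in F).
  by apply/eqP; rewrite -subr_eq0; apply/eqP/H.
by move: iF; rewrite inE negb_or => /andP[ic ic']; rewrite !fsfun_dflt.
Qed.

Variable psi : M -> M.
Hypothesis psi_linear : forall a x y, psi (a *: x + y) = lbar a *: psi x + psi y.
Hypothesis psiK : involutive psi.
Hypothesis psi_b1 : forall i, P i -> cf i (psi (b i)) = 1.
Hypothesis psi_b : forall i j, P i -> P j -> cf i (psi (b j)) <> 0 ->
  i = j \/ lt i j.

Lemma lbar0 : lbar 0 = 0.
Proof. by have := lbar_v_ev 0; rewrite !ev0 !mulr0. Qed.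
Lemma lbar1 : lbar 1 = 1.
Proof. by have := lbar_ev 1; rewrite !ev1. Qed.

Lemma psi0 : psi 0 = 0.
Proof.
have := psi_linear 1 0 0; rewrite lbar1 !scale1r addr0 => /eqP.
by rewrite addrC -subr_eq subrr => /eqP.
Qed.
Lemma psiD x y : psi (x + y) = psi x + psi y.
Proof. by rewrite -[x]scale1r psi_linear lbar1 !scale1r. Qed.
Lemma psiZ a x : psi (a *: x) = lbar a *: psi x.
Proof. by rewrite -[a *: x]addr0 psi_linear psi0 addr0. Qed.
Lemma psiN x : psi (- x) = - psi x.
Proof. by apply/eqP; rewrite -addr_eq0 -psiD addNr psi0. Qed.
Lemma psi_sum (J : Type) (r : seq J) (F : J -> M) :
  psi (\sum_(j <- r) F j) = \sum_(j <- r) psi (F j).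
Proof. by apply: big_morph; [exact: psiD | exact: psi0]. Qed.

Lemma cf_psi_support m i : P i -> cf i (psi m) <> 0 ->
  exists j, [/\ P j, cf j m <> 0 & i = j \/ lt i j].
Proof.
move=> Pi im; apply: contrapT => /forallNP jm; apply: im.
rewrite (coords_expand bP m) psi_sum (coords_sum bP); apply: big1_fset => j jS _.
have [Pj mj] := (csuppP bP m j).1 jS.
rewrite psiZ (coordsZ bP); have [->|/eqP/psi_b] := eqVneq (cf i (psi (b j))) 0.
  by rewrite mulr0.
by move=> /(_ Pi Pj) ij; case: (jm j).
Qed.

(** By [psi_b], only [b j] with [j = i] or [j] above [i] can contribute to coordinate [i] of
    [psi m]; with nothing above [i] in the support, the [i]-term alone is left, with its scalar
    barred. *)
Lemma cf_psi_maximal m i : P i -> (forall j, P j -> cf j m <> 0 -> ~ lt i j) ->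
  cf i (psi m) = lbar (cf i m).
Proof.
move=> Pi mi; have off j : j \in csupp P cf m -> j != i ->
    cf i (psi (cf j m *: b j)) = 0.
  move=> jS ji; have [Pj mj] := (csuppP bP m j).1 jS.
  rewrite psiZ (coordsZ bP); have [->|/eqP/psi_b] := eqVneq (cf i (psi (b j))) 0.
    by rewrite mulr0.
  by case/(_ Pi Pj) => [ij|/(mi _ Pj mj)//]; rewrite ij eqxx in ji.
rewrite {1}(coords_expand bP m) psi_sum (coords_sum bP).
have [iS|iN] := boolP (i \in csupp P cf m).
  rewrite (big_fsetD1 i) //= psiZ (coordsZ bP) psi_b1 // mulr1 big1_fset ?addr0 //.
  by move=> j; rewrite !inE => /andP[ji jS] _; apply: off.
have -> : cf i m = 0.
  by apply: contrapT => im; case/negP: iN; apply/(csuppP bP).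
rewrite lbar0; apply: big1_fset => j jS _; apply: off => //.
by apply: contraNneq iN => <-.
Qed.

(** On the layer of greatest length [cf_psi_maximal] makes each coordinate of [m] anti-invariant, so
    [antiinvariant_split] supplies the coefficients of [q] there. Subtracting their contribution
    leaves an anti-invariant remainder supported in smaller lengths, and the argument repeats. *)
Lemma antiinvariant_solve x m : P x -> psi m = - m ->
  (forall i, P i -> cf i m <> 0 -> lt i x) ->
  exists2 q, q - psi q = m &
    forall i, P i -> cf i q <> 0 -> lt i x /\ vZv (cf i q).
Proof.
move=> Px; suff main N : forall m, psi m = - m ->
    (forall i, P i -> cf i m <> 0 -> lt i x /\ (len i < N)%N) ->
    exists2 q, q - psi q = m &
      forall i, P i -> cf i q <> 0 -> lt i x /\ vZv (cf i q).
  move=> mA mx; apply: (main (len x)) => // i Pi im.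
  by have ix := mx i Pi im; split=> //; apply: lt_len.
elim: N => {m} [|N IH] m mA mx.
  exists 0; first rewrite psi0 subrr.
    by apply/esym/(coords_inj bP) => i Pi; apply: contrapT => /(mx _ Pi)[].
  by move=> i Pi; rewrite (coords0 bP).
have top i : i \in csupp P cf m -> exists q, len i = N ->
    vZv q /\ q - lbar q = cf i m.
  move=> /(csuppP bP)[Pi im]; have [iN|iN] := pselect (len i = N); last by exists 0.
  have [|q qv qE] := @antiinvariant_split (cf i m); last by exists q.
  rewrite -cf_psi_maximal // ?mA ?(coordsN bP) // => j Pj /(mx _ Pj)[_ jN] /lt_len.
  by rewrite iN ltnNge -ltnS jN.
have {}top i : exists q, i \in csupp P cf m -> len i = N ->
    vZv q /\ q - lbar q = cf i m.
  have [/top[q qP]|iS] := boolP (i \in csupp P cf m); first by exists q.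
  by exists 0.
have [q qP] := choice top.
pose F := [fset i in csupp P cf m | len i == N]%fset.
have FP i : i \in F -> [/\ P i, lt i x, len i = N & cf i m <> 0].
  rewrite !inE => /andP[/(csuppP bP)[Pi im] /eqP iN].
  by have [ix _] := mx _ Pi im.
have FPP i : i \in F -> P i by move=> /FP[].
pose q0 := \sum_(i <- F) q i *: b i.
have q0E i : P i -> cf i q0 = if i \in F then q i else 0.
  by move=> Pi; rewrite (coords_sum_b bP).
have q0P i : P i -> cf i q0 <> 0 -> lt i x /\ vZv (cf i q0).
  move=> Pi; rewrite q0E //; case: ifP => // iF _; have [_ ix iN _] := FP i iF.
  split=> //; move: iF; rewrite !inE => /andP[iS _].
  by have [] := qP i iS iN.
(* Outside [F], the support of [psi q0] lies strictly below indices of [F], so it is still below [x]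
   and has length less than [N]. *)
have q0psi i : P i -> cf i (psi q0) <> 0 -> i \in F \/ lt i x /\ (len i < N)%N.
  move=> Pi /(cf_psi_support Pi)[j [Pj jq ij]]; move: jq; rewrite q0E //.
  case: ifP => // jF _; case: ij => [->|ij]; first by left.
  have [_ jx jN _] := FP j jF; right; split; first exact: lt_trans jx.
  by rewrite -jN lt_len.
have [||q1 q1E q1P] := IH (m - (q0 - psi q0)).
- by rewrite !(psiD, psiN) mA psiK [in RHS]opprB opprB addrC.
- move=> i Pi; rewrite !(coordsB bP) => iN.
  have [iF|iF] := boolP (i \in F).
    case: iN; have [_ ix iN im] := FP i iF.
    rewrite cf_psi_maximal // ?q0E // ?iF.
      move: iF; rewrite !inE => /andP[iS _].
      by have [_ ->] := qP i iS iN; rewrite subrr.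
    move=> j Pj; rewrite q0E //; case: ifP => // /FP[_ _ jN _] _ /lt_len.
    by rewrite iN jN ltnn.
  have [i0|/eqP/(q0psi _ Pi)[]] := eqVneq (cf i (psi q0)) 0; last 2 first.
  + by rewrite (negPf iF).
  + by [].
  move: iN; rewrite i0 q0E // (negPf iF) !subr0 => im.
  have [ix] := mx i Pi im; rewrite ltnS leq_eqVlt => /orP[iN|//].
  by case/negP: iF; rewrite !inE iN andbT; apply/(csuppP bP).
exists (q0 + q1); first by rewrite psiD opprD addrACA q1E addrC subrK.
move=> i Pi; rewrite (coordsD bP) => iN.
have [i0|/eqP iq0] := eqVneq (cf i q0) 0.
  by move: iN; rewrite i0 add0r => /(q1P _ Pi).
have [ix iv] := q0P i Pi iq0; split=> //; apply: vZvD => //.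
have [->|/eqP/(q1P _ Pi)[]//] := eqVneq (cf i q1) 0.
exact: vZv0.
Qed.

(** Descending from the greatest length, [cf_psi_maximal] makes the coordinate at hand
    bar-invariant, and being in [vZ[v]] it vanishes. Applied to the difference of two candidates,
    this is uniqueness. *)
Lemma invariant_vZv_eq0 m : psi m = m -> (forall i, P i -> vZv (cf i m)) -> m = 0.
Proof.
move=> mI mv; apply: (coords_inj bP).
pose B := (\sum_(i <- csupp P cf m) len i).+1.
suff main k : forall i, P i -> (B <= len i + k)%N -> cf i m = 0.
  by move=> i Pi; apply: (main B i Pi); rewrite leq_addl.
elim: k => [|k IH] i Pi ik.
  apply: contrapT => im; move: ik; rewrite leqNgt addn0.
  have iS : i \in csupp P cf m by apply/(csuppP bP).
  by rewrite ltnS (big_fsetD1 i) //= leq_addr.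
apply: vZv_invariant; first exact: mv.
rewrite -{2}mI cf_psi_maximal // => j Pj jm /lt_len ij; apply: jm.
by apply: IH => //; rewrite (leq_trans ik) // addnS -addSn leq_add2r.
Qed.

Definition canonical_for i m := psi m = m /\
  forall j, P j -> cf j (m - b i) <> 0 -> lt j i /\ vZv (cf j (m - b i)).

Theorem canonical_basis : exists C : I -> M,
  [/\ is_basis P C, forall i, P i -> canonical_for i (C i) &
      forall i m, P i -> canonical_for i m -> m = C i].
Proof.
have ex i : exists c, P i -> canonical_for i c.
  have [Pi|] := pselect (P i); last by exists 0.
  have [||q qE qP] := @antiinvariant_solve i (psi (b i) - b i) Pi.
  - by rewrite psiD psiN psiK opprB.
  - move=> j Pj; rewrite (coordsB bP) => jN.
    have [ij|ji] := eqVneq i j.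
      by case: jN; rewrite -ij psi_b1 // (coords_b bP) // eqxx subrr.
    move: jN; rewrite (coords_b bP) // [j == i]eq_sym (negPf ji) subr0 => /psi_b.
    by case/(_ Pj Pi) => // ij; rewrite ij eqxx in ji.
  exists (b i + q) => _; split=> [|j Pj]; last first.
    by rewrite [b i + q]addrC addrK; apply: qP.
  rewrite psiD; apply/eqP; rewrite -subr_eq0 opprD addrACA -qE.
  by rewrite addrA subrK subrr.
have [C CP] := choice ex; exists C; split=> //.
  by apply: unitriangular_basis => i j Pi Pj /((CP i Pi).2 j Pj)[].
move=> i m Pi [mI mP]; have [CI CC] := CP i Pi.
apply/eqP; rewrite -subr_eq0; apply/eqP/invariant_vZv_eq0.
  by rewrite psiD psiN mI CI.
have dv x j : P j -> (cf j x <> 0 -> lt j i /\ vZv (cf j x)) -> vZv (cf j x).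
  by move=> Pj xP; have [->|/eqP/xP[]//] := eqVneq (cf j x) 0; apply: vZv0.
move=> j Pj; have -> : m - C i = (m - b i) - (C i - b i) by rewrite opprB addrA subrK.
by rewrite (coordsB bP); apply: vZvB; apply: dv => //; [apply: mP | apply: CC].
Qed.

End CanonicalBasis.

(** * Affine roots *)

Section AffineRoots.
Variables (R : realType) (V : vectType R) (d : nat) (Phi : rootSystem V d).

Local Notation "<< x , y >>" := (dot Phi x y) (format "<< x ,  y >>").
Local Notation root := (Defs.root Phi).
Local Notation simple := (Defs.simple Phi).
Local Notation highest := (highest Phi).
Local Notation alcove := (alcove Phi).
Local Notation extW := (extW Phi).

Lemma dot_suml (J : Type) (r : seq J) (F : J -> V) y :
  <<\sum_(j <- r) F j, y>> = \sum_(j <- r) <<F j, y>>.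
Proof. by apply: (big_morph (fun x => <<x, y>>)) => [x z|]; rewrite ?dotD ?dot0. Qed.

Lemma dotMn x y k : <<x *+ k, y>> = <<x, y>> *+ k.
Proof. by rewrite -scaler_nat dotZ mulr_natl. Qed.

Lemma root0 a : a \in root -> a != 0.
Proof. by move=> aP; apply: contraTneq aP => ->; apply: root_neq0. Qed.

Lemma rootN a : a \in root -> - a \in root.
Proof.
move=> aP; have := refl_root aP aP; rewrite reflE mulfK ?root_norm_neq0 //.
by rewrite scaler_nat mulr2n opprD addrA subrr add0r.
Qed.

Lemma root_cases a : a \in root -> posroot Phi a \/ posroot Phi (- a).
Proof.
by move=> aP; case: (root_sign aP); [left|right]; split; rewrite ?rootN.
Qed.

Lemma simple_pos k : posroot Phi (simple k).
Proof.
split; first exact: simple_root.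
exists (fun j => (j == k) : nat); rewrite (bigD1 k) //= eqxx big1 ?addr0 // => i ik.
by rewrite (negPf ik).
Qed.

Lemma weyl_isometry (w : weyl Phi) x y : <<weyl_val w x, weyl_val w y>> = <<x, y>>.
Proof.
case: w => f /= /asboolP[s ->]; elim: s => /= [|k s IH]; first by rewrite !id_lfunE.
by rewrite !comp_lfunE dot_refl reflK ?simple_root.
Qed.

Lemma weyl_root (w : weyl Phi) a : a \in root -> weyl_val w a \in root.
Proof.
case: w => f /= /asboolP[s ->] aP; elim: s => /= [|k s IH]; first by rewrite id_lfunE.
by rewrite comp_lfunE refl_root ?simple_root.
Qed.

Lemma int_gt_geS (x y : R) : x \is a Num.int -> y \is a Num.int -> x < y -> x + 1 <= y.
Proof.
by move=> /intrP[i ->] /intrP[j ->]; rewrite -[1]/(1%:~R) -intrD ltr_int ler_int lezD1.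
Qed.

(** The upper bound holds because [highest - a] is a nonnegative combination of simple roots; the
    lower one is strict because a root is nonzero and so has a nonzero coefficient. *)
Lemma alcove_root a p : posroot Phi a -> alcove p -> 0 < <<a, p>> < 1.
Proof.
move=> [aP [c aE]] [p0 p1]; apply/andP; split; last first.
  apply: le_lt_trans p1; have [e eE] := highest_max aP.
  rewrite -subr_ge0 -dotN -dotD eE dot_suml sumr_ge0 // => k _.
  by rewrite dotMn mulrn_wge0 // ltW.
have ck : exists k, c k != 0%N.
  apply/existsP; apply: contraT; rewrite negb_exists => /forallP c0.
  have /negP[] := root0 aP; apply/eqP; rewrite aE big1 // => k _.
  by have := c0 k; rewrite negbK => /eqP ->.
case: ck => k ck; rewrite aE dot_suml (bigD1 k) //= dotMn ltr_pwDl //.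
  by rewrite pmulrn_lgt0 ?lt0n.
by apply: sumr_ge0 => j _; rewrite dotMn mulrn_wge0 // ltW.
Qed.

Lemma dot_simple_eq0 x : (forall k, <<simple k, x>> = 0) -> x = 0.
Proof.
move=> sx; apply/eqP; apply: contraT => /(dot_gt0 Phi).
have /(@coord_span _ _ _ _ x) xE : x \in <<[tuple simple k | k < d]>>%VS.
  by rewrite (span_basis (simple_basis Phi)) memvf.
rewrite {1}xE dot_suml big1 ?ltxx // => i _.
by rewrite dotZ -tnth_nth tnth_mktuple sx mulr0.
Qed.

Lemma alcove_nonempty : exists p, alcove p.
Proof.
pose f (x : V) : 'rV[R]_d := \row_k <<simple k, x>>.
have f_lin : linear f.
  by move=> a x y; apply/rowP => k; rewrite !mxE dotDZr.
pose fL := GRing.isLinear.Build R V 'rV[R]_d *:%R f f_lin.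
pose F : {linear V -> 'rV[R]_d} := HB.pack f fL.
have FE x k : linfun F x 0 k = <<simple k, x>> by rewrite lfunE /= mxE.
have ker0 : lker (linfun F) == 0%VS.
  apply/eqP/vspaceP => x; rewrite memv_ker memv0; apply/eqP/eqP => [Fx|->]; last first.
    by rewrite linear0.
  by apply: dot_simple_eq0 => k; rewrite -FE Fx mxE.
have dimV : \dim (fullv : {vspace V}) = d.
  exact: size_basis (simple_basis Phi).
have img : limg (linfun F) = fullv.
  apply/eqP; rewrite eqEdim subvf /= limg_dim_eq ?dimV.
    by rewrite dimvf /= /dim /= mul1n.
  by rewrite (eqP ker0) capv0.
(* [p] is the sum of the fundamental coweights, pairing to 1 with every simple root. Division by
   [<<highest, p>> + 1] brings it into the alcove. *)
have /memv_imgP[p _ pE] : const_mx 1 \in limg (linfun F) by rewrite img memvf.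
have p1 k : <<simple k, p>> = 1 by rewrite -FE -pE mxE.
have h0 : 0 <= <<highest, p>>.
  have [_ [c ->]] := highest_pos Phi; rewrite dot_suml sumr_ge0 // => k _.
  by rewrite dotMn p1 ler0n.
exists ((<<highest, p>> + 1)^-1 *: p); split=> [k|].
  by rewrite dotZr p1 mulr1 invr_gt0 ltr_wpDl.
by rewrite dotZr mulrC ltr_pdivrMr ?mul1r ?ltrDl ?ltr_wpDl.
Qed.

(* A pair (a, m) stands for the affine function x |-> <<a, x>> + m, which is an
   affine root when a is a root and m an integer. *)
Definition aval (a : V * R) (p : V) : R := <<a.1, p>> + a.2.
Definition aneg (a : V * R) : V * R := (- a.1, - a.2).
Definition aroot (a : V * R) : Prop := a.1 \in root /\ a.2 \is a Num.int.
Definition apos (a : V * R) : Prop := forall p, alcove p -> 0 < aval a p.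

Definition pact (x : extW) (p : V) : V := weyl_val (elin x) p + coweight_val (etr x).
(** The action on affine functions dual to [pact]: the constant term is the one for which moving
    function and point together keeps the value ([aval_act]). *)
Definition aact (x : extW) (a : V * R) : V * R :=
  (weyl_val (elin x) a.1, a.2 - <<weyl_val (elin x) a.1, etr x>>).

(** The walls of the alcove in the numbering of [sgen]; index 0 is the affine function
    [1 - highest]. *)
Definition asimple (k : 'I_d.+1) : V * R :=
  if unlift ord0 k is Some j then (simple j, 0) else (- highest, 1).

Lemma anegK : involutive aneg.
Proof. by case=> a m; rewrite /aneg /= !opprK. Qed.
Lemma aval_neg a p : aval (aneg a) p = - aval a p.
Proof. by rewrite /aval /= dotN opprD. Qed.
Lemma aval_act x a p : aval (aact x a) (pact x p) = aval a p.
Proof.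
rewrite /aval /aact /pact /= dotDr weyl_isometry addrACA; ring.
Qed.
Lemma pactM x y p : pact (x * y)%g p = pact x (pact y p).
Proof. by rewrite /pact /= comp_lfunE linearD /= -addrA; congr (_ + _); rewrite addrC. Qed.
Lemma pact1 p : pact 1%g p = p.
Proof. by rewrite /pact /= id_lfunE addr0. Qed.
Lemma aactM x y a : aact (x * y)%g a = aact x (aact y a).
Proof.
rewrite /aact /= comp_lfunE; congr (_, _).
rewrite dotDr weyl_isometry; ring.
Qed.
Lemma aact1 a : aact 1%g a = a.
Proof. by case: a => a m; rewrite /aact /= id_lfunE dot0r subr0. Qed.
Lemma aact_neg x a : aact x (aneg a) = aneg (aact x a).
Proof. by rewrite /aact /aneg /= linearN /= dotN opprD. Qed.
Lemma aval_actV x a p : aval (aact x a) p = aval a (pact x^-1%g p).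
Proof. by rewrite -(aval_act x a) -pactM mulgV pact1. Qed.

Lemma alcoveE p : alcove p <-> forall k, 0 < aval (asimple k) p.
Proof.
rewrite /aval /asimple; split=> [[p0 p1] k|pk].
  case: unliftP => [j _|_] /=; first by rewrite addr0.
  by rewrite dotN addrC subr_gt0.
split=> [k|]; first by have := pk (lift ord0 k); rewrite liftK /= addr0.
by have := pk ord0; rewrite unlift_none /= dotN addrC subr_gt0.
Qed.

Lemma apos_simple k : apos (asimple k).
Proof. by move=> p /alcoveE. Qed.
Lemma aroot_simple k : aroot (asimple k).
Proof.
rewrite /asimple; case: unliftP => [j _|_]; split=> //=.
- exact: simple_root.
- exact/rootN/highest_root.
Qed.
Lemma aroot_act x a : aroot a -> aroot (aact x a).
Proof.
move=> [a1 a2]; split; rewrite /= ?weyl_root // rpredB //.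
by have /coweight_predP := coweight_valP (etr x); apply; rewrite weyl_root.
Qed.

(** On the alcove a positive root takes values strictly between 0 and 1, so the integer [m] decides
    the sign. The threshold is 0 here, and 1 when the root is negative. *)
Lemma apos_posroot a m : posroot Phi a -> m \is a Num.int -> apos (a, m) <-> 0 <= m.
Proof.
move=> aP mP; split=> [am|m0 p pA]; last first.
  by rewrite ltr_wpDr //; case/andP: (alcove_root aP pA).
have [p pA] := alcove_nonempty; have := am p pA; have /andP[_] := alcove_root aP pA.
rewrite /aval /= => p1 p0; rewrite leNgt; apply/negP => m0.
have := int_gt_geS mP (rpred0 _) m0; lra.
Qed.

Lemma apos_negroot a m : posroot Phi (- a) -> m \is a Num.int -> apos (a, m) <-> 1 <= m.
Proof.
move=> aP mP; have pa p : alcove p -> -1 < <<a, p>> < 0.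
  by move=> /(alcove_root aP); rewrite dotN => /andP[]; lra.
split=> [am|m1 p pA]; last first.
  by rewrite /aval /=; have /andP[] := pa p pA; lra.
have [p pA] := alcove_nonempty; have := am p pA; have /andP[] := pa p pA.
rewrite /aval /= => p1 p2 p0; rewrite leNgt; apply/negP => m1.
have := int_gt_geS mP (rpred1 _) m1; lra.
Qed.

Lemma apos_total a : aroot a -> apos a \/ apos (aneg a).
Proof.
case: a => a m [/= aP mP]; have /= mNP := rpredNr mP.
have dich : 0 <= m \/ 1 <= - m.
  have [m0|m0] := leP 0 m; [by left|right].
  by have := int_gt_geS mP (rpred0 _) m0; lra.
have [ap|ap] := root_cases aP.
  rewrite /aneg /=; have aNP : posroot Phi (- - a) by rewrite opprK.
  by case: dich => m0; [left; apply/(apos_posroot ap)|right; apply/(apos_negroot aNP)].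
have [m1|m1] := leP 1 m; [by left; apply/(apos_negroot ap)|right].
apply/(apos_posroot ap) => //=; rewrite oppr_ge0.
by have := int_gt_geS mP (rpred1 _) m1; lra.
Qed.

Lemma apos_contra a : apos a -> ~ apos (aneg a).
Proof.
have [p pA] := alcove_nonempty => /(_ _ pA) ap /(_ _ pA); rewrite aval_neg oppr_gt0.
by move/(lt_trans ap); rewrite ltxx.
Qed.

Lemma Omega_apos (o : extW) a : Omega o -> apos a -> apos (aact o a).
Proof.
move=> oA ap p; rewrite -{1}oA => -[q qA <-].
by rewrite -/(pact o q) aval_act; apply: ap.
Qed.

Lemma OmegaP (o : extW) : (forall k, apos (aact o (asimple k))) -> Omega o.
Proof.
move=> op; have oVA q : alcove q -> alcove (pact o^-1%g q).
  by move=> qA; apply/alcoveE => k; rewrite -aval_actV; apply: op.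
rewrite /Omega /=; apply/seteqP; split=> [_ [p pA <-]|q qA]; last first.
  exists (pact o^-1%g q); first exact: oVA.
  by rewrite -/(pact o _) -pactM mulgV pact1.
rewrite -/(pact o p); apply/alcoveE => k.
rewrite -[o]invgK -aval_actV.
(* Were the moved root negative, it would be so at the point [o^-1 q] of the alcove, where its value
   is that of the simple affine root at [q]. *)
have [|] := apos_total (aroot_act o^-1%g (aroot_simple k)); first exact.
have [q qA] := alcove_nonempty => /(_ _ (oVA q qA)).
rewrite -aact_neg aval_act aval_neg oppr_gt0 => q0.
by have := lt_trans q0 (apos_simple k qA); rewrite ltxx.
Qed.

Definition acov (a : V * R) : V := (2 / <<a.1, a.1>>) *: a.1.

Lemma sgen_pact k p : pact (sgen Phi k) p = p - aval (asimple k) p *: acov (asimple k).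
Proof.
rewrite /pact /sgen /asimple /aval /acov; case: unliftP => [j _|_] /=.
  rewrite reflE addr0 addr0 scalerA dotC; congr (_ - _ *: _); ring.
rewrite reflE !dotN !dotNr opprK -addrA; congr (_ + _).
rewrite !scalerN opprK !scalerA -scaleNr -scalerDl dotC; congr (_ *: _); ring.
Qed.

Lemma acov_act x a : acov (aact x a) = weyl_val (elin x) (acov a).
Proof. by rewrite /acov /= weyl_isometry linearZ. Qed.

Lemma pact_inj (x y : extW) : (forall p, pact x p = pact y p) -> x = y.
Proof.
case: x y => [i w] [j z] /= E.
have ij : i = j by apply/val_inj; have := E 0; rewrite /pact /= !linear0 !add0r.
congr ExtW => //; apply/val_inj/lfunP => p.
by have := E p; rewrite /pact /= ij => /addIr.
Qed.

(** Conjugation by [x] gives the reflection in the image hyperplane, and by [sgen_pact] a reflection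
    depends only on its affine root, through the value and the coroot [acov]. *)
Lemma conj_sgen (x : extW) k j : aact x (asimple k) = asimple j ->
  (x * sgen Phi k * x^-1)%g = sgen Phi j.
Proof.
move=> xkj; apply: pact_inj => p; rewrite !pactM !sgen_pact -xkj acov_act.
rewrite aval_actV /pact /= linearB linearZ /= addrAC; congr (_ - _).
by rewrite -[LHS]/(pact x (pact x^-1%g p)) -pactM mulgV pact1.
Qed.

Lemma sgen_asimple k : aact (sgen Phi k) (asimple k) = aneg (asimple k).
Proof.
rewrite /aact /sgen /asimple /aneg; case: unliftP => [j _|_] /=.
  rewrite reflE mulfK ?root_norm_neq0 ?simple_root // dot0r subr0 oppr0.
  by rewrite scaler_nat mulr2n opprD addrA subrr add0r.
have h0 := root_norm_neq0 (highest_root Phi).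
rewrite reflE !dotN mulrN mulNr mulfK // scaleNr !opprK scaler_nat mulr2n.
rewrite addrA addNr add0r dotZr divfK //; congr (_, _); ring.
Qed.

Lemma sgenK k : (sgen Phi k * sgen Phi k = 1)%g.
Proof.
apply: pact_inj => p; rewrite pactM pact1 [in LHS]sgen_pact.
have -> : aval (asimple k) (pact (sgen Phi k) p) = - aval (asimple k) p.
  by apply: oppr_inj; rewrite opprK -aval_neg -sgen_asimple aval_act.
by rewrite sgen_pact scaleNr opprK subrK.
Qed.

Lemma sgenV k : (sgen Phi k)^-1%g = sgen Phi k.
Proof. by rewrite -[RHS]mul1g -(mulVg (sgen Phi k)) -mulgA sgenK mulg1. Qed.

(** The reflection changes only the coefficient of [simple j]. A negative image forces all other
    coefficients of [a] to be 0, and reducedness leaves [a = simple j]. *)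
Lemma refl_simple_pos j a : posroot Phi a -> a <> simple j ->
  posroot Phi (refl Phi (simple j) a).
Proof.
move=> [aP [c aE]] aj; have raP := refl_root (simple_root Phi j) aP.
have [//|[_ [e eE]]] := root_cases raP; case: aj.
set t := 2 * <<a, simple j>> / <<simple j, simple j>>.
have H : (fun i => (c i + e i)%:R : R) =1 (fun i => t *+ (i == j)).
  apply: (@simple_free _ _ _ Phi); under eq_bigr do rewrite scaler_nat mulrnDr.
  rewrite big_split /= -aE -eE reflE -/t opprB addrCA subrr addr0.
  rewrite (bigD1 j) //= eqxx mulr1n big1 ?addr0 // => i /negPf ->.
  by rewrite mulr0n scale0r.
have c0 i : i != j -> c i = 0%N.
  move=> /negPf ij; have /eqP := H i.
  by rewrite ij mulr0n pnatr_eq0 addn_eq0 => /andP[/eqP].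
have aE' : a = (c j)%:R *: simple j.
  rewrite {1}aE (bigD1 j) //= big1 ?addr0 ?scaler_nat // => i /c0 ->.
  by rewrite mulr0n.
have [c1|c1] : (c j)%:R = 1 :> R \/ (c j)%:R = -1 :> R.
- by apply: (root_reduced (simple_root Phi j)); rewrite -aE'.
- by rewrite aE' c1 scale1r.
- have : 0 <= (c j)%:R :> R by rewrite ler0n.
  by rewrite c1 lerNr oppr0 ler10.
Qed.

Lemma highest_dominant k : 0 <= <<highest, simple k>>.
Proof.
rewrite leNgt; apply/negP => h0.
have [e] := highest_max (refl_root (simple_root Phi k) (highest_root Phi)).
have k0 : 0 < <<simple k, simple k>> by rewrite dot_gt0 // root0 ?simple_root.
set t := 2 * <<highest, simple k>> / <<simple k, simple k>>.
rewrite reflE -/t opprB addrCA subrr addr0 => E.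
have /(_ k) : (fun i => t *+ (i == k)) =1 (fun i => (e i)%:R : R).
  apply: (@simple_free _ _ _ Phi); rewrite (bigD1 k) //= eqxx mulr1n big1 ?addr0.
    by rewrite E; apply: eq_bigr => i _; rewrite scaler_nat.
  by move=> i /negPf ->; rewrite mulr0n scale0r.
rewrite eqxx mulr1n => tE; have : 0 <= t by rewrite tE ler0n.
by rewrite leNgt pmulr_llt0 ?invr_gt0 // pmulr_rlt0 ?h0 ?ltr0n.
Qed.

Lemma highest_pairing b : posroot Phi b -> b <> highest ->
  2 * <<b, highest>> / <<highest, highest>> = 0 \/
  2 * <<b, highest>> / <<highest, highest>> = 1.
Proof.
move=> [bP [c bE]] bh; set t := 2 * _ / _.
have hh : 0 < <<highest, highest>> by rewrite dot_gt0 // root0 ?highest_root.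
have t_int : t \is a Num.int by apply: root_int => //; apply: highest_root.
have t0 : 0 <= t.
  rewrite divr_ge0 ?(ltW hh) // mulr_ge0 ?ler0n // bE dot_suml sumr_ge0 // => k _.
  by rewrite dotMn dotC mulrn_wge0 // highest_dominant.
have [t1|t1] := leP t 1.
  have [tp|] := ltP 0 t; last by left; apply/le_anti; rewrite t0 andbT.
  by right; have := int_gt_geS (rpred0 _) t_int tp; lra.
have t2 := int_gt_geS (rpred1 _) t_int t1.
(* For [t >= 2], the differences of [highest] with [b] and with the root [t *: highest - b] are
   nonnegative combinations of simple roots, but they add up to [(2 - t) *: highest], which has no
   positive coefficient. So both vanish and [b = highest]. *)
have [f fE] := highest_max (rootN (refl_root (highest_root Phi) bP)).
have [g gE] := highest_max bP.
have [_ [h hE]] := highest_pos Phi.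
have H : (fun i => (f i + g i)%:R : R) =1 (fun i => (2 - t) * (h i)%:R).
  apply: (@simple_free _ _ _ Phi); under eq_bigr do rewrite scaler_nat mulrnDr.
  rewrite big_split /= -fE -gE reflE -/t opprK.
  under [RHS]eq_bigr do rewrite -scalerA scaler_nat.
  rewrite -scaler_sumr -hE scalerBl scaler_nat mulr2n.
  by rewrite addrACA; congr (_ + _); rewrite addrAC subrr add0r.
have g0 i : g i = 0%N.
  have := H i => E; have : 0 <= (f i + g i)%:R :> R by rewrite ler0n.
  have h0 : 0 <= (h i)%:R :> R by rewrite ler0n.
  have t20 : 2 - t <= 0 by lra.
  have := mulr_le0_ge0 t20 h0; rewrite -E => E1 E2.
  have /eqP : (f i + g i)%:R = 0 :> R by apply/le_anti/andP.
  by rewrite pnatr_eq0 addn_eq0 => /andP[_ /eqP].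
case: bh; apply/esym/eqP; rewrite -subr_eq0 gE big1 // => i _.
by rewrite g0 mulr0n.
Qed.

(** The affine form of [refl_simple_pos]. A finite simple reflection keeps the constant, so only a
    simple root with constant 0 can lose positivity. The affine one adds to the constant the pairing
    [t] with the coroot of [highest], which is 0 or 1 up to sign unless [a] is [highest] or its
    opposite; the thresholds of [apos_posroot] and [apos_negroot] then decide. *)
Lemma sgen_apos k a : aroot a -> apos a -> a <> asimple k -> apos (aact (sgen Phi k) a).
Proof.
case: a => a m [/= aP mP]; rewrite /aact /sgen /asimple.
case: unliftP => [j _|_] /=.
  rewrite dot0r subr0 => am ak; have raP := refl_root (simple_root Phi j) aP.
  have [rp|rp] := root_cases raP; [apply/(apos_posroot rp mP)|apply/(apos_negroot rp mP)].
    have [ap|ap] := root_cases aP; first exact: (apos_posroot ap mP).1 am.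
    by apply: le_trans ((apos_negroot ap mP).1 am); rewrite ler01.
  have [ap|ap] := root_cases aP; last exact: (apos_negroot ap mP).1 am.
  have [m0|m0] := eqVneq m 0.
    have aj : a <> simple j by move=> aj; apply: ak; rewrite aj m0.
    have := refl_simple_pos ap aj => rp'.
    have [p pA] := alcove_nonempty.
    have := alcove_root rp pA; have := alcove_root rp' pA; rewrite dotN.
    by move=> /andP[? _] /andP[? _]; lra.
  have m1 := (apos_posroot ap mP).1 am.
  by rewrite -[1]add0r int_gt_geS ?rpred0 // lt_def m0.
move=> am ak; rewrite !dotZr dot_refl.
set t := 2 * <<a, highest>> / <<highest, highest>>.
have h0 := root_norm_neq0 (highest_root Phi).
have -> : refl Phi highest highest = - highest.
  by rewrite reflE mulfK // scaler_nat mulr2n opprD addrA subrr add0r.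
have -> : m - 2 / <<highest, highest>> * <<a, - highest>> = m + t.
  by rewrite dotNr /t; ring.
have t_int : t \is a Num.int by apply: root_int => //; apply: highest_root.
have mtP : m + t \is a Num.int by rewrite rpredD.
have rE : refl Phi highest a = a - t *: highest by rewrite reflE.
have hp := highest_pos Phi.
have [ap|ap] := root_cases aP.
  have m0 := (apos_posroot ap mP).1 am.
  have [ah|ah] := pselect (a = highest).
    have t2 : t = 2 by rewrite /t ah mulfK.
    have -> : refl Phi highest a = - highest.
      by rewrite rE t2 ah scaler_nat mulr2n opprD addrA subrr add0r.
    by apply/apos_negroot; rewrite ?opprK //; lra.
  have [tE|tE] := highest_pairing ap ah; rewrite -/t in tE.
    by rewrite rE tE scale0r subr0 addr0.
  apply/apos_negroot => //; last by lra.
  rewrite rE tE scale1r opprB; split; last exact: highest_max.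
  have := refl_root (highest_root Phi) aP.
  by rewrite rE tE scale1r => /rootN; rewrite opprB.
have m1 := (apos_negroot ap mP).1 am.
have [ah|ah] := pselect (- a = highest).
  have aE : a = - highest by rewrite -ah opprK.
  have t2 : t = - 2 by rewrite /t aE dotN mulrN mulNr mulfK.
  have -> : refl Phi highest a = highest.
    by rewrite rE t2 aE scaleNr opprK scaler_nat mulr2n addrA addNr add0r.
  have m2 : m <> 1 by move=> m2; apply: ak; rewrite aE m2.
  have m12 : 1 < m by rewrite lt_def m1 andbT; apply/eqP.
  have := int_gt_geS (rpred1 _) mP m12 => m22.
  by apply/apos_posroot => //; lra.
have tN : 2 * <<- a, highest>> / <<highest, highest>> = - t by rewrite dotN /t; ring.
have [tE|tE] := highest_pairing ap ah; rewrite tN in tE.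
  have t0 : t = 0 by lra.
  by rewrite rE t0 scale0r subr0 addr0.
have t1 : t = -1 by lra.
have raE : refl Phi highest a = highest - - a.
  by rewrite rE t1 scaleN1r !opprK addrC.
have rp : posroot Phi (refl Phi highest a).
  split; first exact: refl_root (highest_root Phi) aP.
  by rewrite raE; apply: highest_max; rewrite rootN.
by apply/(apos_posroot rp mtP); lra.
Qed.

(** If [(a, m)] is positive and [x] makes it negative, then [0 <= m < - <<a, q>>] at [q = x^-1 p]
    for a point [p] of the alcove. There are finitely many roots, hence a uniform bound on [m]. *)
Lemma inversions_finite (x : extW) : exists A : {fset V * R},
  forall a, aroot a -> apos a -> apos (aneg (aact x a)) -> a \in A.
Proof.
have [p pA] := alcove_nonempty.
pose q := pact x^-1%g p.
pose B := \sum_(b <- Defs.root Phi) `|<<b, q>>|.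
pose N := Num.bound B.
exists [fset (b, k%:R) | b in Defs.root Phi, k in iota 0 N]%fset => -[a m] [aP mP] am xam.
have m0 : 0 <= m.
  have [ap|ap] := root_cases aP; first exact: (apos_posroot ap mP).1 am.
  by apply: le_trans ((apos_negroot ap mP).1 am); rewrite ler01.
have /intrP[z zE] := mP.
have [k kE] : exists k : nat, z = k by exists `|z|%N; rewrite gez0_abs // -(ler0z R) -zE.
have {zE}mE : m = k%:R by rewrite -[m]/(a, m).2 zE kE.
apply/imfset2P; exists a => //; exists k; last by rewrite mE.
rewrite mem_iota /= add0n -(ltr_nat R) -mE.
have := xam p pA; rewrite aval_neg aval_actV /aval /= -/q oppr_gt0 => aq.
have aB : `|<<a, q>>| <= B.
  by rewrite /B (big_fsetD1 a) //= lerDl sumr_ge0.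
have BN : B < N%:R by apply/archi_boundP/sumr_ge0.
have := ler_norm (- <<a, q>>); rewrite normrN; lra.
Qed.

End AffineRoots.

(** * Words and the length function *)

Section Coxeter.
Variables (R : realType) (V : vectType R) (d : nat) (Phi : rootSystem V d).

Local Notation extW := (extW Phi).
Local Notation sgen := (sgen Phi).
Local Notation asimple := (asimple Phi).
Local Notation apos := (apos Phi).
Implicit Types (x y z o : extW) (k j : 'I_d.+1) (s : seq 'I_d.+1).

Definition word s : extW := (\prod_(k <- s) sgen k)%g.
(** Ascents and descents in terms of affine roots; their agreement with the length ([upE], [downE])
    is a consequence of the exchange condition. *)
Definition up x k := apos (aact x (asimple k)).
Definition down x k := apos (aneg (aact x (asimple k))).

Lemma word_nil : word [::] = 1%g. Proof. exact: big_nil. Qed.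
Lemma word_cons k s : word (k :: s) = (sgen k * word s)%g. Proof. exact: big_cons. Qed.
Lemma word_cat s1 s2 : word (s1 ++ s2) = (word s1 * word s2)%g. Proof. exact: big_cat. Qed.
Lemma word1 k : word [:: k] = sgen k. Proof. by rewrite word_cons word_nil mulg1. Qed.
Lemma word_rcons s k : word (rcons s k) = (word s * sgen k)%g.
Proof. by rewrite -cats1 word_cat word1. Qed.
Lemma wordV s : (word s)^-1%g = word (rev s).
Proof.
elim: s => [|k s IH]; first by rewrite word_nil invg1.
by rewrite rev_cons word_rcons word_cons invgM IH sgenV.
Qed.

Lemma sgenKr x k : (x * sgen k * sgen k = x)%g.
Proof. by rewrite -mulgA sgenK mulg1. Qed.
Lemma sgenKl x k : (sgen k * (sgen k * x) = x)%g.
Proof. by rewrite mulgA sgenK mul1g. Qed.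

Lemma up_or_down x k : up x k \/ down x k.
Proof. exact/apos_total/aroot_act/aroot_simple. Qed.
Lemma up_not_down x k : up x k -> ~ down x k.
Proof. exact: apos_contra. Qed.
Lemma down_sgen x k : up x k -> down (x * sgen k)%g k.
Proof. by rewrite /up /down aactM sgen_asimple aact_neg anegK. Qed.
Lemma up_sgen x k : down x k -> up (x * sgen k)%g k.
Proof. by rewrite /up /down aactM sgen_asimple aact_neg. Qed.
Lemma up1 k : up 1%g k.
Proof. by rewrite /up aact1; apply: apos_simple. Qed.

Lemma OmegaV o : Omega o -> Omega o^-1%g.
Proof.
move=> oO; apply: OmegaP => k; have [//|ok] := up_or_down o^-1%g k.
have := Omega_apos oO ok; rewrite -aact_neg -aactM mulgV aact1 => /apos_contra[].
by rewrite anegK; apply: apos_simple.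
Qed.
Lemma OmegaM o o' : Omega o -> Omega o' -> Omega (o * o')%g.
Proof.
move=> oO oO'; apply: OmegaP => k; rewrite aactM; apply: Omega_apos => //.
by apply: Omega_apos => //; apply: apos_simple.
Qed.
Lemma Omega1 : Omega (1%g : extW).
Proof. by apply: OmegaP => k; apply: up1. Qed.
Lemma Omega_aposV o a : Omega o -> apos (aact o a) -> apos a.
Proof. by move=> /OmegaV oO /(Omega_apos oO); rewrite -aactM mulVg aact1. Qed.

(** Omega permutes the simple affine roots. The conjugate makes the positive root [o a_k] negative,
    so it is not in Omega and has a descent [j]; then [o^-1 a_j] is a positive root made negative by
    [s_k], and by [sgen_apos] this happens to [a_k] only. *)
Lemma conj_Omega o k : Omega o -> exists j, (o * sgen k * o^-1)%g = sgen j.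
Proof.
move=> oO; set y := (_ * _)%g.
have [j yj] : exists j, down y j.
  apply: contrapT => /forallNP yN.
  have yO : Omega y.
    by apply: OmegaP => j; have [//|/yN] := up_or_down y j.
  have ok := Omega_apos oO (@apos_simple _ _ _ Phi k).
  apply: (apos_contra ok); have := Omega_apos yO (Omega_apos oO (@apos_simple _ _ _ Phi k)).
  by rewrite -aactM /y mulgVK aactM sgen_asimple aact_neg.
exists j; rewrite /y; apply: conj_sgen.
have vj : apos (aact o^-1%g (asimple j)).
  exact/(Omega_apos (OmegaV oO))/apos_simple.
suff <- : aact o^-1%g (asimple j) = asimple k by rewrite -aactM mulgV aact1.
apply: contrapT => jk.
have := sgen_apos (aroot_act _ (aroot_simple Phi j)) vj jk.
by move=> /(Omega_apos oO); rewrite -!aactM => /apos_contra; apply.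
Qed.

(* If z(a_k) is a positive root made negative by a word, then one letter of the
   word turns it into its opposite: the root before that letter is simple. *)
Lemma exchange s z k : up z k -> down (word s * z)%g k ->
  exists s1 j s2, s = s1 ++ j :: s2 /\
    (word s * (z * sgen k * z^-1))%g = word (s1 ++ s2).
Proof.
move=> zk; elim: s => [|j s IH].
  by rewrite word_nil mul1g => /(up_not_down zk).
rewrite word_cons -mulgA => jk.
have [sk|/IH[s1 [i [s2 [-> E]]]]] := up_or_down (word s * z)%g k; last first.
  by exists (j :: s1), i, s2; rewrite -mulgA E -word_cons.
exists [::], j, s; split=> //=.
have [sE|sN] := pselect (aact (word s * z)%g (asimple k) = asimple j).
  have := conj_sgen sE; rewrite invgM => sE'.
  have -> : (z * sgen k * z^-1)%g = ((word s)^-1 * sgen j * word s)%g.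
    by rewrite -sE' !mulgA mulVg mul1g mulgVK.
  by rewrite !mulgA mulgK sgenK mul1g.
have := sgen_apos (aroot_act _ (aroot_simple Phi k)) sk sN.
by rewrite -aactM => /apos_contra; case.
Qed.

(** Multiplying by a descent removes one inversion, so induction on a finite set containing the
    inversions reaches an element without descents, which lies in Omega. *)
Lemma has_word_exists x : exists l, has_word x l.
Proof.
have [A] := inversions_finite x; have [n] := ubnP #|` A|.
elim: n => // n IH in x A *; rewrite ltnS => An AP.
have [xO|] := pselect (Omega x).
  by exists 0%N, x, [::]; split; rewrite // big_nil mulg1.
move=> xN; have [k xk] : exists k, down x k.
  apply: contrapT => /forallNP xk; apply: xN; apply: OmegaP => k.
  by have [//|/xk] := up_or_down x k.
have kA : asimple k \in A.
  by apply: AP => //; [exact: aroot_simple | exact: apos_simple].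
have [||l [o [s [oO sl xE]]]] :=
  IH (x * sgen k)%g [fset aact (sgen k) a | a in A `\ asimple k]%fset.
- rewrite (leq_ltn_trans (leq_imfset_card _ _ _)) //.
  by rewrite (leq_trans _ An) // [X in (_ < X)%N](cardfsD1 (asimple k)) kA add1n.
- move=> a aR aP; rewrite aactM => xa.
  have ak : a <> asimple k.
    move=> ak; apply: (up_not_down (up_sgen xk)).
    by rewrite /down aactM -ak.
  apply/imfsetP; exists (aact (sgen k) a); last by rewrite -aactM sgenK aact1.
  rewrite /= !inE AP ?andbT //; [|exact: aroot_act|exact: sgen_apos].
  apply/eqP => ska; have := aP; rewrite -[a](@aact1 _ _ _ Phi) -(sgenK Phi k) aactM ska.
  rewrite sgen_asimple.
  by move=> /apos_contra; rewrite anegK; apply; apply: apos_simple.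
exists l.+1, o, (rcons s k); split; rewrite ?size_rcons ?sl //.
by rewrite -/(word _) word_rcons mulgA -/(word s) -xE sgenKr.
Qed.

Lemma len_spec x : has_word x (len x) /\ forall l, has_word x l -> (len x <= l)%N.
Proof.
rewrite /len; case: xgetP => [l -> //|noP].
suff [l lP] : exists l, has_word x l /\ forall l', has_word x l' -> (l <= l')%N.
  by case: (noP l lP).
have [l0 w0] := has_word_exists x.
have ex : exists l, `[< has_word x l >] by exists l0; apply/asboolP.
exists (ex_minn ex); case: ex_minnP => m /asboolP mP mmin; split=> // l' lP.
by apply: mmin; apply/asboolP.
Qed.

Lemma len_word x : exists o s, [/\ Omega o, size s = len x & x = (o * word s)%g].
Proof. exact: (len_spec x).1. Qed.

Lemma len_le o s : Omega o -> (len (o * word s)%g <= size s)%N.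
Proof. by move=> oO; apply: (len_spec _).2; exists o, s. Qed.

(** The positive root [z a_k] is made negative by [x]. The Omega factor of [x] preserves signs, so a
    shortest word does it, and [exchange] deletes one of its letters. *)
Lemma len_reflect_down x z k : up z k -> down (x * z)%g k ->
  (len (x * (z * sgen k * z^-1))%g < len x)%N.
Proof.
move=> zk xk; have [o [s [oO <- xE]]] := len_word x.
have [|s1 [j [s2 [sE E]]]] := @exchange s z k zk.
  rewrite /down xE -mulgA [in X in aneg X]aactM -aact_neg in xk.
  exact: (@Omega_aposV o _ oO xk).
rewrite {1}xE -mulgA E sE !size_cat /= addnS ltnS -size_cat.
exact: len_le.
Qed.

Lemma reflectK z k : (z * sgen k * z^-1 * (z * sgen k * z^-1) = 1)%g.
Proof. by rewrite !mulgA mulgVK sgenKr mulgV. Qed.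

Lemma len_reflect_up x z k : up z k -> up (x * z)%g k ->
  (len x < len (x * (z * sgen k * z^-1))%g)%N.
Proof.
move=> zk xk; have := @len_reflect_down (x * (z * sgen k * z^-1))%g z k zk.
rewrite -[X in (len X < _)%N]mulgA reflectK mulg1; apply.
by rewrite !mulgA mulgVK; apply: down_sgen.
Qed.

Lemma len_mulr_le x k : (len (x * sgen k)%g <= (len x).+1)%N.
Proof.
have [o [s [oO <- ->]]] := len_word x.
by rewrite -mulgA -word_rcons -(size_rcons s k) len_le.
Qed.

Lemma len_up x k : up x k -> len (x * sgen k)%g = (len x).+1.
Proof.
move=> xk; apply/eqP; rewrite eqn_leq len_mulr_le /=.
have := @len_reflect_up x 1%g k (up1 k).
by rewrite mul1g invg1 !mulg1; apply.
Qed.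

Lemma len_down x k : down x k -> len x = (len (x * sgen k)%g).+1.
Proof. by move=> xk; rewrite -(len_up (up_sgen xk)) sgenKr. Qed.

Lemma upE x k : up x k <-> (len x < len (x * sgen k)%g)%N.
Proof.
split=> [/len_up ->//|xk]; have [//|/len_down xk'] := up_or_down x k.
by move: xk; rewrite xk' ltnNge leqnSn.
Qed.

Lemma conj_word o s : Omega o -> exists s', size s' = size s /\
  (o * word s * o^-1)%g = word s'.
Proof.
move=> oO; elim: s => [|k s [s' [ss' E]]].
  by exists [::]; rewrite word_nil mulg1 mulgV.
have [j jE] := conj_Omega k oO; exists (j :: s'); split; first by rewrite /= ss'.
by rewrite !word_cons -E -jE !mulgA !mulgVK.
Qed.

Lemma len_mul_le x y : (len (x * y)%g <= len x + len y)%N.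
Proof.
have [o [s [oO <- ->]]] := len_word x; have [o' [s' [oO' <- ->]]] := len_word y.
have [t [st E]] := conj_word s (OmegaV oO').
rewrite -st -size_cat; suff -> : (o * word s * (o' * word s') = o * o' * word (t ++ s'))%g.
  exact/len_le/OmegaM.
by rewrite word_cat -E invgK !mulgA mulgK.
Qed.

Lemma lenV x : len x^-1%g = len x.
Proof.
suff le y : (len y^-1%g <= len y)%N.
  by apply/eqP; rewrite eqn_leq le /= -{1}[x]invgK le.
have [o [s [oO <- ->]]] := len_word y.
have [t [st E]] := conj_word (rev s) oO.
have -> : ((o * word s)^-1 = o^-1 * word t)%g.
  by rewrite -E invgM wordV -mulgA mulKg.
by rewrite -(size_rev s) -st; apply/len_le/OmegaV.
Qed.

Lemma len1 : len (1%g : extW) = 0%N.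
Proof.
apply/eqP; rewrite -leqn0; have := len_le [::] Omega1.
by rewrite word_nil mulg1.
Qed.

Lemma len_sgen k : len (sgen k) = 1%N.
Proof. by rewrite -[sgen k]mul1g len_up ?len1 //; apply: up1. Qed.

End Coxeter.

(** * Double cosets and the Bruhat order *)

Section DoubleCosets.
Variables (R : realType) (V : vectType R) (d : nat) (Phi : rootSystem V d).

Local Notation extW := (extW Phi).
Local Notation sgen := (sgen Phi).
Local Notation parabolic := (@parabolic R V d Phi).
Local Notation word := (word Phi).
Implicit Types (x y z o w : extW) (k j : 'I_d.+1) (s t : seq 'I_d.+1).
Implicit Types (J K : set 'I_d.+1).

Definition letters s J := forall k, k \in s -> J k.

Lemma letters_cons k s J : letters (k :: s) J <-> J k /\ letters s J.
Proof.
split=> [sJ|[kJ sJ] j]; last by rewrite inE => /orP[/eqP ->|/sJ].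
by split=> [|j js]; apply: sJ; rewrite inE ?eqxx ?js ?orbT.
Qed.
Lemma letters_cat s t J : letters (s ++ t) J <-> letters s J /\ letters t J.
Proof.
split=> [stJ|[sJ tJ] j]; last by rewrite mem_cat => /orP[/sJ|/tJ].
by split=> j js; apply: stJ; rewrite mem_cat js ?orbT.
Qed.
Lemma letters_rev s J : letters s J -> letters (rev s) J.
Proof. by move=> sJ j; rewrite mem_rev; apply: sJ. Qed.
Lemma letters_rcons s k J : letters (rcons s k) J <-> letters s J /\ J k.
Proof.
rewrite -cats1 letters_cat letters_cons.
by split=> [[? []]|[]].
Qed.
Lemma letters_delete s1 j s2 J : letters (s1 ++ j :: s2) J -> letters (s1 ++ s2) J.
Proof. by rewrite !letters_cat letters_cons => -[? []]. Qed.

Lemma parabolic_word J s : letters s J -> parabolic J (word s).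
Proof. by exists s. Qed.
Lemma parabolicP J x : parabolic J x -> exists2 s, letters s J & x = word s.
Proof. by []. Qed.
Lemma parabolic1 J : parabolic J 1%g.
Proof. by exists [::] => //; rewrite big_nil. Qed.
Lemma parabolicM J x y : parabolic J x -> parabolic J y -> parabolic J (x * y)%g.
Proof.
move=> [s sJ ->] [t tJ ->]; rewrite -big_cat /=.
by apply: parabolic_word; apply/letters_cat.
Qed.
Lemma parabolicV J x : parabolic J x -> parabolic J x^-1%g.
Proof.
by move=> [s sJ ->]; rewrite -/(word s) wordV; apply: parabolic_word; apply: letters_rev.
Qed.
Lemma parabolic_sgen J k : J k -> parabolic J (sgen k).
Proof.
by move=> kJ; exists [:: k] => [j|]; rewrite ?big_seq1 // inE => /eqP ->.
Qed.

Definition coset2 J K x : set extW :=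
  [set y | exists a b, [/\ parabolic J a, parabolic K b & y = (a * x * b)%g]].

Lemma coset2_refl J K x : coset2 J K x x.
Proof. by exists 1%g, 1%g; rewrite mul1g mulg1; split=> //; apply: parabolic1. Qed.
Lemma coset2_sym J K x y : coset2 J K x y -> coset2 J K y x.
Proof.
move=> [a [b [aJ bK ->]]]; exists a^-1%g, b^-1%g; split; try exact: parabolicV.
by rewrite !mulgA mulVg mul1g mulgK.
Qed.
Lemma coset2_trans J K x y z : coset2 J K x y -> coset2 J K y z -> coset2 J K x z.
Proof.
move=> [a [b [aJ bK ->]]] [a' [b' [aJ' bK' ->]]]; exists (a' * a)%g, (b * b')%g.
by split; rewrite ?mulgA //; apply: parabolicM.
Qed.
Lemma coset2_left J K x y a : parabolic J a -> coset2 J K x y -> coset2 J K x (a * y)%g.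
Proof.
move=> aJ xy; apply: coset2_trans xy _; exists a, 1%g; rewrite mulg1.
by split=> //; apply: parabolic1.
Qed.
Lemma coset2_right J K x y b : parabolic K b -> coset2 J K x y -> coset2 J K x (y * b)%g.
Proof.
move=> bK xy; apply: coset2_trans xy _; exists 1%g, b; rewrite mul1g.
by split=> //; apply: parabolic1.
Qed.

Definition minimal J K x := forall y, coset2 J K x y -> (len x <= len y)%N.

Lemma minimal_exists J K w : exists2 x, coset2 J K w x & minimal J K x.
Proof.
have ex : exists l, `[< exists2 x, coset2 J K w x & len x = l >].
  by exists (len w); apply/asboolP; exists w => //; apply: coset2_refl.
case: (ex_minnP ex) => m /asboolP[x wx <-] mmin; exists x => // y xy.
by apply: mmin; apply/asboolP; exists y => //; apply: coset2_trans xy.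
Qed.

(** If [x] made the positive root [b a_k] negative, the reflection [b s_k b^-1], an element of
    [W_K], would shorten [x] inside its double coset. *)
Lemma minimal_up J K x a b k : minimal J K x -> parabolic J a -> parabolic K b ->
  up b k -> K k -> up (x * b)%g k.
Proof.
move=> xmin aJ bK bk kK; have [//|xbk] := up_or_down (x * b)%g k.
have := len_reflect_down bk xbk; rewrite ltnNge xmin //.
apply: coset2_right (coset2_refl _ _ _).
by do ?[apply: parabolicM | apply: parabolicV | apply: parabolic_sgen].
Qed.

Lemma minimalV J K x : minimal J K x -> minimal K J x^-1%g.
Proof.
move=> xmin y [a [b [aJ bK ->]]]; rewrite lenV -[(_ * _)%g]invgK lenV.
apply: xmin; exists b^-1%g, a^-1%g; split; try exact: parabolicV.
by rewrite !invgM invgK mulgA.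
Qed.

(** When the length is not additive, some added letter makes it drop, and [exchange] cancels it
    against another letter. By [minimal_up] no sign changes while passing [x], so the cancelled
    letter lies in one of the two words and the shorter expression has the same shape. *)
Lemma coset2_reduce J K x sa sb : minimal J K x -> letters sa J -> letters sb K ->
  len (word sa * x * word sb)%g = (size sa + len x + size sb)%N \/
  exists ta tb, [/\ letters ta J, letters tb K,
    (word sa * x * word sb = word ta * x * word tb)%g &
    (size ta + size tb < size sa + size sb)%N].
Proof.
move=> xmin saJ.
elim/last_ind: sb => [_|sb k IH]; last first.
  rewrite letters_rcons => -[sbK kK]; rewrite word_rcons size_rcons.
  have [E|[ta [tb [taJ tbK E lt]]]] := IH sbK; last first.
    right; exists ta, (rcons tb k); split=> //; first exact/letters_rcons.
      by rewrite word_rcons !mulgA E.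
    by rewrite size_rcons !addnS ltnS.
  have [u|u] := up_or_down (word sa * x * word sb)%g k.
    by left; rewrite mulgA len_up // E addnS.
  right; have [bk|bk] := up_or_down (word sb) k; last first.
    have [|s1 [j [s2 [sE]]]] := @exchange _ _ _ Phi sb 1%g k (@up1 _ _ _ Phi k).
      by rewrite mulg1.
    rewrite mul1g invg1 mulg1 => wE.
    exists sa, (s1 ++ s2); split=> //; last by rewrite sE !size_cat /=; lia.
      by rewrite sE in sbK; apply: letters_delete sbK.
    by rewrite wE.
  (* The root is still positive after [word sb] and after [x], so it changes sign within
     [word sa]. *)
  have xk := minimal_up xmin (parabolic_word saJ) (parabolic_word sbK) bk kK.
  rewrite -mulgA in u; have [s1 [j [s2 [sE wE]]]] := exchange xk u.
  exists (s1 ++ s2), sb; split=> //; last by rewrite sE !size_cat /=; lia.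
    by rewrite sE in saJ; apply: letters_delete saJ.
  by rewrite -wE -[in RHS](mulgA _ x) -[RHS]mulgA mulgVK !mulgA.
(* Only the left word remains. Its letters are added on the left, so ascents and the exchange are
   read off inverses. *)
rewrite word_nil mulg1 addn0.
elim: sa saJ => [_|k sa IH]; first by left; rewrite word_nil mul1g.
rewrite letters_cons => -[kJ saJ]; rewrite word_cons.
have [E|[ta [tb [taJ tbK E lt]]]] := IH saJ; last first.
  right; exists (k :: ta), tb; split=> //; first exact/letters_cons.
  by rewrite word_cons -!mulgA; congr (_ * _)%g; rewrite !mulgA.
have [u|u] := up_or_down (word sa * x)^-1%g k.
  left; rewrite -lenV -mulgA invgM sgenV len_up // lenV E /=; lia.
right; rewrite invgM wordV in u.
have [bk|bk] := up_or_down (word (rev sa)) k.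
  have := minimal_up (minimalV xmin) (parabolic1 _) (parabolic_word (letters_rev saJ)) bk kJ.
  by move/up_not_down.
have [|s1 [j [s2 [sE]]]] := @exchange _ _ _ Phi (rev sa) 1%g k (@up1 _ _ _ Phi k).
  by rewrite mulg1.
rewrite mul1g invg1 mulg1 -wordV => wE.
exists (rev (s1 ++ s2)), [::]; split=> //.
- by have := letters_rev saJ; rewrite sE => /letters_delete/letters_rev.
- rewrite -(invgK (sgen k * word sa)%g) invgM sgenV wE wordV word_nil mulg1 //.
- by have := congr1 size sE; rewrite !size_rev !size_cat /=; lia.
Qed.

Lemma coset2_reduced J K x y : minimal J K x -> coset2 J K x y ->
  exists sa sb, [/\ letters sa J, letters sb K, y = (word sa * x * word sb)%g &
    len y = (size sa + len x + size sb)%N].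
Proof.
move=> xmin [_ [_ [/parabolicP[sa saJ ->] /parabolicP[sb sbK ->] ->]]].
have [n] := ubnP (size sa + size sb); elim: n => // n IH in sa sb saJ sbK *.
rewrite ltnS => sn; have [E|[ta [tb [taJ tbK E lt]]]] := coset2_reduce xmin saJ sbK.
  by exists sa, sb.
by rewrite E; apply: IH => //; apply: leq_trans sn.
Qed.

Lemma minimal_unique J K x y : minimal J K x -> minimal J K y -> coset2 J K x y -> x = y.
Proof.
move=> xmin ymin xy; have [sa [sb [_ _ yE ylen]]] := coset2_reduced xmin xy.
have := ymin x (coset2_sym xy); rewrite ylen => le.
have sa0 : sa = [::] by apply/nilP; rewrite /nilp; lia.
have sb0 : sb = [::] by apply/nilP; rewrite /nilp; lia.
by rewrite yE sa0 sb0 word_nil mul1g mulg1.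
Qed.

Lemma len_minimal_mul J x a : minimal J set0 x -> parabolic J a ->
  len (a * x)%g = (len a + len x)%N.
Proof.
move=> xmin aJ.
have ax : coset2 J set0 x (a * x)%g by apply: coset2_left (coset2_refl _ _ _).
have [sa [sb [_ sb0 E lenE]]] := coset2_reduced xmin ax.
have {}sb0 : sb = [::] by case: sb sb0 {E lenE} => // k sb /(_ k);
  rewrite inE eqxx => /(_ isT).
move: E; rewrite sb0 word_nil mulg1 => /mulIg aE.
apply/eqP; rewrite eqn_leq len_mul_le lenE sb0 addn0 leq_add2r aE.
by have := len_le sa (@Omega1 _ _ _ Phi); rewrite mul1g.
Qed.

End DoubleCosets.

(** * Lifting properties of the Bruhat order and minimal coset representatives *)

Section Bruhat.
Variables (R : realType) (V : vectType R) (d : nat) (Phi : rootSystem V d).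

Local Notation extW := (extW Phi).
Local Notation sgen := (sgen Phi).
Implicit Types (x y z w : extW) (k j : 'I_d.+1).

Definition bruhat_le y x := y = x \/ bruhat_lt y x.

Lemma bruhat_lt_trans x y z : bruhat_lt x y -> bruhat_lt y z -> bruhat_lt x z.
Proof. exact: t_trans. Qed.
Lemma bruhat_le_lt_trans x y z : bruhat_le x y -> bruhat_lt y z -> bruhat_lt x z.
Proof. by move=> [->//|]; apply: bruhat_lt_trans. Qed.
Lemma bruhat_lt_le_trans x y z : bruhat_lt x y -> bruhat_le y z -> bruhat_lt x z.
Proof. by move=> xy [<-//|]; apply: bruhat_lt_trans. Qed.
Lemma bruhat_le_trans x y z : bruhat_le x y -> bruhat_le y z -> bruhat_le x z.
Proof. by move=> [->//|xy] yz; right; apply: bruhat_lt_le_trans yz. Qed.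

Lemma bruhat_lt_len y x : bruhat_lt y x -> (len y < len x)%N.
Proof. by elim=> [{}y {}x []//|{}y z {}x _ yz _]; apply: ltn_trans. Qed.

Lemma bruhat_lt_mulr x k : (len x < len (x * sgen k)%g)%N -> bruhat_lt x (x * sgen k)%g.
Proof.
move=> xk; apply: t_step; split=> //; exists 1%g, k.
by rewrite mul1g invg1 mulg1 sgenKr.
Qed.

Lemma bruhat_step_inv y x : bruhat_step y x -> bruhat_step y^-1%g x^-1%g.
Proof.
move=> [yx [z [k yE]]]; split; first by rewrite !lenV.
exists (x * z)%g, k; rewrite yE !invgM !invgK sgenV !mulgA.
by rewrite mulVg mul1g.
Qed.

Lemma bruhat_lt_inv y x : bruhat_lt y x -> bruhat_lt y^-1%g x^-1%g.
Proof.
elim=> [{}y {}x /bruhat_step_inv|{}y z {}x _ yz _]; first exact: t_step.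
exact: bruhat_lt_trans.
Qed.
Lemma bruhat_le_inv y x : bruhat_le y x -> bruhat_le y^-1%g x^-1%g.
Proof. by move=> [->|/bruhat_lt_inv]; [left|right]. Qed.

Lemma bruhat_lt_mull x k : (len x < len (sgen k * x)%g)%N -> bruhat_lt x (sgen k * x)%g.
Proof.
move=> xk; rewrite -[x]invgK -[(sgen k * _)%g]invgK; apply: bruhat_lt_inv.
by rewrite invgM !invgK sgenV; apply: bruhat_lt_mulr; rewrite -(sgenV Phi k) -invgM !lenV.
Qed.

Lemma bruhat_stepP y x : bruhat_step y x ->
  exists z k, [/\ up z k, down (x * z)%g k & y = (x * (z * sgen k * z^-1))%g].
Proof.
(* [z] and [z s_k] define the same reflection with opposite roots, so the root may be taken
   positive. *)
move=> [yx [z [k yE]]]; wlog zk : z yE / up z k.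
  move=> H; have [|zk] := up_or_down z k; first exact: H.
  apply: (H (z * sgen k)%g); last exact: up_sgen.
  by rewrite yE invgM sgenV !mulgA sgenKr.
exists z, k; split=> //; have [u|//] := up_or_down (x * z)%g k.
by have := len_reflect_up zk u; rewrite -yE ltnNge (ltnW yx).
Qed.

(** Right multiplication by [s_j] replaces the root of the reflection by its image under [s_j]. This
    stays positive, and the step goes the same way, unless the root is [a_j] itself; then
    [y s_j = x]. *)
Lemma bruhat_step_mulr y x j : bruhat_step y x ->
  (y * sgen j)%g = x \/ bruhat_step (y * sgen j)%g (x * sgen j)%g.
Proof.
move=> /bruhat_stepP[z [k [zk xzk yE]]].
have [zE|zN] := pselect (aact z (asimple Phi k) = asimple Phi j).
  by left; rewrite yE (conj_sgen zE) sgenKr.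
right; have jzk : up (sgen j * z)%g k.
  by rewrite /up aactM; apply: sgen_apos => //; apply/aroot_act/aroot_simple.
have E : (y * sgen j = x * sgen j * (sgen j * z * sgen k * (sgen j * z)^-1))%g.
  by rewrite yE invgM sgenV !mulgA sgenKr.
split; last by exists (sgen j * z)%g, k.
by rewrite E; apply: len_reflect_down => //; rewrite mulgA sgenKr.
Qed.

Lemma bruhat_lt_mulr_or y x j : bruhat_lt y x ->
  bruhat_le (y * sgen j)%g x \/ bruhat_lt (y * sgen j)%g (x * sgen j)%g.
Proof.
elim=> [{}y {}x|{}y z {}x yz IH1 zx IH2].
  by case/(bruhat_step_mulr j) => [->|st]; [left; left|right; apply: t_step].
case: IH1 => [yz1|yz1]; first by left; right; apply: bruhat_le_lt_trans zx.
case: IH2 => [zx1|zx1]; first by left; right; apply: bruhat_lt_le_trans zx1.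
by right; apply: bruhat_lt_trans zx1.
Qed.

Lemma bruhat_lt_up y x j : bruhat_lt y x -> up x j ->
  bruhat_lt (y * sgen j)%g (x * sgen j)%g.
Proof.
move=> yx /upE/bruhat_lt_mulr xj.
by have [yx1|//] := bruhat_lt_mulr_or j yx; apply: bruhat_le_lt_trans xj.
Qed.

(** A lifting property that makes no assumption on ascents, so that a comparison can be carried
    through an arbitrary word. *)
Lemma bruhat_le_mulr_or y x j : bruhat_le y x ->
  bruhat_le y (x * sgen j)%g \/ bruhat_le (y * sgen j)%g (x * sgen j)%g.
Proof.
case=> [->|]; first by right; left.
elim=> [{}y {}x|{}y z {}x yz IH1 zx IH2].
  case/(bruhat_step_mulr j) => [<-|st]; first by left; left; rewrite sgenKr.
  by right; right; apply: t_step.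
case: IH2 => [zx1|zx1].
  by left; right; apply: bruhat_lt_le_trans zx1.
case: IH1 => [yz1|yz1]; first by left; apply: bruhat_le_trans zx1.
by right; apply: bruhat_le_trans zx1.
Qed.

Lemma bruhat_le_mull_or y x j : bruhat_le y x ->
  bruhat_le y (sgen j * x)%g \/ bruhat_le (sgen j * y)%g (sgen j * x)%g.
Proof.
move=> /bruhat_le_inv/(bruhat_le_mulr_or j)[] /bruhat_le_inv;
  rewrite !invgM !invgK !sgenV; by [left|right].
Qed.

(** Each letter on the way from [w] to [x] either leaves the lower element in place or moves it too;
    in both cases it stays in its double coset. *)
Lemma bruhat_le_coset2 J K w' w x : bruhat_le w' w -> coset2 J K w x ->
  exists2 y, coset2 J K w' y & bruhat_le y x.
Proof.
move=> ww [_ [_ [/parabolicP[sa saJ ->] /parabolicP[sb sbK ->] ->]]].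
elim: sa saJ => [_|k sa IH /letters_cons[kJ /IH[y w'y yx]]]; last first.
  rewrite word_cons -!mulgA; rewrite -mulgA in yx.
  case: (bruhat_le_mull_or k yx) => le; first by exists y.
  by exists (sgen k * y)%g => //; apply: coset2_left => //; apply: parabolic_sgen.
rewrite word_nil mul1g; elim/last_ind: sb sbK => [_|sb k IH].
  by rewrite word_nil mulg1; exists w' => //; apply: coset2_refl.
move=> /letters_rcons[/IH[y w'y yx] kK].
rewrite word_rcons mulgA; case: (bruhat_le_mulr_or k yx) => le; first by exists y.
by exists (y * sgen k)%g => //; apply: coset2_right => //; apply: parabolic_sgen.
Qed.

(** In a factorisation of [y] with additive length, stripping the outer letters one by one must
    lower the length by exactly one each time, so it descends in the Bruhat order. *)
Lemma bruhat_le_minimal J K x y : minimal J K x -> coset2 J K x y -> bruhat_le x y.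
Proof.
move=> xmin /(coset2_reduced xmin)[sa [sb [_ _ ->]]].
have lenl k z : (len (sgen k * z)%g <= (len z).+1)%N.
  by rewrite -lenV invgM sgenV -(lenV z) len_mulr_le.
have lena s : (len (word Phi s * x)%g <= size s + len x)%N.
  have := len_le s (@Omega1 _ _ _ Phi); rewrite mul1g => le.
  by apply: leq_trans (len_mul_le _ _) _; rewrite leq_add2r.
elim/last_ind: sb => [|sb k IH] lenE; last first.
  rewrite word_rcons mulgA size_rcons addnS in lenE *.
  have le1 := len_mulr_le (word Phi sa * x * word Phi sb)%g k.
  have le2 := len_mul_le (word Phi sa * x)%g (word Phi sb).
  have le3 := lena sa; have le4 := len_le sb (@Omega1 _ _ _ Phi); rewrite mul1g in le4.
  have E : len (word Phi sa * x * word Phi sb)%g = (size sa + len x + size sb)%N.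
    rewrite lenE ltnS in le1; apply/eqP; rewrite eqn_leq le1 andbT.
    by rewrite (leq_trans le2) // leq_add.
  by apply: bruhat_le_trans (IH E) _; right; apply: bruhat_lt_mulr; rewrite E lenE.
rewrite word_nil mulg1 addn0 in lenE *.
elim: sa => [|k sa IH] in lenE *; first by left; rewrite word_nil mul1g.
rewrite word_cons -mulgA /= in lenE *.
have le1 := lenl k (word Phi sa * x)%g; have le2 := lena sa.
have E : len (word Phi sa * x)%g = (size sa + len x)%N.
  by rewrite lenE addSn ltnS in le1; apply/eqP; rewrite eqn_leq le1 le2.
by apply: bruhat_le_trans (IH E) _; right; apply: bruhat_lt_mull; rewrite E lenE addSn.
Qed.

(** Carrying [w' <= w] to the minimal element [x] gives some [z <= x] in the coset of [w'], and [y]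
    is below every element of that coset. *)
Lemma bruhat_le_minimal2 J K w' w x y : bruhat_le w' w -> minimal J K x ->
  coset2 J K x w -> minimal J K y -> coset2 J K y w' -> bruhat_le y x.
Proof.
move=> ww xmin xw ymin yw; have [z wz zx] := bruhat_le_coset2 ww (coset2_sym xw).
by apply: bruhat_le_trans zx; apply: bruhat_le_minimal ymin (coset2_trans yw wz).
Qed.

End Bruhat.

(** * The Hecke algebra *)

Section Hecke.
Variables (R : realType) (V : vectType R) (d : nat) (Phi : rootSystem V d).
Variables (H : unitAlgType laurent) (HH : heckeAlgebra Phi H).
Variables (cf : extW Phi -> H -> laurent) (cfP : coords setT (Hb HH) cf).

Local Notation extW := (extW Phi).
Local Notation sgen := (sgen Phi).
Local Notation parabolic := (@parabolic R V d Phi).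
Local Notation Hb := (Hb HH).
Local Notation c := (v^-1 - v).
Implicit Types (x y z o w : extW) (k j : 'I_d.+1) (m h : H) (J K : set 'I_d.+1).

Lemma Hb_ind (Pr : H -> Prop) : Pr 0 ->
  (forall a m h, Pr m -> Pr h -> Pr (a *: m + h)) -> (forall w, Pr (Hb w)) ->
  forall m, Pr m.
Proof.
move=> Pr0 PrD PrH m; rewrite (coords_expand cfP m).
by elim/big_rec: _ => // w y _; apply: PrD.
Qed.

Lemma cf_eq m h : (forall w, cf w m = cf w h) -> m = h.
Proof. by move=> mh; apply: (coords_eq cfP) => w _. Qed.

Lemma cf_Hb w x : cf w (Hb x) = (w == x)%:R.
Proof. exact: (coords_b cfP). Qed.

Lemma Hb1 : Hb 1%g = 1.
Proof.
rewrite -[LHS]mulr1; elim/Hb_ind: (1 : H) => [|a m h mE hE|w].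
- by rewrite mulr0.
- by rewrite mulrDr -scalerAr mE hE.
- by rewrite HbM mul1g ?len1.
Qed.

Lemma Hb_sgen2 k : Hb (sgen k) * Hb (sgen k) = 1 + c *: Hb (sgen k).
Proof.
have := Hb_quad HH k; rewrite mulrDr !mulrBl -!scalerAr -!scalerAl !mulr1 mul1r.
rewrite scalerA [X in X *: 1](_ : _ = 1) ?scale1r; last by rewrite ?vVK ?vKV.
move=> /eqP; rewrite addrAC subr_eq0 => /eqP E.
by rewrite scalerBl -E -addrA [_ *: _ - 1 - _]addrAC subrr add0r [RHS]addrC subrK.
Qed.

Lemma downE x k : down x k <-> (len (x * sgen k)%g < len x)%N.
Proof.
split=> [/len_down ->//|xk]; have [/len_up|//] := up_or_down x k.
by move=> xk'; move: xk; rewrite xk' ltnNge leqnSn.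
Qed.

Lemma HbMs_up x k : up x k -> Hb x * Hb (sgen k) = Hb (x * sgen k)%g.
Proof. by move=> xk; rewrite HbM // len_up // len_sgen addn1. Qed.

Lemma HbMs_down x k : down x k -> Hb x * Hb (sgen k) = Hb (x * sgen k)%g + c *: Hb x.
Proof.
move=> /up_sgen xk; rewrite -{1}[x](sgenKr x k) -(HbMs_up xk) -mulrA Hb_sgen2.
by rewrite mulrDr mulr1 -scalerAr (HbMs_up xk) sgenKr.
Qed.

Lemma HsMb_up x k : up x^-1%g k -> Hb (sgen k) * Hb x = Hb (sgen k * x)%g.
Proof.
move=> xk; rewrite HbM // -lenV invgM sgenV len_up // lenV len_sgen //.
Qed.

Lemma HsMb_down x k : down x^-1%g k ->
  Hb (sgen k) * Hb x = Hb (sgen k * x)%g + c *: Hb x.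
Proof.
move=> /up_sgen; rewrite -[X in (_ * X)%g](sgenV Phi k) -invgM => xk.
rewrite -{1}[x](sgenKl x k) -(HsMb_up xk) mulrA Hb_sgen2.
by rewrite mulrDl mul1r -scalerAl (HsMb_up xk) sgenKl.
Qed.

Lemma cf_mulr w m k : cf w (m * Hb (sgen k)) =
  cf (w * sgen k)%g m + if (len (w * sgen k)%g < len w)%N then c * cf w m else 0.
Proof.
have sw (y : extW) : (w == y * sgen k)%g = (w * sgen k == y)%g.
  by rewrite -(inj_eq (mulIg (sgen k))) sgenKr.
elim/Hb_ind: m => [|a m h mE hE|y].
- by rewrite mul0r !(coords0 cfP) mulr0 if_same addr0.
- rewrite mulrDl -scalerAl !(coords_linear cfP) mE hE.
  by case: ifP => _; ring.
- have [yk|yk] := up_or_down y k.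
    rewrite HbMs_up // !cf_Hb sw; case: ifP => [wk|_]; last by rewrite addr0.
    case: (eqVneq w y) => [wy|_]; last by rewrite mulr0 addr0.
    by move: wk; rewrite wy len_up // ltnNge leqnSn.
  rewrite HbMs_down // (coordsD cfP) (coordsZ cfP) !cf_Hb sw; congr (_ + _).
  case: (eqVneq w y) => [->|_]; last by rewrite mulr0 if_same.
  by move/downE: yk => ->.
Qed.

Lemma cf_mull w m k : cf w (Hb (sgen k) * m) =
  cf (sgen k * w)%g m + if (len (sgen k * w)%g < len w)%N then c * cf w m else 0.
Proof.
have sw (y : extW) : (w == sgen k * y)%g = (sgen k * w == y)%g.
  by rewrite -(inj_eq (mulgI (sgen k))) sgenKl.
elim/Hb_ind: m => [|a m h mE hE|y].
- by rewrite mulr0 !(coords0 cfP) mulr0 if_same addr0.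
- rewrite mulrDr -scalerAr !(coords_linear cfP) mE hE.
  by case: ifP => _; ring.
- have lenE : (len (sgen k * y)%g < len y)%N = (len (y^-1 * sgen k)%g < len y^-1%g)%N.
    by rewrite -(lenV (sgen k * y)%g) invgM sgenV (lenV y).
  have [yk|yk] := up_or_down y^-1%g k.
    rewrite HsMb_up // !cf_Hb sw; case: ifP => [wk|_]; last by rewrite addr0.
    case: (eqVneq w y) => [wy|_]; last by rewrite mulr0 addr0.
    by move: wk; rewrite wy lenE len_up // ltnNge leqnSn.
  rewrite HsMb_down // (coordsD cfP) (coordsZ cfP) !cf_Hb sw; congr (_ + _).
  case: (eqVneq w y) => [->|_]; last by rewrite mulr0 if_same.
  by rewrite lenE; move/downE: yk => ->.
Qed.

Definition rinv J m := forall k, J k -> m * Hb (sgen k) = v^-1 *: m.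
Definition linv J m := forall k, J k -> Hb (sgen k) * m = v^-1 *: m.

Lemma vcE : v + c = v^-1. Proof. by rewrite addrC subrK. Qed.

(* Being an eigenvector of H_s, on either side, means that v^(len w) times the
   coefficient at w does not change when w is multiplied by s on that side. *)
Lemma eigen_coef (f : H -> H) (t : extW -> extW) m : involutive t ->
  (forall w, len (t w) = (len w).+1 \/ len w = (len (t w)).+1) ->
  (forall w, cf w (f m) =
    cf (t w) m + if (len (t w) < len w)%N then c * cf w m else 0) ->
  f m = v^-1 *: m <-> forall w, v ^+ len (t w) * cf (t w) m = v ^+ len w * cf w m.
Proof.
move=> tK lent fE.
have eq_up w : len (t w) = (len w).+1 ->
    (v ^+ len (t w) * cf (t w) m = v ^+ len w * cf w m <-> cf (t w) m = v^-1 * cf w m).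
  move=> wt; rewrite wt exprSr -mulrA; split=> [/(mulrI (unitrX _ v_unit)) <-|->].
    by rewrite mulrA vVK mul1r.
  by rewrite [v * _]mulrA vKV mul1r.
split=> [mE w|mE].
  have up_case w' : len (t w') = (len w').+1 ->
      v ^+ len (t w') * cf (t w') m = v ^+ len w' * cf w' m.
    move=> wt; apply/(eq_up _ wt); have := fE w'.
    by rewrite mE (coordsZ cfP) wt ltnNge leqnSn addr0.
  have [/up_case //|wt] := lent w.
  by have := up_case (t w); rewrite tK => ->.
apply: cf_eq => w; rewrite fE (coordsZ cfP).
have [wt|wt] := lent w.
  by rewrite wt ltnNge leqnSn addr0; apply/(eq_up _ wt).
rewrite {1}wt ltnS leqnn.
have /(eq_up (t w)) : len (t (t w)) = (len (t w)).+1 by rewrite tK.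
rewrite tK mE => -[/(_ erefl) E _].
have tE : cf (t w) m = v * cf w m by rewrite E mulrA vKV mul1r.
by rewrite tE -mulrDl vcE.
Qed.

Lemma rinvP m k : m * Hb (sgen k) = v^-1 *: m <->
  forall w, v ^+ len (w * sgen k)%g * cf (w * sgen k)%g m = v ^+ len w * cf w m.
Proof.
apply: (eigen_coef (f := fun m => m * Hb (sgen k)) (t := fun w => (w * sgen k)%g)).
- by move=> w; rewrite sgenKr.
- by move=> w; have [/len_up|/len_down] := up_or_down w k; [left|right].
- by move=> w; rewrite cf_mulr.
Qed.

Lemma linvP m k : Hb (sgen k) * m = v^-1 *: m <->
  forall w, v ^+ len (sgen k * w)%g * cf (sgen k * w)%g m = v ^+ len w * cf w m.
Proof.
apply: (eigen_coef (f := fun m => Hb (sgen k) * m) (t := fun w => (sgen k * w)%g)).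
- by move=> w; rewrite sgenKl.
- move=> w; rewrite -(lenV (sgen k * w)%g) -(lenV w) invgM sgenV.
  by have [/len_up|/len_down] := up_or_down w^-1%g k; [left|right].
- by move=> w; rewrite cf_mull.
Qed.

Lemma inv_coset2 J K m x y : linv J m -> rinv K m -> coset2 J K x y ->
  v ^+ len y * cf y m = v ^+ len x * cf x m.
Proof.
move=> mJ mK [_ [_ [/parabolicP[s sJ ->] /parabolicP[t tK ->] ->]]].
elim/last_ind: t tK => [_|t k IH /letters_rcons[/IH <- kK]]; last first.
  by rewrite word_rcons mulgA; exact: (rinvP m k).1 (mK k kK) _.
rewrite word_nil mulg1; elim: s sJ => [_|k s IH /letters_cons[kJ /IH <-]].
  by rewrite word_nil mul1g.
by rewrite word_cons -mulgA; exact: (linvP m k).1 (mJ k kJ) _.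
Qed.

(** Normalised so that [v^(len w)] times the coefficient at [w] is 1 on [D]; for [D = W_gamma]
    finite it differs from [xel] by a power of [v]. *)
Definition coset_sum (D : set extW) : H := \sum_(w \in D) v ^- len w *: Hb w.

Lemma cf_fsum (D : set extW) (f : extW -> laurent) w : finite_set D ->
  cf w (\sum_(y \in D) f y *: Hb y) = if w \in D then f w else 0.
Proof.
move=> Dfin; rewrite fsbig_finite //= (coords_sum_b cfP) //.
by rewrite in_fset_set.
Qed.

Lemma cf_coset_sum D w : finite_set D -> v ^+ len w * cf w (coset_sum D) = (w \in D)%:R.
Proof.
move=> Dfin; rewrite cf_fsum //; case: ifP => _; last by rewrite mulr0.
by rewrite mulrV ?unitrX ?v_unit.
Qed.

Lemma coset_sum_rinv J K x : finite_set (coset2 J K x) -> rinv K (coset_sum (coset2 J K x)).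
Proof.
move=> fin k kK; apply/rinvP => w; rewrite !cf_coset_sum //; congr (nat_of_bool _)%:R.
have kW := parabolic_sgen Phi kK.
by apply/idP/idP => /set_mem wx; apply/mem_set; [rewrite -[w](sgenKr w k)|];
  apply: coset2_right.
Qed.

Lemma coset_sum_linv J K x : finite_set (coset2 J K x) -> linv J (coset_sum (coset2 J K x)).
Proof.
move=> fin k kK; apply/linvP => w; rewrite !cf_coset_sum //; congr (nat_of_bool _)%:R.
have kW := parabolic_sgen Phi kK.
by apply/idP/idP => /set_mem wx; apply/mem_set; [rewrite -[w](sgenKl w k)|];
  apply: coset2_left.
Qed.

(** One-sided cosets are double cosets for the empty set of generators, so parabolic subgroups
    inherit the results on double cosets. *)
Lemma coset2_parabolic J : coset2 J set0 (1%g : extW) = parabolic J.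
Proof.
apply/seteqP; split=> [_ [a [_ [aJ /parabolicP[s s0 ->] ->]]]|a aJ].
  case: s s0 => [_|k s /letters_cons[]//]; by rewrite word_nil !mulg1.
exists a, 1%g; rewrite !mulg1; split=> //; exact: parabolic1.
Qed.

Lemma coset2_parabolicr J : coset2 set0 J (1%g : extW) = parabolic J.
Proof.
apply/seteqP; split=> [_ [_ [a [/parabolicP[s s0 ->] aJ ->]]]|a aJ].
  case: s s0 => [_|k s /letters_cons[]//]; by rewrite word_nil !mul1g.
exists 1%g, a; rewrite !mul1g; split=> //; exact: parabolic1.
Qed.

Lemma parabolic_linv J : finite_set (parabolic J) -> linv J (coset_sum (parabolic J)).
Proof. by rewrite -coset2_parabolic; apply: coset_sum_linv. Qed.
Lemma parabolic_rinv J : finite_set (parabolic J) -> rinv J (coset_sum (parabolic J)).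
Proof. by rewrite -coset2_parabolicr; apply: coset_sum_rinv. Qed.

Lemma coset_sum_mul_minimal J x y : finite_set (parabolic J) -> minimal J set0 x ->
  v ^+ len y * cf y (coset_sum (parabolic J) * Hb x) =
  if y \in coset2 J set0 x then v ^+ len x else 0.
Proof.
move=> fin xmin; have -> : coset_sum (parabolic J) * Hb x =
    \sum_(w <- fset_set (parabolic J)) v ^- len w *: Hb (w * x)%g.
  rewrite /coset_sum fsbig_finite //= mulr_suml; apply: eq_big_seq => w wJ.
  rewrite in_fset_set // in wJ.
  by rewrite -scalerAl HbM // (len_minimal_mul xmin (set_mem wJ)).
rewrite (coords_sum cfP); case: ifPn => yx; last first.
  rewrite big1_fset ?mulr0 // => w wJ _; rewrite (coordsZ cfP) cf_Hb.
  case: eqP => [ywx|]; last by rewrite mulr0.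
  case/negP: yx; apply/mem_set; rewrite ywx; apply: coset2_left (coset2_refl _ _ _).
  by move: wJ; rewrite in_fset_set // => /set_mem.
have [w [b [wJ /parabolicP[s s0 bE] yE]]] := set_mem yx.
have {s0 bE}b1 : b = 1%g by rewrite bE; case: s s0 {bE} => [_|k s /letters_cons[]//];
  rewrite word_nil.
rewrite b1 mulg1 in yE.
have wF : w \in fset_set (parabolic J) by rewrite in_fset_set //; apply/mem_set.
rewrite (big_fsetD1 w) //= big1_fset => [|z].
  rewrite addr0 (coordsZ cfP) cf_Hb yE eqxx mulr1 (len_minimal_mul xmin wJ).
  by rewrite addnC exprD mulrK // unitrX ?v_unit.
rewrite !inE => /andP[zw _] _; rewrite (coordsZ cfP) cf_Hb yE.
by rewrite (inj_eq (mulIg x)) eq_sym (negPf zw) mulr0.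
Qed.

(** By [inv_coset2] the coefficients of [m] on a coset [W_J x] follow from the one at its minimal
    element [x], and they are those of a multiple of the sum over [W_J] times [Hb x]. Subtracting
    this multiple empties the coset and shrinks the support. *)
Lemma linv_coset_sum_mul J m : finite_set (parabolic J) -> linv J m ->
  exists h, m = coset_sum (parabolic J) * h.
Proof.
move=> fin; have [n] := ubnP #|` csupp setT cf m|.
elim: n => // n IH in m *; rewrite ltnS => mn mJ.
have [->|m0] := eqVneq m 0; first by exists 0; rewrite mulr0.
have m0K : rinv set0 m by move=> k [].
have [w mw] : exists w, cf w m <> 0.
  apply: contrapT => /forallNP mw; case/eqP: m0; apply: cf_eq => w.
  by rewrite (coords0 cfP); apply: contrapT.
have [x wx xmin] := minimal_exists J set0 w.
have mx : cf x m <> 0.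
  move=> mx; have := inv_coset2 mJ m0K wx; rewrite mx mulr0 => /esym E.
  by apply: mw; apply: (mulrI (unitrX (len w) v_unit)); rewrite E mulr0.
have [||h hE] := IH (m - cf x m *: (coset_sum (parabolic J) * Hb x)).
- have sub : (csupp setT cf (m - cf x m *: (coset_sum (parabolic J) * Hb x)) `<=`
      csupp setT cf m `\ x)%fset.
    apply/fsubsetP => y /(csuppP cfP)[_]; rewrite (coordsB cfP) (coordsZ cfP) => yN.
    have yE := coset_sum_mul_minimal y fin xmin.
    have [yx|yx] := boolP (y \in coset2 J set0 x).
      case: yN; apply: (mulrI (unitrX (len y) v_unit)); rewrite mulr0 mulrBr.
      rewrite mulrCA yE yx (inv_coset2 mJ m0K (set_mem yx)) [cf x m * _]mulrC.
      by rewrite subrr.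
    have y0 : cf y (coset_sum (parabolic J) * Hb x) = 0.
      by apply: (mulrI (unitrX (len y) v_unit)); rewrite yE (negPf yx) mulr0.
    rewrite !inE; apply/andP; split.
      by apply: contraNneq yx => ->; apply/mem_set/coset2_refl.
    by apply/(csuppP cfP); split=> // ym; apply: yN; rewrite ym y0 mulr0 subr0.
  have xS : x \in csupp setT cf m by apply/(csuppP cfP).
  by apply: leq_ltn_trans (fsubset_leq_card sub) _; rewrite (cardfsD1 x) xS add1n in mn.
- move=> k kJ; rewrite mulrBr mJ // -scalerAr mulrA parabolic_linv //.
  by rewrite -scalerAl scalerBr !scalerA [v^-1 * _]mulrC.
exists (h + cf x m *: Hb x); rewrite mulrDr -hE -scalerAr subrK //.
Qed.

Lemma rinv_mul_word J m s : rinv J m -> letters s J -> len (word Phi s) = size s ->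
  m * Hb (word Phi s) = v ^- size s *: m.
Proof.
move=> mJ; elim/last_ind: s => [_ _|s k IH /letters_rcons[sJ kJ]].
  by rewrite word_nil Hb1 mulr1 expr0 invr1 scale1r.
rewrite word_rcons size_rcons => E.
have le := len_mulr_le (word Phi s) k; rewrite E ltnS in le.
have le' := len_le s (@Omega1 _ _ _ Phi); rewrite mul1g in le'.
have sE : len (word Phi s) = size s by apply/eqP; rewrite eqn_leq le le'.
have su : up (word Phi s) k by apply/upE; rewrite E sE.
rewrite -(HbMs_up su) mulrA IH // -scalerAl mJ // scalerA exprS.
by rewrite invrM ?unitrX ?v_unit.
Qed.

(** [Hb w] with [w] in [W_J] multiplies [m] by [v^-(len w)] and carries the same weight in the sum,
    whence the Poincare polynomial of [W_J] in [v^-2]. *)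
Lemma rinv_mul_parabolic J m : finite_set (parabolic J) -> rinv J m ->
  m * coset_sum (parabolic J) =
  (\sum_(w <- fset_set (parabolic J)) v ^- (len w + len w)) *: m.
Proof.
move=> fin mJ; rewrite /coset_sum fsbig_finite //= mulr_sumr scaler_suml.
apply: eq_big_seq => w; rewrite in_fset_set // => /set_mem wJ.
have min1 : minimal J set0 (1%g : extW) by move=> y _; rewrite len1.
have [|sa [sb [saJ]]] := @coset2_reduced _ _ _ Phi J set0 1%g w min1.
  by rewrite coset2_parabolic.
case: sb => [_|k sb /letters_cons[]//]; rewrite word_nil !mulg1 len1 !addn0 => wE lw.
rewrite -scalerAr {2}wE (rinv_mul_word mJ) -?wE // -lw scalerA.
by rewrite exprD invrM ?unitrX ?v_unit.
Qed.

(* Multiplying by the sum over W_J acts on m as a nonzero scalar. *)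
Lemma parabolic_annihilator J m h : finite_set (parabolic J) -> rinv J m ->
  coset_sum (parabolic J) * h = 0 -> m * h = 0.
Proof.
move=> fin mJ h0; have := rinv_mul_parabolic fin mJ.
set P := (\sum_(_ <- _) _) => PE.
have P0 : P != 0.
  apply: sum_vV_neq0 => E; have : 1%g \in fset_set (parabolic J).
    by rewrite in_fset_set //; apply/mem_set/parabolic1.
  by rewrite -[_ \in _]/(_ \in (fset_set _ : seq _)) E.
have : P *: (m * h) = 0 by rewrite scalerAl -PE -mulrA h0 mulr0.
move=> E; apply: cf_eq => w; rewrite (coords0 cfP).
have := congr1 (cf w) E; rewrite (coordsZ cfP) (coords0 cfP).
by case/laurent_integral => // /eqP; rewrite (negPf P0).
Qed.

(** * The bar involution of the Hecke algebra *)

Section Bar.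
Variables (bar : {rmorphism H -> H}) (barP : is_bar HH bar).

Lemma bar_vV : bar v^-1%:A = v%:A.
Proof.
have : bar v%:A * bar v^-1%:A = 1.
  by rewrite -rmorphM -scalerAl mul1r scalerA vKV scale1r rmorph1.
rewrite (bar_v barP) => /(congr1 (fun m => v%:A * m)).
by rewrite mulr1 -!scalerAl !mul1r scalerA vKV scale1r.
Qed.

(** A ring morphism with prescribed value at [v] is determined on all scalars; semilinearity of
    [bar] over [lbar] follows. *)
Lemma barA a : bar a%:A = (lbar a)%:A.
Proof.
move: a; apply: (lbar_ind (P := fun a b => bar a%:A = b%:A)) => [|a b E]; last first.
  have -> : (v^-1 * a)%:A = v^-1%:A * a%:A :> H by rewrite -scalerAl mul1r scalerA.
  by rewrite rmorphM E bar_vV -scalerAl mul1r scalerA.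
elim/poly_ind => [|p e IH]; first by rewrite !ev0 !scale0r rmorph0.
rewrite !evE.
have E (a b : laurent) : (a * b + e%:~R)%:A = a%:A * b%:A + e%:~R :> H.
  by rewrite scalerDl -scalerAl mul1r scalerA scaler_int.
by rewrite !E rmorphD rmorphM rmorph_int IH (bar_v barP).
Qed.

Lemma barZ a m : bar (a *: m) = lbar a *: bar m.
Proof. by rewrite -[m in LHS]mul1r scalerAl rmorphM barA -scalerAl mul1r. Qed.

Lemma lbar_vV : lbar v^-1 = v.
Proof. by rewrite -[v^-1]mulr1 lbar_vVM -(ev1 v) lbar_ev !ev1 mulr1. Qed.

Lemma lbar_c : lbar c = - c.
Proof.
rewrite lbarD lbar_vV.
have -> : lbar (- v) = - v^-1.
  by have := lbar_ev (- 'X); rewrite !evE.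
by rewrite opprB.
Qed.

Lemma bar_sgen k : bar (Hb (sgen k)) = Hb (sgen k) - c%:A.
Proof.
rewrite (bar_gen barP); have E : Hb (sgen k) * (Hb (sgen k) - c%:A) = 1.
  by rewrite mulrBr Hb_sgen2 -scalerAr mulr1 addrK.
have E' : (Hb (sgen k) - c%:A) * Hb (sgen k) = 1.
  by rewrite mulrBl Hb_sgen2 -scalerAl mul1r addrK.
have u : Hb (sgen k) \is a GRing.unit by apply/unitrP; exists (Hb (sgen k) - c%:A).
by apply: (mulrI u); rewrite mulrV // E.
Qed.

Lemma length_ind (Pr : extW -> Prop) : (forall o, Omega o -> Pr o) ->
  (forall x k, up x k -> Pr x -> Pr (x * sgen k)%g) -> forall x, Pr x.
Proof.
move=> PrO PrS x; have [n] := ubnP (len x); elim: n => // n IH in x *.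
rewrite ltnS => xn; have [xO|xN] := pselect (Omega x); first exact: PrO.
have [k xk] : exists k, down x k.
  apply: contrapT => /forallNP xk; apply: xN; apply: OmegaP => k.
  by have [//|/xk] := up_or_down x k.
rewrite -(sgenKr x k); apply: PrS; first exact: up_sgen.
by apply: IH; rewrite -(len_down xk).
Qed.

(** For an ascent [k], [bar (Hb (x s_k))] is [bar (Hb x) * (Hb s_k - c)]. Its support lies in the
    lower interval of [x] and in that interval multiplied by [s_k]; both are below [x s_k], the
    second by [bruhat_lt_up]. *)
Lemma bar_Hb x : cf x (bar (Hb x)) = 1 /\
  forall w, cf w (bar (Hb x)) <> 0 -> bruhat_le w x.
Proof.
elim/length_ind: x => [o oO|x k xk [x1 xb]].
  rewrite (bar_Omega barP oO) cf_Hb eqxx; split=> // w; rewrite cf_Hb.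
  by case: eqP => // -> _; left.
have E w : cf w (bar (Hb (x * sgen k)%g)) = cf (w * sgen k)%g (bar (Hb x)) +
    (if (len (w * sgen k)%g < len w)%N then c * cf w (bar (Hb x)) else 0) -
    c * cf w (bar (Hb x)).
  rewrite -(HbMs_up xk) rmorphM bar_sgen mulrBr -scalerAr mulr1.
  by rewrite (coordsB cfP) (coordsZ cfP) cf_mulr.
have xlt : bruhat_lt x (x * sgen k)%g by apply/bruhat_lt_mulr/upE.
split; first by rewrite E sgenKr x1 len_up // leqnn addrK.
move=> w; rewrite E => wN.
have [w0|/eqP/xb wx] := eqVneq (cf w (bar (Hb x))) 0; last first.
  by right; apply: bruhat_le_lt_trans xlt.
move: wN; rewrite w0 mulr0 if_same addr0 subr0 => /xb[<-|wx].
  by left; rewrite sgenKr.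
by right; have := bruhat_lt_up wx xk; rewrite sgenKr.
Qed.

Lemma barK : involutive bar.
Proof.
elim/Hb_ind => [|a m h mE hE|x]; first by rewrite !rmorph0.
  rewrite !rmorphD !barZ mE hE; congr (_ *: _ + _).
  exact: lbarK.
elim/length_ind: x => [o oO|x k xk IH]; first by rewrite !(bar_Omega barP oO).
rewrite -(HbMs_up xk) !rmorphM IH bar_sgen rmorphB bar_sgen barA lbar_c.
by rewrite scaleNr opprK subrK.
Qed.

(** Applying [bar] gives eigenvalue [v] for the inverse [Hb s_k - c], hence [v + c = v^-1] again for
    [Hb s_k]. *)
Lemma bar_rinv J m : rinv J m -> rinv J (bar m).
Proof.
move=> mJ k kJ; have := congr1 bar (mJ k kJ).
rewrite rmorphM barZ bar_sgen mulrBr -scalerAr mulr1 => /eqP.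
rewrite subr_eq -scalerDl => /eqP ->; congr (_ *: _).
by rewrite lbar_vV vcE.
Qed.

Lemma bar_linv J m : linv J m -> linv J (bar m).
Proof.
move=> mJ k kJ; have := congr1 bar (mJ k kJ).
rewrite rmorphM barZ bar_sgen mulrBl -scalerAl mul1r => /eqP.
rewrite subr_eq -scalerDl => /eqP ->; congr (_ *: _).
by rewrite lbar_vV vcE.
Qed.

End Bar.
End Hecke.

(** * Orbits *)

Section Orbits.
Variables (R : realType) (V : vectType R) (d : nat) (Phi : rootSystem V d).
Variables (n : nat) (Xf : set (coweight Phi)).
Hypotheses (Xf_inv : ract_invariant n Xf) (Xf_fund : fund_domain n Xf).

Local Notation "<< x , y >>" := (dot Phi x y) (format "<< x ,  y >>").
Local Notation simple := (Defs.simple Phi).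
Local Notation Lambda := (Lambda n Xf).
Local Notation irep := (irep n Xf).
Local Notation ract := (ract n).
Implicit Types (i j : coweight Phi) (x y : extW Phi).

Lemma simple_norm_gt0 k : 0 < <<simple k, simple k>>.
Proof. by rewrite dot_gt0 //; apply: (@root0 _ _ _ Phi); apply: simple_root. Qed.

Lemma fund_simple i k : fund n i ->
  <<simple k, i>> <= 0 /\ - <<simple k, i>> < n%:R * <<simple k, simple k>>.
Proof.
move=> /(_ _ (simple_pos Phi k)) /andP[]; have k0 := simple_norm_gt0 k.
rewrite ltr_pdivlMr // ler_pdivrMr // mul0r [<<coweight_val i, _>>]dotC; split; nra.
Qed.

Lemma weyl_actMn (w : weyl Phi) i m : weyl_act w (i *+ m) = weyl_act w i *+ m.
Proof.
have w0 : weyl_act w 0 = 0 by apply/val_inj; rewrite /= linear0.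
by elim: m => [|m IH]; rewrite ?mulr0n // !mulrS weyl_actD IH.
Qed.

Lemma ractM i x y : ract i (x * y)%g = ract (ract i x) y.
Proof.
rewrite /Defs.ract /= invgM weyl_actM; congr weyl_act.
rewrite mulrnDl opprD addrA [LHS]weyl_actD weyl_actN weyl_actMn -weyl_actM mulVg.
by rewrite weyl_act1.
Qed.

Lemma orbit_eq i j : Defs.orbit n i j -> Defs.orbit n j = Defs.orbit n i.
Proof.
move=> [x ->]; apply/seteqP; split=> _ [y ->]; first by exists (x * y)%g; rewrite ractM.
by exists (x^-1 * y)%g; rewrite -ractM mulVKg.
Qed.

(** A point of [fund] pairs nonpositively with the simple roots, so it is itself a candidate and the
    default of [irep] is not taken. *)
Lemma irepP g : Lambda g -> [/\ Ff n Xf (irep g), antidominant (irep g) & g (irep g)].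
Proof.
move=> gL; rewrite /Defs.irep; set S := (X in xget _ X).
suff : exists i, S i by move/(xgetPex 0).
have [i [[[iF iX] gi] _]] := Xf_fund gL; exists i; split=> //.
  by exists 1%g, i; rewrite weyl_act1.
by move=> k; have [] := fund_simple k iF.
Qed.

Lemma irep_Xf g : Lambda g -> Xf (irep g).
Proof.
move=> /irepP[[w [i [[iF iX] ->]]] _ _].
have := Xf_inv (ExtW 0 w^-1%g) iX.
by rewrite /Defs.ract /= invgK mul0rn subr0.
Qed.

(** A coweight is determined by its pairings with the simple roots; these are integers, and bounded
    on [fund]. *)
Lemma fund_finite : finite_set (@fund R V d Phi n).
Proof.
pose N := (\sum_(k < d) Num.bound (n%:R * <<simple k, simple k>>)%R)%N.
pose f (e : {ffun 'I_d -> 'I_N}) : coweight Phi :=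
  xget 0 [set i : coweight Phi | forall k, <<simple k, i>> = - (e k : nat)%:R].
apply: (@sub_finite_set _ _ (f @` setT)); last by apply: finite_image; apply: finite_finset.
move=> i iF.
have e_ex k : exists e : 'I_N, <<simple k, i>> = - (e : nat)%:R.
  have [i0 iN] := fund_simple k iF.
  have /coweight_predP/(_ _ (simple_root Phi k))/intrP[z zE] := coweight_valP i.
  have zN : 0 <= - z by rewrite oppr_ge0 -(lerz0 R) -zE.
  have zE' : - <<simple k, i>> = (`|z|%N)%:R.
    by have := gez0_abs zN; rewrite abszN zE -mulrNz => <-; rewrite -pmulrn.
  have lt : (`|z| < N)%N.
    rewrite -(ltr_nat R) -zE'; apply: lt_le_trans iN _.
    apply: le_trans (ltW (archi_boundP _)) _.
      by rewrite mulr_ge0 ?ler0n // ltW ?simple_norm_gt0.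
    by rewrite ler_nat /N (bigD1 k) //= leq_addr.
  by exists (Ordinal lt); rewrite -[LHS]opprK zE'.
have [e eE] := choice e_ex; exists [ffun k => e k] => //.
rewrite /f; case: xgetP => [j _ jE|/(_ i)[k]]; last by rewrite ffunE.
apply/val_inj/eqP; rewrite -subr_eq0; apply/eqP/(@dot_simple_eq0 _ _ _ Phi) => k.
by rewrite dotDr dotNr jE eE ffunE subrr.
Qed.

Lemma Lambda_finite : finite_set Lambda.
Proof.
apply: (@sub_finite_set _ _ (Defs.orbit n @` (@fund R V d Phi n))); last first.
  exact/finite_image/fund_finite.
move=> g gL; have [i [[[iF _] gi] _]] := Xf_fund gL; exists i => //.
by case: gL gi => j _ ->; apply: orbit_eq.
Qed.

End Orbits.

(** * The affine q-Schur algebra *)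

Section Schur.
Variables (R : realType) (V : vectType R) (d : nat) (Phi : rootSystem V d).
Variables (n : nat) (Xf : set (coweight Phi)).
Hypotheses (Xf_inv : ract_invariant n Xf) (Xf_fund : fund_domain n Xf).
Variables (H : unitAlgType laurent) (HH : heckeAlgebra Phi H).
Variables (T : lmodType laurent) (TT : tensorSpace n Xf HH T).
Variables (iota : T -> set (coweight Phi) -> H) (iotaP : is_orbit_iso TT iota).
Variables (cf : extW Phi -> H -> laurent) (cfP : coords setT (Hb HH) cf).

Local Notation extW := (extW Phi).
Local Notation Lam := (Lambda n Xf).
Local Notation J := (Jset n Xf).
Local Notation Wpar := (Wpar n Xf).
Local Notation dcoset := (dcoset n Xf).
Local Notation Dmin := (Dmin n Xf).
Local Notation Hb := (Hb HH).
Local Notation coset_sum := (coset_sum HH).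
Local Notation rinv := (rinv HH).
Local Notation linv := (linv HH).
Local Notation ug g := (u TT (irep n Xf g)).
Local Notation component := (component iota).
Implicit Types (g h : set (coweight Phi)) (w : extW) (m : H) (f : schur TT).

Lemma vexpB (a b : nat) : v ^ (a%:Z - b%:Z) = v ^+ a * v ^- b.
Proof. by rewrite exprzDr ?v_unit // exprnN. Qed.

Lemma iotaD x y g : iota (x + y) g = iota x g + iota y g.
Proof. by rewrite -[x]scale1r (iota_linear iotaP) !scale1r. Qed.
Lemma iota0 g : iota 0 g = 0.
Proof. by apply: (addrI (iota 0 g)); rewrite -iotaD !addr0. Qed.
Lemma iotaZ a x g : iota (a *: x) g = a *: iota x g.
Proof. by rewrite -[a *: x]addr0 (iota_linear iotaP) iota0 addr0. Qed.
Lemma iota_sum (I : Type) (r : seq I) (F : I -> T) g :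
  iota (\sum_(i <- r) F i) g = \sum_(i <- r) iota (F i) g.
Proof. by apply: (big_morph (fun x => iota x g)) => [x y|]; rewrite ?iotaD ?iota0. Qed.

Lemma iota_out x g : ~ Lam g -> iota x g = 0.
Proof. by move=> gN; have [+ _] := iota_image iotaP (iota x); case;
  [exists x | move=> _; apply]. Qed.

Lemma iota_in x g : Lam g -> exists a, iota x g = xel n Xf HH g * a.
Proof. by have [+ _] := iota_image iotaP (iota x); case; [exists x | move=> + _; apply]. Qed.

Lemma iota_eq x y : (forall g, Lam g -> iota x g = iota y g) -> x = y.
Proof.
move=> xy; apply: (iota_inj iotaP); apply/funext => g.
by have [/xy//|gN] := pselect (Lam g); rewrite !iota_out.
Qed.

(* The vector u_(i_gamma) is nonzero, while an infinite W_gamma would give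
   x_gamma the junk value 0. *)
Lemma Wpar_finite g : Lam g -> finite_set (Wpar g).
Proof.
move=> gL; apply: contrapT => inf.
have x0 : xel n Xf HH g = 0.
  apply: fsbig_dflt => fin; apply: inf; apply: sub_finite_set fin => w wW; split=> //= /=.
  move=> /(congr1 (cf w)); rewrite (coordsZ cfP) (coords_b cfP) // eqxx mulr1.
  rewrite (coords0 cfP) vexpB.
  move=> E; have : v ^+ len (longest (Wpar g)) * v ^- len w \is a GRing.unit.
    by rewrite unitrMl ?unitrV unitrX ?v_unit.
  by rewrite E unitr0.
have u0 : ug g = 0.
  apply: iota_eq => g' _; rewrite (iota_u iotaP) // iota0 x0.
  by case: eqP.
have [e eP] := basis_coords (u_basis TT).
have := coords_b eP (irep_Xf Xf_inv Xf_fund gL) (irep_Xf Xf_inv Xf_fund gL).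
by rewrite u0 (coords0 eP) eqxx => /esym/eqP; rewrite oner_eq0.
Qed.

Lemma xelE g : Lam g -> xel n Xf HH g = v ^+ len (longest (Wpar g)) *: coset_sum (Wpar g).
Proof.
move=> /Wpar_finite fin; rewrite /xel /coset_sum !fsbig_finite //= scaler_sumr.
by apply: eq_bigr => w _; rewrite vexpB scalerA.
Qed.

Lemma xel_rinv g : Lam g -> rinv (J g) (xel n Xf HH g).
Proof.
move=> gL k kJ; rewrite xelE // -scalerAl.
by rewrite (parabolic_rinv cfP (Wpar_finite gL) kJ) !scalerA mulrC.
Qed.

Lemma xel_linv g : Lam g -> linv (J g) (xel n Xf HH g).
Proof.
move=> gL k kJ; rewrite xelE // -scalerAr.
by rewrite (parabolic_linv cfP (Wpar_finite gL) kJ) !scalerA mulrC.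
Qed.

Lemma dcoset_finite g h x : Lam g -> Lam h -> finite_set (dcoset g x h).
Proof.
move=> gL hL; apply: sub_finite_set
  (finite_image2 (fun a b => (a * x * b)%g) (Wpar_finite gL) (Wpar_finite hL)).
by move=> _ [a [b [aW bW ->]]]; exists a => //; exists b.
Qed.

Lemma longestP g h x : Lam g -> Lam h ->
  dcoset g x h (longest (dcoset g x h)) /\
  forall y, dcoset g x h y -> (len y <= len (longest (dcoset g x h)))%N.
Proof.
move=> gL hL; have fin := dcoset_finite x gL hL.
have xD : dcoset g x h x := coset2_refl (J g) (J h) x.
suff ex : exists w, [set w | dcoset g x h w /\ forall y, dcoset g x h y -> (len y <= len w)%N] w.
  exact: (xgetPex 1%g ex).
have ex : exists l, `[< exists2 w, dcoset g x h w & len w = l >].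
  by exists (len x); apply/asboolP; exists x.
have bound l : `[< exists2 w, dcoset g x h w & len w = l >] ->
    (l <= \sum_(w <- fset_set (dcoset g x h)) len w)%N.
  move=> /asboolP[w wD <-]; rewrite (big_fsetD1 w) ?leq_addr //=.
  by rewrite in_fset_set //; apply/mem_set.
case: (ex_maxnP ex bound) => l /asboolP[w wD <-] wmax; exists w; split=> // y yD.
by apply: wmax; apply/asboolP; exists y.
Qed.

Lemma schur_linear f : linear (schur_val f).
Proof. by case: f => f /= /asboolP[]. Qed.
Lemma schur_act f x a : schur_val f (act TT x a) = act TT (schur_val f x) a.
Proof. by case: f => f /= /asboolP[]. Qed.
Lemma schurD f x y : schur_val f (x + y) = schur_val f x + schur_val f y.
Proof. by have := schur_linear f 1 x y; rewrite !scale1r. Qed.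
Lemma schur0 f : schur_val f 0 = 0.
Proof. by apply: (addrI (schur_val f 0)); rewrite -schurD !addr0. Qed.
Lemma schurZ f a x : schur_val f (a *: x) = a *: schur_val f x.
Proof. by rewrite -[a *: x]addr0 schur_linear schur0 addr0. Qed.
Lemma schur_sum f (I : Type) (r : seq I) (F : I -> T) :
  schur_val f (\sum_(i <- r) F i) = \sum_(i <- r) schur_val f (F i).
Proof. by apply: (big_morph (schur_val f)) => [x y|]; rewrite ?schurD ?schur0. Qed.

(** Each component of [iota x] is a right multiple of [xel g], the image of a generator, and [iota]
    is injective. Hence an endomorphism is determined by its components. *)
Lemma tensor_generated x : exists hh : set (coweight Phi) -> H,
  x = \sum_(g <- fset_set Lam) act TT (ug g) (hh g).
Proof.
have ex g : exists a, Lam g -> iota x g = xel n Xf HH g * a.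
  by have [/(iota_in x)[a aE]|] := pselect (Lam g); [exists a | exists 0].
have [hh hhE] := choice ex; exists hh.
have LF := Lambda_finite Xf_fund.
apply: iota_eq => g gL; rewrite iota_sum.
have gF : g \in fset_set Lam by rewrite in_fset_set //; apply/mem_set.
rewrite (big_fsetD1 g) //= big1_fset => [|g'].
  by rewrite addr0 (iota_act iotaP) (iota_u iotaP) // eqxx hhE.
rewrite !inE => /andP[gg' g'F] _; rewrite (iota_act iotaP) (iota_u iotaP).
  by rewrite eq_sym (negPf gg') mul0r.
by move: g'F; rewrite in_fset_set // => /set_mem.
Qed.

Lemma component_inj f f' : (forall g h, Lam g -> Lam h ->
  component f g h = component f' g h) -> f = f'.
Proof.
move=> ff'; apply/val_inj/funext => x /=; have [hh ->] := tensor_generated x.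
rewrite !schur_sum; apply: eq_big_seq => h; rewrite in_fset_set; last exact: Lambda_finite.
move=> /set_mem hL; rewrite !schur_act; congr act.
by apply: iota_eq => g gL; apply: ff'.
Qed.

Lemma component_linear a f f' g h :
  component (a *: f + f') g h = a *: component f g h + component f' g h.
Proof. exact: (iota_linear iotaP). Qed.
Lemma component0 g h : component (0 : schur TT) g h = 0.
Proof. exact: iota0. Qed.
Lemma componentZ a f g h : component (a *: f) g h = a *: component f g h.
Proof. exact: iotaZ. Qed.

Lemma component_linv f g h : Lam g -> linv (J g) (component f g h).
Proof.
move=> gL k kJ; have [a aE] := iota_in (f (ug h)) gL.
by rewrite /Defs.component aE mulrA xel_linv // -scalerAl.
Qed.

Lemma component_rinv f g h : Lam h -> rinv (J h) (component f g h).
Proof.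
move=> hL k kJ; rewrite /Defs.component -(iota_act iotaP) -schur_act -iotaZ -schurZ.
congr (iota (schur_val f _) g); apply: iota_eq => g' _.
rewrite (iota_act iotaP) iotaZ !(iota_u iotaP) //; case: eqP => _.
  exact: xel_rinv.
by rewrite mul0r scaler0.
Qed.

(** The endomorphism sends the element with components [xel h * hh h] to the one whose component at
    [g] is the sum of the [m g h * hh h]. The left eigenvector property puts this sum into [x_g H],
    by [linv_coset_sum_mul]. *)
Lemma component_exists (m : set (coweight Phi) -> set (coweight Phi) -> H) :
  (forall g h, Lam g -> Lam h -> linv (J g) (m g h) /\ rinv (J h) (m g h)) ->
  exists f, forall g h, Lam g -> Lam h -> component f g h = m g h.
Proof.
move=> mP; have LF := Lambda_finite Xf_fund.
have LFP g : g \in fset_set Lam -> Lam g by rewrite in_fset_set // => /set_mem.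
have lifts x : exists hh, forall h, Lam h -> iota x h = xel n Xf HH h * hh h.
  have ex g : exists a, Lam g -> iota x g = xel n Xf HH g * a.
    by have [/(iota_in x)[a aE]|] := pselect (Lam g); [exists a | exists 0].
  by have [hh hhE] := choice ex; exists hh.
(* [hh h] is unique only up to the right annihilator of [xel h]; [parabolic_annihilator] shows that
   [m g h] is killed by it too. *)
have wd g (hh hh' : set (coweight Phi) -> H) : Lam g ->
    (forall h, Lam h -> xel n Xf HH h * hh h = xel n Xf HH h * hh' h) ->
    \sum_(h <- fset_set Lam) m g h * hh h = \sum_(h <- fset_set Lam) m g h * hh' h.
  move=> gL E; apply: eq_big_seq => h /LFP hL; apply/eqP; rewrite -subr_eq0 -mulrBr.
  apply/eqP; apply: (parabolic_annihilator cfP (Wpar_finite hL) (mP g h gL hL).2).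
  have : xel n Xf HH h * (hh h - hh' h) = 0 by rewrite mulrBr E // subrr.
  rewrite xelE // -scalerAl => /(congr1 ( *:%R (v ^- len (longest (Wpar h))))).
  by rewrite scalerA mulVr ?unitrX ?v_unit // scale1r scaler0.
have ex x : exists y, forall hh, (forall h, Lam h -> iota x h = xel n Xf HH h * hh h) ->
    forall g, Lam g -> iota y g = \sum_(h <- fset_set Lam) m g h * hh h.
  have [hh hhE] := lifts x.
  have [_ img] := iota_image iotaP
    (fun g => if `[< Lam g >] then \sum_(h <- fset_set Lam) m g h * hh h else 0).
  have [|y yE] := img.
    split=> [g gL|g gN]; last by case: asboolP.
    rewrite asboolT //.
    have mx h : exists a, Lam h -> m g h = xel n Xf HH g * a.
      have [hL|] := pselect (Lam h); last by exists 0.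
      have [a aE] := linv_coset_sum_mul cfP (Wpar_finite gL) (mP g h gL hL).1.
      exists (v ^- len (longest (Wpar g)) *: a) => _.
      by rewrite xelE // -scalerAl -scalerAr scalerA mulrV ?unitrX ?v_unit // scale1r.
    have [a aE] := choice mx; exists (\sum_(h <- fset_set Lam) a h * hh h).
    by rewrite mulr_sumr; apply: eq_big_seq => h /LFP hL; rewrite aE // mulrA.
  exists y => hh' hh'E g gL; rewrite -yE asboolT //.
  by apply: wd => // h hL; rewrite -hhE // hh'E.
have [F FP] := choice ex.
have F_schur : F \in schur_pred TT.
  apply/asboolP; split=> [a x y|x b]; apply: iota_eq => g gL.
    have [hx hxE] := lifts x; have [hy hyE] := lifts y.
    rewrite (iota_linear iotaP) (FP x hx) // (FP y hy) //.
    rewrite (FP _ (fun h => a *: hx h + hy h)) //; last first.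
      by move=> h hL; rewrite (iota_linear iotaP) hxE // hyE // mulrDr -scalerAr.
    rewrite scaler_sumr -big_split /=; apply: eq_bigr => h _.
    by rewrite mulrDr -scalerAr.
  have [hx hxE] := lifts x; rewrite (iota_act iotaP) (FP x hx) //.
  rewrite (FP _ (fun h => hx h * b)) //; last first.
    by move=> h hL; rewrite (iota_act iotaP) hxE // mulrA.
  by rewrite mulr_suml; apply: eq_bigr => h _; rewrite mulrA.
exists (Defs.Schur F_schur) => g h gL hL; rewrite /Defs.component /=.
rewrite (FP _ (fun h' => if h' == h then 1 else 0)) // => [|h' h'L].
  rewrite (big_fsetD1 h) //=; last by rewrite in_fset_set //; apply/mem_set.
  rewrite eqxx mulr1 big1_fset ?addr0 // => h'; rewrite !inE => /andP[/negPf -> _] _.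
  by rewrite mulr0.
by rewrite (iota_u iotaP) //; case: eqP => [->|_]; rewrite ?mulr1 ?mulr0.
Qed.

(** The image of [xel h] under the standard basis element, with coefficient 1 at the longest element
    of the coset. *)
Definition scaled_coset_sum g x h : H :=
  v ^+ len (longest (dcoset g x h)) *: coset_sum (dcoset g x h).

Lemma dcoset_linv g x h : Lam g -> Lam h -> linv (J g) (coset_sum (dcoset g x h)).
Proof. by move=> gL hL; apply: (coset_sum_linv cfP (dcoset_finite x gL hL)). Qed.
Lemma dcoset_rinv g x h : Lam g -> Lam h -> rinv (J h) (coset_sum (dcoset g x h)).
Proof. by move=> gL hL; apply: (coset_sum_rinv cfP (dcoset_finite x gL hL)). Qed.

(** [component_exists] realises the components required of [phi], so its default is not taken; the
    powers of [v] in [phi] and [std] combine into that of [scaled_coset_sum]. *)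
Lemma component_std g x h g' h' : Lam g -> Lam h -> Lam g' -> Lam h' ->
  component (std TT iota (g, x, h)) g' h' =
    if (g' == g) && (h' == h) then scaled_coset_sum g x h else 0.
Proof.
move=> gL hL gL' hL'; rewrite /std componentZ.
pose m g' h' := if (g' == g) && (h' == h) then
  v ^+ len (longest (Wpar h)) *: coset_sum (dcoset g x h) else 0.
have [|f fE] := @component_exists m.
  move=> g1 h1 g1L h1L; rewrite /m; case: ifP => [/andP[/eqP -> /eqP ->]|_]; last first.
    by split=> k _; rewrite ?mulr0 ?mul0r scaler0.
  split=> k kJ.
    by rewrite -scalerAr (dcoset_linv x gL hL kJ) !scalerA mulrC.
  by rewrite -scalerAl (dcoset_rinv x gL hL kJ) !scalerA mulrC.
have sumE : \sum_(w \in dcoset g x h) v ^ (- (len w)%:Z) *: Hb w = coset_sum (dcoset g x h).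
  rewrite /coset_sum !fsbig_finite //; try exact: dcoset_finite.
  by apply: eq_bigr => w _; rewrite exprnN.
have -> : component (phi TT iota (g, x, h)) g' h' = m g' h'.
  rewrite /phi; set S := (X in xget _ X).
  have Sf : S f by move=> g1 h1 g1L h1L; rewrite fE // /m sumE.
  have := xgetPex 0 (ex_intro _ _ Sf) => /(_ g' h' gL' hL') ->.
  by rewrite /m sumE.
rewrite /m; case: ifP => _; last by rewrite scaler0.
by rewrite vexpB scalerA -mulrA mulVr ?unitrX ?v_unit // mulr1.
Qed.

Definition scf (t : triple Phi) f : laurent :=
  cf (longest (dcoset t.1.1 t.1.2 t.2)) (component f t.1.1 t.2).

Lemma Dmin_unique g h x y w : Dmin g h x -> Dmin g h y ->
  dcoset g x h w -> dcoset g y h w -> x = y.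
Proof.
move=> xmin ymin xw yw; apply: (@minimal_unique _ _ _ Phi (J g) (J h)) => //.
by apply: (@coset2_trans _ _ _ Phi _ _ _ w) => //; apply: coset2_sym.
Qed.

Lemma scf_std t t' : Xi n Xf t -> Xi n Xf t' -> scf t (std TT iota t') = (t == t')%:R.
Proof.
case: t t' => [[g x] h] [[g' x'] h'] [/= gL xD hL] [/= gL' xD' hL'].
rewrite /scf /= component_std //.
have [gg|gg] := eqVneq g g'; last first.
  by rewrite (coords0 cfP) !xpair_eqE (negPf gg).
have [hh|hh] := eqVneq h h'; last first.
  by rewrite /= (coords0 cfP) !xpair_eqE (negPf hh) andbF.
subst g' h'; rewrite !xpair_eqE !eqxx andbT /= /scaled_coset_sum (coordsZ cfP).
have fin := dcoset_finite x' gL hL.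
have [LD _] := longestP x gL hL.
have [<-|xx] := eqVneq x x'.
  by rewrite (cf_coset_sum cfP) ?mem_set //; apply: dcoset_finite.
have LN : (longest (dcoset g x h) \in dcoset g x' h) = false.
  apply/negbTE/negP => /set_mem LD'; case/eqP: xx.
  exact: (Dmin_unique xD xD' LD LD').
have E := cf_coset_sum cfP (longest (dcoset g x h)) fin; rewrite LN in E.
have -> : cf (longest (dcoset g x h)) (coset_sum (dcoset g x' h)) = 0.
  by apply: (mulrI (unitrX (len (longest (dcoset g x h))) v_unit)); rewrite E mulr0.
by rewrite mulr0.
Qed.

Lemma scf_coords : coords (Xi n Xf) (std TT iota) scf.
Proof.
split.
- by move=> t a f f'; rewrite /scf component_linear (coords_linear cfP).
- move=> f; pose S := \bigcup_(g in Lam) \bigcup_(h in Lam)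
    [set w | setT w /\ cf w (component f g h) != 0].
  have Sfin : finite_set S.
    apply: bigcup_finite => [|g _]; first exact: Lambda_finite.
    apply: bigcup_finite => [|h _]; first exact: Lambda_finite.
    exact: (coords_fin cfP).
  (* A triple is recovered from the longest element of its coset, as the coset has only one minimal
     element; so finitely many nonzero coefficients allow finitely many triples. *)
  pose rep (p : set (coweight Phi) * extW * set (coweight Phi)) : triple Phi :=
    (p.1.1, xget 1%g [set x | Dmin p.1.1 p.2 x /\ dcoset p.1.1 x p.2 p.1.2], p.2).
  have Lfin := Lambda_finite Xf_fund.
  apply: sub_finite_set
    (finite_image rep (finite_setX (finite_setX Lfin Sfin) Lfin)).
  move=> [[g x] h] [[/= gL xD hL] tN].
  have [LD _] := longestP x gL hL.
  exists (g, longest (dcoset g x h), h).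
    by split=> //; split=> //; exists g => //; exists h.
  rewrite /rep /=; congr (_, _, _); case: xgetP => [y _ [yD yL]|/(_ x)[]] //.
  exact: (Dmin_unique yD xD yL LD).
- move=> f f0; apply: component_inj => g h gL hL; rewrite component0.
  apply: (cf_eq cfP) => w; rewrite (coords0 cfP).
  have [x wx xmin] := minimal_exists (J g) (J h) w.
  have [LD _] := longestP x gL hL.
  have t_Xi : Xi n Xf (g, x, h) by split.
  have wL : coset2 (J g) (J h) w (longest (dcoset g x h)).
    by apply: coset2_trans wx _; apply: LD.
  have := inv_coset2 cfP (component_linv f h gL) (component_rinv f g hL) wL.
  have /= := f0 _ t_Xi; rewrite /scf /= => ->; rewrite mulr0 => E.
  by apply: (mulrI (unitrX (len w) v_unit)); rewrite -E mulr0.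
- exact: scf_std.
Qed.

(** * The bar involution of the q-Schur algebra *)

Section Bar.
Variables (bar : {rmorphism H -> H}) (barP : is_bar HH bar).

Lemma component_bar f g h : Lam g -> Lam h ->
  component (schur_bar iota bar f) g h = bar (component f g h).
Proof.
move=> gL hL; have [|f' f'E] := @component_exists (fun g h => bar (component f g h)).
  move=> g1 h1 g1L h1L; split; first exact/(bar_linv barP)/component_linv.
  exact/(bar_rinv barP)/component_rinv.
rewrite /schur_bar; set S := (X in xget _ X).
have Sf : S f' by [].
by have := xgetPex 0 (ex_intro _ _ Sf); apply.
Qed.

Lemma schur_bar_linear a f f' : schur_bar iota bar (a *: f + f') =
  lbar a *: schur_bar iota bar f + schur_bar iota bar f'.
Proof.
apply: component_inj => g h gL hL; rewrite component_linear !component_bar //.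
by rewrite component_linear rmorphD (barZ barP).
Qed.

Lemma schur_barK : involutive (schur_bar iota bar : schur TT -> schur TT).
Proof.
move=> f; apply: component_inj => g h gL hL; rewrite !component_bar //.
exact: (barK cfP barP).
Qed.

Lemma bar_scaled_coset_sum g x h w : Lam g -> Lam h ->
  cf w (bar (scaled_coset_sum g x h)) <> 0 ->
  exists2 z, dcoset g x h z & bruhat_le w z.
Proof.
move=> gL hL; have fin := dcoset_finite x gL hL.
rewrite /scaled_coset_sum (barZ barP) (coordsZ cfP) /coset_sum fsbig_finite //= rmorph_sum.
rewrite (coords_sum cfP) => wN; apply: contrapT => zN; apply: wN.
rewrite big1_fset ?mulr0 // => z; rewrite in_fset_set // => /set_mem zD _ /=.
rewrite (barZ barP) (coordsZ cfP).
have [->|/eqP wz] := eqVneq (cf w (bar (Hb z))) 0; first by rewrite mulr0.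
by case: zN; exists z => //; apply: (bar_Hb cfP barP z).2.
Qed.

(** An element [z] of the coset other than the longest one [L] does not contribute: [bar (Hb z)] is
    supported below [z], and [L] is at least as long as [z]. The scalar of the term of [L] is 1. *)
Lemma bar_scaled_coset_sum_longest g x h : Lam g -> Lam h ->
  cf (longest (dcoset g x h)) (bar (scaled_coset_sum g x h)) = 1.
Proof.
move=> gL hL; have fin := dcoset_finite x gL hL.
have [LD Lmax] := longestP x gL hL; set L := longest _ in LD Lmax *.
have -> : scaled_coset_sum g x h =
    \sum_(z <- fset_set (dcoset g x h)) (v ^+ len L * v ^- len z) *: Hb z.
  rewrite /scaled_coset_sum /coset_sum fsbig_finite //= scaler_sumr.
  by apply: eq_bigr => z _; rewrite scalerA.
rewrite rmorph_sum (coords_sum cfP) (big_fsetD1 L) /=; last first.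
  by rewrite in_fset_set //; apply/mem_set.
rewrite (barZ barP) (coordsZ cfP) mulrV ?unitrX ?v_unit // lbar1 mul1r.
rewrite (bar_Hb cfP barP L).1 big1_fset ?addr0 // => z.
rewrite !inE in_fset_set // => /andP[zL /set_mem zD] _ /=.
rewrite (barZ barP) (coordsZ cfP).
have [->|/eqP Lz] := eqVneq (cf L (bar (Hb z))) 0; first by rewrite mulr0.
case: ((bar_Hb cfP barP z).2 _ Lz) => [Lz'|/bruhat_lt_len]; first by rewrite Lz' eqxx in zL.
by rewrite ltnNge Lmax.
Qed.

Definition triple_lt (t t' : triple Phi) :=
  [/\ t.1.1 = t'.1.1, t.2 = t'.2 & bruhat_lt t.1.2 t'.1.2].

Lemma scf_bar_std t : Xi n Xf t -> scf t (schur_bar iota bar (std TT iota t)) = 1.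
Proof.
case: t => [[g x] h] [/= gL xD hL]; rewrite /scf /= component_bar // component_std //.
by rewrite !eqxx; apply: bar_scaled_coset_sum_longest.
Qed.

(** A nonzero coordinate puts the longest element of the coset of [x] below some element of the
    coset of [x'], and passing to minimal elements gives [x <= x']. *)
Lemma scf_bar_std_lt t t' : Xi n Xf t -> Xi n Xf t' ->
  scf t (schur_bar iota bar (std TT iota t')) <> 0 -> t = t' \/ triple_lt t t'.
Proof.
case: t t' => [[g x] h] [[g' x'] h'] [/= gL xD hL] [/= gL' xD' hL'].
rewrite /scf /= component_bar // component_std //.
case: ifP => [/andP[/eqP gg /eqP hh]|_]; last by rewrite rmorph0 (coords0 cfP).
subst g' h' => /(bar_scaled_coset_sum gL hL)[z zD le].
have [LD _] := longestP x gL hL.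
have [->|lt] := bruhat_le_minimal2 le xD' zD xD LD; first by left.
by right.
Qed.

(** Translates the finitely supported sums of [std_coset] into the coordinate condition of
    [canonical_for]; the fixed outer indices are absorbed into [triple_lt]. *)
Lemma std_cosetP t f : Xi n Xf t ->
  std_coset iota t f <-> forall t', Xi n Xf t' -> scf t' (f - std TT iota t) <> 0 ->
    triple_lt t' t /\ vZv (scf t' (f - std TT iota t)).
Proof.
case: t => [[g x] h] [/= gL xD hL].
have sumE (F : {fset extW}) (e : extW -> laurent) t' : Xi n Xf t' ->
    (forall y, y \in F -> Dmin g h y) ->
    scf t' (\sum_(y <- F) e y *: std TT iota (g, y, h)) =
    if [&& t'.1.1 == g, t'.2 == h & t'.1.2 \in F] then e t'.1.2 else 0.
  move=> t'X FD; rewrite (coords_sum scf_coords).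
  have term y : y \in F -> scf t' (e y *: std TT iota (g, y, h)) =
      e y * (t' == (g, y, h))%:R.
    by move=> /FD yD; rewrite (coordsZ scf_coords) scf_std.
  case: ifP => [/and3P[/eqP g' /eqP h' yF]|tN].
    rewrite (big_fsetD1 t'.1.2) //= term // big1_fset => [|y].
      by rewrite addr0 -g' -h' -!surjective_pairing eqxx mulr1.
    rewrite !inE => /andP[yN yF'] _; rewrite term //; case: eqP => [E|]; last by rewrite mulr0.
    by case/eqP: yN; rewrite E.
  apply: big1_fset => y yF _; rewrite term //; case: eqP => [E|]; last by rewrite mulr0.
  by move: tN; rewrite E /= !eqxx yF.
split=> [[e [eP ->]] t' t'X|fP].
  rewrite [X in scf t' X]addrC addKr sumE //; last by move=> y /eP[].
  by case: ifP => [/and3P[/eqP g' /eqP h' /eP[_ lt ve]]|].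
set q := f - _ in fP.
pose F := [fset t'.1.2 | t' in csupp (Xi n Xf) scf q]%fset.
have FP y : y \in F -> [/\ Dmin g h y, bruhat_lt y x, scf (g, y, h) q <> 0 &
    vZv (scf (g, y, h) q)].
  move=> /imfsetP[[[g' y'] h'] /(csuppP scf_coords)[t'X qN] /= ->].
  have [[/= gg hh lt] vq] := fP _ t'X qN; subst g' h'.
  by case: t'X.
pose e : {fsfun extW -> laurent with 0} := [fsfun y in F => scf (g, y, h) q].
have eF y : y \in finsupp e -> y \in F.
  by rewrite mem_finsupp fsfunE; case: ifP => // _; rewrite eqxx.
exists e; split=> [y /eF yF|].
  by rewrite fsfunE yF; have [] := FP y yF.
rewrite -[LHS](subrK (std TT iota (g, x, h))) addrC -/q; congr (_ + _).
apply: (coords_eq scf_coords) => t' t'X; rewrite sumE // => [|y /eF/FP[]//].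
have [q0|/eqP qN] := eqVneq (scf t' q) 0.
  rewrite q0; case: ifP => // /and3P[/eqP g' /eqP h' /eF yF].
  rewrite fsfunE yF -g' -h' -!surjective_pairing q0 //.
have [[/= g' h' lt] vq] := fP _ t'X qN.
have yF : t'.1.2 \in F by apply/imfsetP; exists t' => //=; apply/(csuppP scf_coords).
have tE : (g, t'.1.2, h) = t' by rewrite -g' -h' -!surjective_pairing.
have eE : e t'.1.2 = scf t' q by rewrite fsfunE yF tE.
by rewrite g' h' !eqxx mem_finsupp eE; move/eqP: (qN) => ->.
Qed.

End Bar.
End Schur.

Theorem proposition2p6 (R : realType) (V : vectType R) (d : nat)
    (Phi : rootSystem V d) (n : nat) (n_ge2 : (2 <= n)%N)
    (Xf : set (coweight Phi)) (Xf_inv : ract_invariant n Xf)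
    (Xf_fund : fund_domain n Xf)
    (H : unitAlgType laurent) (HH : heckeAlgebra Phi H)
    (bar : {rmorphism H -> H}) (barP : is_bar HH bar)
    (T : lmodType laurent) (TT : tensorSpace n Xf HH T)
    (iota : T -> set (coweight Phi) -> H) (iotaP : is_orbit_iso TT iota) :
  exists C : triple Phi -> schur TT,
    [/\ is_basis (Xi n Xf) C,
        forall t, Xi n Xf t ->
          schur_bar iota bar (C t) = C t /\ std_coset iota t (C t)
      & forall C' : triple Phi -> schur TT,
          (forall t, Xi n Xf t ->
             schur_bar iota bar (C' t) = C' t /\ std_coset iota t (C' t)) ->
          forall t, Xi n Xf t -> C' t = C t].
Proof.
have [cf cfP] := basis_coords (Hb_basis HH).
have lt_trans (t1 t2 t3 : triple Phi) : triple_lt t1 t2 ->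
    triple_lt t2 t3 -> triple_lt t1 t3.
  move=> [g12 h12 l12] [g23 h23 l23]; split; rewrite ?g12 ?h12 //.
  exact: bruhat_lt_trans l23.
have lt_len (t1 t2 : triple Phi) : triple_lt t1 t2 -> (len t1.1.2 < len t2.1.2)%N.
  by move=> [_ _ /bruhat_lt_len].
have scfP := scf_coords Xf_inv Xf_fund iotaP cfP.
have [C [Cb CP CU]] := canonical_basis scfP lt_trans lt_len
  (schur_bar_linear Xf_inv Xf_fund iotaP cfP barP)
  (schur_barK Xf_inv Xf_fund iotaP cfP barP)
  (scf_bar_std Xf_inv Xf_fund iotaP cfP barP)
  (scf_bar_std_lt Xf_inv Xf_fund iotaP cfP barP).
have cosetP t f := @std_cosetP _ _ _ _ _ _ Xf_inv Xf_fund _ _ _ _ _ iotaP _ cfP t f.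
exists C; split=> // [t tX|C' C'P t tX].
  by have [Cinv CC] := CP t tX; split=> //; apply/cosetP.
by have [C'inv /cosetP C'C] := C'P t tX; apply: CU => //; split=> //; apply: C'C.
Qed.
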